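(* Let $(\zeta(x))_{x>0}$, $\Phi$ and $\mathcal{I}$ be as in the context. Let $h:[0,1]\to\mathbb{R}$ be continuous with $\int_0^1|h(t)|^pt^{-1}\,dt<\infty$ for some $p\in\mathcal{I}\cap(0,1]$. For $a\in(0,1)$ define $$\int_{(a,1]}\zeta(x)\,dh(x):=\zeta(1)h(1)-\zeta(a)h(a)-\int_{(a,1]}h(x)\,d\zeta(x).$$ Then $\int_{(a,1]}\zeta(x)\,dh(x)$ converges in $L^p$ as $a\downarrow0$.
   Context: Let $\mathcal{G}$ be the space of Lipschitz functions $f:\mathbb{R}\to\mathbb{R}$ with the norm $|f(0)|+L_f$, where $L_f=\sup_{x\neq y}|f(y)-f(x)|/|x-y|$, and its Borel $\sigma$-algebra. Let $\nu$ be a probability measure on $\mathcal{G}$, $f$ a random element with distribution $\nu$, and assume $\mathbf{E}L_f<\infty$, $\mathbf{E}\log L_f<0$ and $\mathbf{E}|f(z_0)-z_0|<\infty$ for a fixed $z_0\in\mathbb{R}$. Let $\Phi(p)=\mathbf{E}L_f^p$ and $\mathcal{I}=\{p>0:\Phi(p)<1\}$. Let $\mathcal{P}$ be a Poisson process on $[0,\infty)\times[0,\infty)\times\mathcal{G}$ with intensity $\mathrm{Leb}\otimes\mathrm{Leb}\otimes\nu$. For $x>0$, enumerate the points $(t_k,x_k,f_k)$ of $\mathcal{P}$ with $x_k\le x$ so that $t_1<t_2<\cdots$, let $N_x(t)$ be the number of them with $t_k\le t$, and set $\zeta_t(x)=f_1\circ\cdots\circ f_{N_x(t)}(z_0)$.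 Almost surely the limit $\zeta(x)=\lim_{t\to\infty}\zeta_t(x)$ exists simultaneously for all $x>0$; the process has c\`adl\`ag paths of finite variation on compact subintervals of $(0,\infty)$, and $\int_{(a,1]}h\,d\zeta$ denotes the Riemann--Stieltjes integral, equal to $\sum_{y\in(a,1]}h(y)(\zeta(y)-\zeta(y-))$. *)

(* Defs.v *)
From HB Require Import structures.
From mathcomp Require Import all_boot all_order all_algebra.
From mathcomp Require Import all_classical all_reals all_analysis.
Import Order.TTheory GRing.Theory Num.Theory.
Import numFieldNormedType.Exports.

Set Implicit Arguments.
Unset Strict Implicit.
Unset Printing Implicit Defensive.

Local Open Scope classical_set_scope.
Local Open Scope ring_scope.

Definition lipschitz (R : realType) (f : R -> R) : Prop :=
  exists L : R, forall x y : R, `|f y - f x| <= L * `|y - x|.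

(** L_f = sup_{x <> y} |f y - f x| / |y - x| (meaningful for Lipschitz f) *)
Definition lipconst (R : realType) (f : R -> R) : R :=
  sup [set r : R | exists x y : R, x != y /\ r = `|f y - f x| / `|y - x|].

Record Lip (R : realType) := MkLip { lfun :> R -> R ; lfunP : lipschitz lfun }.

HB.instance Definition _ (R : realType) := gen_eqMixin (Lip R).
HB.instance Definition _ (R : realType) := gen_choiceMixin (Lip R).

Lemma lipschitz0 (R : realType) : lipschitz (fun _ : R => 0 : R).
Proof. by exists 0 => x y; rewrite subrr normr0 mul0r. Qed.

HB.instance Definition _ (R : realType) :=
  isPointed.Build (Lip R) (MkLip (@lipschitz0 R)).

Definition Lf (R : realType) (f : Lip R) : R := lipconst (lfun f).

Definition lipdist (R : realType) (f g : Lip R) : R :=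
  `|g 0 - f 0| + lipconst (fun x => g x - f x).

Definition lip_open (R : realType) : set (set (Lip R)) :=
  [set A | forall f, A f -> exists2 e : R, 0 < e &
             forall g, lipdist f g < e -> A g].

Definition LipG (R : realType) := g_sigma_algebraType (@lip_open R).

Definition count_event (Omega T : Type) (N : Omega -> set T) (B : set T)
  (k : nat) : set Omega :=
  [set w | ((N w `&` B) #= `I_k)%card].

Definition poisson_process (R : realType) d (Omega : measurableType d)
  (P : probability Omega R) dT (T : measurableType dT)
  (mu : set T -> \bar R) (N : Omega -> set T) : Prop :=
  (forall B k, measurable B -> (mu B < +oo)%E ->
     measurable (count_event N B k) /\
     P (count_event N B k) =
       (expR (- fine (mu B)) * fine (mu B) ^+ k / (k`!)%:R)%:E) /\
  (forall (n : nat) (B : 'I_n -> set T) (k : 'I_n -> nat),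
     (forall i, measurable (B i)) -> (forall i, (mu (B i) < +oo)%E) ->
     (forall i j, i != j -> B i `&` B j = set0) ->
     P (\bigcap_(i in [set: 'I_n]) count_event N (B i) (k i)) =
       (\prod_(i < n) P (count_event N (B i) (k i)))%E).

Definition pts_space (R : realType) : set ((R * R) * LipG R)%type :=
  [set p | 0 <= p.1.1 /\ 0 <= p.1.2].

Definition pp_intensity (R : realType) (nu : probability (LipG R) R)
  (B : set ((R * R) * LipG R)%type) : \bar R :=
  (((@lebesgue_measure R) \x (@lebesgue_measure R)) \x nu)%E
    (B `&` @pts_space R).

Definition time_enum (R : realType) (S : set ((R * R) * LipG R)%type)
  (l : seq ((R * R) * LipG R)%type) : Prop :=
  sorted (fun p q => p.1.1 < q.1.1) l /\ (forall p, S p <-> p \in l).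

(** f_1 o ... o f_n (z0) for the points of S enumerated by increasing time
   (default z0 if no such enumeration exists, a null event) *)
Definition compose_pts (R : realType) (z0 : R)
  (S : set ((R * R) * LipG R)%type) : R :=
  xget z0 [set v | exists l, time_enum S l /\
                   v = foldr (fun p z => lfun p.2 z) z0 l].

Definition zeta_t (R : realType) (z0 : R) (S : set ((R * R) * LipG R)%type)
  (t x : R) : R :=
  compose_pts z0 (S `&` [set p | 0 <= p.1.1 <= t /\ 0 <= p.1.2 <= x]).

Definition zeta (R : realType) (z0 : R) (S : set ((R * R) * LipG R)%type)
  (x : R) : R :=
  lim (zeta_t z0 S t x @[t --> +oo]).

Definition is_RS_integral (R : realType) (h g : R -> R) (a b I : R) : Prop :=
  forall e : R, 0 < e -> exists2 d : R, 0 < d &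
    forall (n : nat) (p xi : nat -> R),
      p 0%N = a -> p n = b ->
      (forall i, (i < n)%N -> p i < p i.+1) ->
      (forall i, (i < n)%N -> p i.+1 - p i < d) ->
      (forall i, (i < n)%N -> p i <= xi i <= p i.+1) ->
      `| \sum_(i < n) h (xi i) * (g (p i.+1) - g (p i)) - I | < e.

Definition RS_integral (R : realType) (h g : R -> R) (a b : R) : R :=
  xget 0 [set I | is_RS_integral h g a b I].

Definition zeta_dh (R : realType) (z0 : R) (h : R -> R)
  (S : set ((R * R) * LipG R)%type) (a : R) : R :=
  zeta z0 S 1 * h 1 - zeta z0 S a * h a - RS_integral h (zeta z0 S) a 1.

Definition elog (R : realType) (x : R) : \bar R :=
  if x == 0 then -oo%E else (ln x)%:E.

(* Main.v *)
(** Fix [0 < x <= y <= 1] with [y - x] small compared with [x].  A point of level at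
    most [x] contracts all the compositions defining [zeta z], [x <= z <= y], by a
    factor [a] with mean [E a^p = Phi < 1]; such points come at rate [x], whereas the
    points of level in [(x, y]], the only ones responsible for the increments of [zeta]
    on [[x, y]], come at rate [y - x].  Cutting time into cells of length [1 / x] and
    dominating each cell by products over its Poisson points gives a variable [V] with
      [sum_i |zeta z_(i+1) - zeta z_i|^p <= V] for all partitions of [[x, y]], and
      [E V <= K (y - x) / x].
    By subadditivity of [t |-> t^p], [zeta] has bounded variation and the integral of
    [h] with respect to [zeta] on [[x, y]] has [p]-th power at most [(sup |h|^p) V].
    Summing over a fine partition of a dyadic block bounds the [p]-th moment of the
    integral over the block by a constant times the integral of [2 |h t|^p / t + 1]
    over that block, so the integrals over the dyadic blocks are summable in L^p.
    The boundary term is small since [E |zeta a|^p] is bounded and integrability of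
    [|h t|^p / t] forces [h 0 = 0]. *)
Require Import Defs.
From HB Require Import structures.
From mathcomp Require Import all_boot all_order all_algebra.
From mathcomp Require Import all_classical all_reals all_analysis.
From mathcomp Require Import measurable_realfun.
From mathcomp Require Import ring lra.
Import Order.TTheory GRing.Theory Num.Theory.
Import numFieldNormedType.Exports.
Local Open Scope classical_set_scope.
Local Open Scope ring_scope.
Set Implicit Arguments.
Unset Strict Implicit.
Unset Printing Implicit Defensive.

(** * Powers and Lipschitz constants *)

(** The maps are composed with the earliest one outermost, so waiting longer only changes the
    innermost argument. Recursions therefore peel off the first time cell, and what remains depends
    on later points only. Inside a cell the bounds are products over its points: products forget the
    order of the points, and the exponential formula for Poisson processes gives their means, so no
    conditioning on times or marks is needed. With cells of length [1 / x] the mean number of points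
    of level at most [x] per cell is one, so the constants depend on [Phi] and [beta] alone; this
    uniformity is what turns [(y - x) / x], summed over a partition, into the weight [1 / t]. The
    other obstacle is measurability. [zeta] and the Stieltjes integral are defined samplewise, by
    choice and by limits that may fail to exist. Bounds are therefore integrated through measurable
    dominating variables, the process is replaced by a modification whose configurations are all
    separated, and the limit variable is set to 0 off the event where the dominating variables are
    finite. *)

Section powR_subadditivity.
Context {R : realType}.
Variable p : R.
Hypothesis p01 : 0 < p <= 1.
Implicit Types x y : R.

Let p0 : 0 < p. Proof. by case/andP: p01. Qed.
Let pN0 : p != 0. Proof. by rewrite gt_eqF. Qed.

Lemma powR_le_mono x y : 0 <= x -> x <= y -> x `^ p <= y `^ p.
Proof.
move=> x0 xy; apply: ge0_ler_powR => //; rewrite ?nnegrE ?(ltW p0) //.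
exact: le_trans xy.
Qed.

Lemma powR_unit_ge x : 0 <= x <= 1 -> x <= x `^ p.
Proof.
case/andP=> x0 x1; move: x0; rewrite le_eqVlt => /predU1P[<-|x0].
  exact: powR_ge0.
rewrite -[leLHS](powRr1 (ltW x0)); apply: ger_powR; rewrite ?x0//.
by case/andP: p01.
Qed.

(** The ratios of [x] and [y] to [x + y] lie in [[0, 1]], where taking a power [p <= 1] does not
    decrease; they sum to 1, and multiplying by the p-th power of [x + y] concludes. *)
Lemma powRD_le x y : 0 <= x -> 0 <= y -> (x + y) `^ p <= x `^ p + y `^ p.
Proof.
move=> x0 y0; have := addr_ge0 x0 y0; rewrite le_eqVlt => /predU1P[s0|s0].
  by rewrite -s0 powR0// addr_ge0// powR_ge0.
have sN0 : x + y != 0 by rewrite gt_eqF.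
have H z : 0 <= z -> z <= x + y ->
    (x + y) `^ p * (z / (x + y)) <= z `^ p.
  move=> z0 zs; have -> : z `^ p = ((x + y) * (z / (x + y))) `^ p.
    by rewrite mulrC divfK.
  rewrite powRM ?divr_ge0// ?(ltW s0)//.
  apply: ler_wpM2l; first exact: powR_ge0.
  apply: powR_unit_ge; rewrite divr_ge0 ?(ltW s0)//=.
  by rewrite ler_pdivrMr// mul1r.
apply: le_trans (lerD (H x x0 _) (H y y0 _)); rewrite ?lerDl ?lerDr//.
by rewrite -mulrDr -mulrDl divff// mulr1.
Qed.

Lemma powR_sum_le (I : Type) (r : seq I) (F : I -> R) :
  (forall i, 0 <= F i) -> (\sum_(i <- r) F i) `^ p <= \sum_(i <- r) F i `^ p.
Proof.
move=> F0; elim: r => [|i r IH]; first by rewrite !big_nil powR0.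
rewrite !big_cons; apply: (le_trans (powRD_le _ _)) => //.
  exact: sumr_ge0.
by rewrite lerD2l.
Qed.

Lemma normpowD x y : `|x + y| `^ p <= `|x| `^ p + `|y| `^ p.
Proof.
apply: (le_trans _ (powRD_le _ _)) => //; apply: powR_le_mono => //.
exact: ler_normD.
Qed.

Lemma normpow_sum (I : Type) (r : seq I) (F : I -> R) :
  `|\sum_(i <- r) F i| `^ p <= \sum_(i <- r) `|F i| `^ p.
Proof.
apply: (le_trans _ (powR_sum_le _ _)) => //; apply: powR_le_mono => //.
exact: ler_norm_sum.
Qed.

Lemma powR_le_inv x V : 0 <= x -> x `^ p <= V -> x <= V `^ p^-1.
Proof.
move=> x0 xV; rewrite -[leLHS](powRr1 x0) -(divff pN0) powRrM.
apply: ge0_ler_powR; rewrite ?nnegrE ?invr_ge0 ?powR_ge0// ?(ltW p0)//.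
exact: le_trans (powR_ge0 _ _) xV.
Qed.

(** Lets a finite first moment of the displacement [|f z0 - z0|] control its p-th moment. *)
Lemma powR_le1D x : 0 <= x -> x `^ p <= 1 + x.
Proof.
move=> x0; have [x1|x1] := leP x 1.
  apply: (@le_trans _ _ 1); last by rewrite lerDl.
  have <- : 1 `^ p = 1 :> R by rewrite powR1.
  exact: powR_le_mono.
apply: (@le_trans _ _ x); last by rewrite lerDr.
rewrite -[leRHS](powRr1 x0); apply: ler_powR; first exact: ltW.
by case/andP: p01.
Qed.

End powR_subadditivity.

Section lipschitz_functions.
Context {R : realType}.
Implicit Types (f g : R -> R) (F G : Lip R).

Lemma lipconst_has_sup f : Defs.lipschitz f ->
  has_sup [set r : R | exists x y : R, x != y /\ r = `|f y - f x| / `|y - x|].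
Proof.
case=> L HL; split.
  by exists (`|f 1 - f 0| / `|1 - 0|), 0, 1; split => //; rewrite eq_sym oner_eq0.
exists L => _ [x [y [xy ->]]].
by rewrite ler_pdivrMr ?HL// normr_gt0 subr_eq0 eq_sym.
Qed.

Lemma lipconst_ge0 f : Defs.lipschitz f -> 0 <= lipconst f.
Proof.
move=> /lipconst_has_sup hs; apply: (@le_trans _ _ (`|f 1 - f 0| / `|1 - 0|)).
  by rewrite divr_ge0.
apply: sup_upper_bound => //.
by exists 0, 1; split => //; rewrite eq_sym oner_eq0.
Qed.

Lemma lipconstP f x y : Defs.lipschitz f -> `|f y - f x| <= lipconst f * `|y - x|.
Proof.
move=> lf; have [->|xy] := eqVneq x y; first by rewrite !subrr normr0 mulr0.
rewrite -ler_pdivrMr; last by rewrite normr_gt0 subr_eq0 eq_sym.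
by apply: sup_upper_bound; [exact: lipconst_has_sup|exists x, y].
Qed.

Lemma lipconst_le f L : 0 <= L ->
  (forall x y, `|f y - f x| <= L * `|y - x|) -> lipconst f <= L.
Proof.
move=> L0 HL; apply: ge_sup.
  by exists (`|f 1 - f 0| / `|1 - 0|), 0, 1; split => //; rewrite eq_sym oner_eq0.
move=> _ [x [y [xy ->]]].
by rewrite ler_pdivrMr ?HL// normr_gt0 subr_eq0 eq_sym.
Qed.

Lemma lipschitzB f g : Defs.lipschitz f -> Defs.lipschitz g ->
  Defs.lipschitz (fun x => g x - f x).
Proof.
case=> K HK [L HL]; exists (L + K) => x y.
rewrite (_ : _ - _ - _ = (g y - g x) - (f y - f x)); last by ring.
by rewrite mulrDl (le_trans (ler_normB _ _))// lerD.
Qed.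

Lemma lipdist_ge0 F G : 0 <= lipdist F G.
Proof.
apply: addr_ge0; first exact: normr_ge0.
exact: (lipconst_ge0 (lipschitzB (Defs.lfunP F) (Defs.lfunP G))).
Qed.

Lemma Lf_ge0 F : 0 <= Lf F. Proof. exact: lipconst_ge0 (Defs.lfunP F). Qed.

Lemma LfP F x y : `|F y - F x| <= Lf F * `|y - x|.
Proof. exact: (lipconstP _ _ (Defs.lfunP F)). Qed.

Lemma Lf_lipdist F G : Lf G <= Lf F + lipdist F G.
Proof.
have lFG := lipschitzB (Defs.lfunP F) (Defs.lfunP G).
apply: lipconst_le => [|x y]; first by rewrite addr_ge0 ?Lf_ge0 ?lipdist_ge0.
rewrite (_ : _ - _ = (F y - F x) + ((G y - F y) - (G x - F x))); last by ring.
rewrite mulrDl (le_trans (ler_normD _ _))// lerD ?LfP//.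
by rewrite (le_trans (lipconstP x y lFG))// ler_wpM2r// lerDr.
Qed.

Lemma eval_lipdist F G z : `|G z - F z| <= (1 + `|z|) * lipdist F G.
Proof.
have lFG := lipschitzB (Defs.lfunP F) (Defs.lfunP G).
have -> : G z - F z = (G 0 - F 0) + ((G z - F z) - (G 0 - F 0)) by ring.
rewrite (le_trans (ler_normD _ _))// mulrDl mul1r.
apply: lerD; first by rewrite lerDl lipconst_ge0.
rewrite (le_trans (lipconstP 0 z lFG))// subr0 mulrC ler_wpM2l//.
by rewrite lerDr.
Qed.

(** The preimage of an open ray is open for [lipdist]: around [F] the radius [(phi F - c) / K]
    works. Open sets generate the sigma-algebra of [LipG]. *)
Lemma measurable_lip_fun (phi : LipG R -> R) (K : R) : 0 < K ->
  (forall F G, `|phi G - phi F| <= K * lipdist F G) ->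
  measurable_fun setT phi.
Proof.
move=> K0 HK; apply: (measurability _ (measurable_realfun.RGenOInfty.measurableE R)) => //.
move=> /= _ [_ [c ->] <-]; rewrite setTI; apply: sub_sigma_algebra => F /=.
rewrite in_itv/= andbT => cF; exists ((phi F - c) / K).
  by rewrite divr_gt0// subr_gt0.
move=> G; rewrite ltr_pdivlMr// mulrC => h; rewrite in_itv/= andbT.
have := HK F G; rewrite ler_norml => /andP[+ _]; lra.
Qed.

Lemma measurable_eval (z : R) : measurable_fun setT (fun F : LipG R => lfun F z).
Proof.
apply: (@measurable_lip_fun _ (1 + `|z|)); first by rewrite ltr_pwDl.
by move=> F G; exact: eval_lipdist.
Qed.

Lemma lipdistC F G : lipdist F G = lipdist G F.
Proof.
rewrite /lipdist distrC /lipconst; congr (_ + sup _); apply/seteqP.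
by split=> _ [x [y [xy ->]]]; exists x, y; split=> //; congr (_ / _);
  rewrite distrC; congr `|_|; ring.
Qed.

Lemma measurable_Lf : measurable_fun setT (fun F : LipG R => Lf F).
Proof.
apply: (@measurable_lip_fun _ 1) => // F G; rewrite mul1r ler_distl.
by rewrite Lf_lipdist andbT lerBlDr lipdistC Lf_lipdist.
Qed.

End lipschitz_functions.

(** * Comparing integrals without measurability of the smaller function *)

Section lower_integral.
Context d (T : measurableType d) (R : realType) (mu : {measure set T -> \bar R}).

Import HBNNSimple.

(** The integral of a nonnegative function is a supremum over the simple
    functions below it, hence monotone even without measurability of [f]. *)
Lemma ge0_le_integral_nonmeas (f g : T -> \bar R) :
  (forall x, 0 <= f x)%E -> (forall x, f x <= g x)%E ->
  (\int[mu]_x f x <= \int[mu]_x g x)%E.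
Proof.
move=> f0 fg; have g0 x : (0 <= g x)%E := le_trans (f0 x) (fg x).
rewrite !ge0_integralTE//.
apply: ge_ereal_sup => /= _ [h hf <-]; apply: ereal_sup_ubound.
by exists h => //= x; exact: le_trans (hf x) (fg x).
Qed.

(** Raising [g] to [+oo] off [G] gives a measurable majorant of [f], equal to [g] almost everywhere.
    It serves for integrands [f] built from [zeta_dh], whose measurability is not established. *)
Lemma le_integral_off_null (G : set T) (f g : T -> \bar R) :
  measurable G -> mu (~` G) = 0 -> measurable_fun setT g ->
  (forall x, 0 <= f x)%E -> (forall x, 0 <= g x)%E ->
  (forall x, G x -> f x <= g x)%E ->
  (\int[mu]_x f x <= \int[mu]_x g x)%E.
Proof.
move=> mG G0 mg f0 g0 fg.
have mGC := measurableC mG.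
pose g' x := if x \in G then g x else +oo%E.
have mg' : measurable_fun setT g'.
  apply: measurable_fun_if => //=.
  - apply: (measurable_fun_bool true); rewrite setTI.
    rewrite [X in measurable X](_ : _ = G)//.
    by apply/seteqP; split=> x /=; [move/set_mem|move/mem_set].
  - exact: measurable_funS mg.
apply: (@le_trans _ _ (\int[mu]_x g' x)%E).
  apply: ge0_le_integral_nonmeas => // x; rewrite /g'; case: ifPn.
    by rewrite inE => /fg.
  by rewrite leey.
rewrite le_eqVlt; apply/orP; left; apply/eqP.
apply: ge0_ae_eq_integral => //.
- by move=> x _; rewrite /g'; case: ifPn; rewrite ?leey.
exists (~` G); split => // x /=; apply: contra_not => Gx _.
by rewrite /g' ifT// inE.
Qed.

End lower_integral.

(** * Riemann--Stieltjes integrals *)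

Section riemann_stieltjes.
Context {R : realType}.
Implicit Types (h g : R -> R) (a b : R).

Definition is_partition a b (n : nat) (x : nat -> R) : Prop :=
  [/\ x 0%N = a, x n = b & forall i, (i < n)%N -> x i < x i.+1].

Definition rs_sum h g (n : nat) (x xi : nat -> R) : R :=
  \sum_(i < n) h (xi i) * (g (x i.+1) - g (x i)).

Definition unif_cont_on h a b : Prop :=
  forall e, 0 < e -> exists2 dl : R, 0 < dl & forall s t,
    a <= s <= b -> a <= t <= b -> `|s - t| < dl -> `|h s - h t| < e.

Definition unif_part a b (n : nat) (i : nat) : R := a + (b - a) * (i%:R / n%:R).

Lemma within_continuous_pointwise h a b s : {within `[a, b], continuous h} ->
  a <= s <= b -> forall e, 0 < e -> exists2 dl : R, 0 < dl & forall t,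
    a <= t <= b -> `|s - t| < dl -> `|h s - h t| < e.
Proof.
move=> /subspace_continuousP hc sab e e0.
have /hc/cvgrPdist_lt/(_ _ e0) : [set` `[a, b]] s by rewrite /= in_itv.
move=> /nbhs_ballP[dl /= dl0 H]; exists dl => // t tab st.
by apply: H; rewrite /= ?in_itv.
Qed.

Lemma within_unif_continuous h a b :
  {within `[a, b], continuous h} -> unif_cont_on h a b.
Proof.
move=> hc e e0.
have := @segment_compact R a b => /compact_near_coveringP.
move=> /(_ R (0^'+) (fun dl s => a <= s <= b -> forall t, a <= t <= b ->
  `|s - t| < dl -> `|h s - h t| < e)) H.
have {}H : \forall dl \near 0^'+, `[a, b] `<=` (fun s => a <= s <= b ->
    forall t, a <= t <= b -> `|s - t| < dl -> `|h s - h t| < e).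
  apply: H => s; rewrite /= in_itv /= => sab.
  have e20 : 0 < e / 2 by rewrite divr_gt0.
  have [dl dl0 Hdl] := within_continuous_pointwise hc sab e20.
  have dl20 : 0 < dl / 2 by rewrite divr_gt0.
  (* The halved radius leaves room for the moving point: [s'] within [dl / 2] of [s] and [t] within
     [dl / 2] of [s'] are both within [dl] of [s]. *)
  exists (ball s (dl / 2), [set r | 0 < r < dl / 2]) => /=.
    split; first exact: nbhsx_ballx.
    near=> r => /=; apply/andP; split; near: r.
      exact: nbhs_right_gt.
    exact: nbhs_right_lt.
  move=> [s' r] /= [ss' /andP[r0 rd]] s'ab t tab s't.
  have := Hdl s' s'ab; have := Hdl t tab.
  have h1 : `|s - s'| < dl by apply: (lt_trans ss'); lra.
  have h2 : `|s - t| < dl.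
    have -> : s - t = (s - s') + (s' - t) by ring.
    rewrite (le_lt_trans (ler_normD _ _))//.
    by rewrite [ltRHS](splitr dl) ltrD// (lt_trans s't).
  move=> /(_ h2) ht /(_ h1) hs'.
  have -> : h s' - h t = (h s' - h s) + (h s - h t) by ring.
  rewrite (le_lt_trans (ler_normD _ _))// [ltRHS](splitr e) ltrD//.
  by rewrite distrC.
near (0 : R)^'+ => dl; exists dl; first by near: dl; exact: nbhs_right_gt.
move=> s t sab tab; apply: (near H dl) => //.
Unshelve. all: by end_near. Qed.

Lemma unif_cont_on_sub h a b c d : a <= c -> d <= b ->
  unif_cont_on h a b -> unif_cont_on h c d.
Proof.
move=> ac db hu e /hu[dl dl0 H]; exists dl => // s t /andP[s1 s2] /andP[t1 t2].
by apply: H; apply/andP; split; lra.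
Qed.

Lemma is_partition_mono a b n x : is_partition a b n x ->
  forall i j, (i <= j)%N -> (j <= n)%N -> x i <= x j.
Proof.
move=> [_ _ H] i j ij jn; elim: j ij jn => [|j IH]; first by rewrite leqn0 => /eqP->.
rewrite leq_eqVlt => /predU1P[->//|ij] jn.
by rewrite (le_trans (IH _ _))// ?(ltnW jn)// ltW// H.
Qed.

Lemma is_partition_itv a b n x : is_partition a b n x ->
  forall i, (i <= n)%N -> a <= x i <= b.
Proof.
move=> H i iN; have mono := is_partition_mono H; have [<- <- _] := H.
by rewrite !mono.
Qed.

Lemma unif_partP a b n : a < b -> is_partition a b n.+1 (unif_part a b n.+1).
Proof.
move=> ab; split; rewrite /unif_part.
- by rewrite mul0r mulr0 addr0.
- by rewrite divff ?pnatr_eq0// mulr1 addrC subrK.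
- move=> i _; rewrite ltrD2l ltr_pM2l ?subr_gt0// ltr_pM2r ?invr_gt0 ?ltr0n//.
  by rewrite ltr_nat.
Qed.

Lemma unif_part_mesh a b n i :
  unif_part a b n.+1 i.+1 - unif_part a b n.+1 i = (b - a) / n.+1%:R.
Proof. by rewrite /unif_part -(natr1 i); field; rewrite ?natr1 ?nat1r pnatr_eq0. Qed.

Definition clamp (u v s : R) : R := Num.max u (Num.min v s).

(** Both sides are the increment of [g] over the intersection of [[u, v]] and [[s, t]], and vanish
    when the two do not overlap. *)
Lemma clamp_exchange g u v s t : u < v -> s < t ->
  g (clamp u v t) - g (clamp u v s) = g (clamp s t v) - g (clamp s t u).
Proof.
rewrite /clamp => uv st.
have [vt|tv] := leP v t; have [vs|sv] := leP v s;
  have [tu|ut] := leP t u; try lra.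
all: rewrite ?(max_r (ltW uv)) ?(max_r (ltW st)).
all: repeat match goal with |- context [Num.max ?x ?y] => case: (leP x y) => ? end.
all: try lra.
all: repeat match goal with
  | H : is_true (?x <= ?y), H' : is_true (?y <= ?x) |- _ =>
    have ? : x = y by (apply/eqP; rewrite eq_le H H'); subst end; lra.
Qed.

Lemma clamp_le u v s t : s <= t -> clamp u v s <= clamp u v t.
Proof. by move=> st; rewrite /clamp le_max2// le_min2. Qed.

Lemma clamp_itv u v s : u <= v -> u <= clamp u v s <= v.
Proof.
by move=> uv; rewrite /clamp le_max lexx/= ge_max uv ge_min lexx.
Qed.

Lemma sum_clamp g a b m q u v : is_partition a b m q -> a <= u -> u <= v -> v <= b ->
  g v - g u = \sum_(j < m) (g (clamp u v (q j.+1)) - g (clamp u v (q j))).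
Proof.
move=> [q0 qm _] au uv vb.
rewrite -(big_mkord xpredT (fun j => g (clamp u v (q j.+1)) - g (clamp u v (q j)))).
rewrite (telescope_sumr (fun j => g (clamp u v (q j))))// q0 qm /clamp.
rewrite (min_l vb) (max_r uv); congr (_ - g _).
by rewrite min_r ?max_l//; lra.
Qed.

(** In place of a common refinement, both sums are expanded over all pairs of cells, weighted by the
    increment [G i j] of [g] over their intersection. Monotonicity makes [G i j] nonnegative; it
    vanishes for disjoint cells, and tags of overlapping cells are less than [2 * dl] apart. *)
Lemma rs_sum_compare h g a b dl w n x xi m y eta :
  (forall s t, a <= s -> s <= t -> t <= b -> g s <= g t) ->
  is_partition a b n x -> is_partition a b m y ->
  (forall i, (i < n)%N -> x i.+1 - x i < dl) ->
  (forall i, (i < m)%N -> y i.+1 - y i < dl) ->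
  (forall i, (i < n)%N -> x i <= xi i <= x i.+1) ->
  (forall i, (i < m)%N -> y i <= eta i <= y i.+1) ->
  0 <= w ->
  (forall s t, a <= s <= b -> a <= t <= b -> `|s - t| < 2 * dl ->
     `|h s - h t| <= w) ->
  `|rs_sum h g n x xi - rs_sum h g m y eta| <= w * (g b - g a).
Proof.
move=> gm xP yP xd yd xxi yeta w0 hw.
have xI := is_partition_itv xP; have yI := is_partition_itv yP.
have [_ _ xlt] := xP; have [_ _ ylt] := yP.
pose G (i j : nat) := g (clamp (x i) (x i.+1) (y j.+1)) -
                      g (clamp (x i) (x i.+1) (y j)).
have xG i : (i < n)%N -> g (x i.+1) - g (x i) = \sum_(j < m) G i j.
  move=> iN; have /andP[? _] := xI _ (ltnW iN); have /andP[_ ?] := xI _ iN.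
  by apply: (sum_clamp _ yP) => //; apply/ltW/xlt.
have yG j : (j < m)%N -> g (y j.+1) - g (y j) = \sum_(i < n) G i j.
  move=> jm; have /andP[? _] := yI _ (ltnW jm); have /andP[_ ?] := yI _ jm.
  rewrite (sum_clamp _ xP (u := y j))//; last exact/ltW/ylt.
  by apply: eq_bigr => i _; rewrite /G clamp_exchange ?xlt ?ylt.
have -> : rs_sum h g n x xi = \sum_(i < n) \sum_(j < m) h (xi i) * G i j.
  by apply: eq_bigr => i _; rewrite xG// mulr_sumr.
have -> : rs_sum h g m y eta = \sum_(i < n) \sum_(j < m) h (eta j) * G i j.
  by rewrite exchange_big; apply: eq_bigr => j _ /=; rewrite yG// mulr_sumr.
have -> : w * (g b - g a) = \sum_(i < n) \sum_(j < m) w * G i j.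
  have [<- <- _] := xP.
  rewrite -(telescope_sumr (fun i => g (x i)))// big_mkord mulr_sumr.
  by apply: eq_bigr => i _; rewrite xG// mulr_sumr.
rewrite -sumrB (le_trans (ler_norm_sum _ _ _))//; apply: ler_sum => i _.
rewrite -sumrB (le_trans (ler_norm_sum _ _ _))//; apply: ler_sum => j _.
have iN := ltn_ord i; have jm := ltn_ord j.
have /andP[xa _] := xI _ (ltnW iN); have /andP[_ xb] := xI _ iN.
have /andP[ya _] := yI _ (ltnW jm); have /andP[_ yb] := yI _ jm.
have xlti := xlt _ iN; have yltj := ylt _ jm.
have /andP[xi1 xi2] := xxi _ iN; have /andP[et1 et2] := yeta _ jm.
have xdi := xd _ iN; have ydj := yd _ jm.
have G0 : 0 <= G i j.
  have /andP[? ?] := clamp_itv (y j) (ltW xlti).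
  have /andP[? ?] := clamp_itv (y j.+1) (ltW xlti).
  rewrite subr_ge0 gm//; [lra|exact/clamp_le/ltW|lra].
rewrite -mulrBl normrM (ger0_norm G0).
have [c1|c1] := leP (y j.+1) (x i).
  suff -> : G i j = 0 by rewrite !mulr0.
  by rewrite /G /clamp !min_r ?max_l ?subrr//; lra.
have [c2|c2] := leP (x i.+1) (y j).
  suff -> : G i j = 0 by rewrite !mulr0.
  by rewrite /G /clamp !min_l ?max_r ?subrr//; lra.
apply: ler_wpM2r => //; apply: hw; try (apply/andP; split; lra).
by rewrite ltr_norml; apply/andP; split; lra.
Qed.

Lemma unif_part_fine a b dl : a < b -> 0 < dl ->
  exists n0, forall n i, (n0 <= n)%N ->
    unif_part a b n.+1 i.+1 - unif_part a b n.+1 i < dl.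
Proof.
move=> ab dl0; exists (Num.bound ((b - a) / dl)) => n i nn.
rewrite unif_part_mesh ltr_pdivrMr ?ltr0n// mulrC -ltr_pdivrMr//.
have ba0 : 0 <= (b - a) / dl by rewrite divr_ge0 ?subr_ge0 ?ltW.
have := archi_boundP ba0 => /lt_le_trans; apply.
by rewrite ler_nat (leq_trans nn).
Qed.

Lemma is_RS_integralP h g a b I : is_RS_integral h g a b I <->
  forall e, 0 < e -> exists2 dl : R, 0 < dl & forall n x xi,
    is_partition a b n x -> (forall i, (i < n)%N -> x i.+1 - x i < dl) ->
    (forall i, (i < n)%N -> x i <= xi i <= x i.+1) ->
    `|rs_sum h g n x xi - I| < e.
Proof.
split=> H e /H[dl dl0 {}H]; exists dl => // n x xi.
- by move=> [x0 xn xlt] xd xxi; exact: H.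
- by move=> x0 xn xlt xd xxi; apply: H.
Qed.

Definition unif_sum h g a b n :=
  rs_sum h g n.+1 (unif_part a b n.+1) (unif_part a b n.+1).

Lemma rs_sum_tag_left a b n x : is_partition a b n x ->
  forall i, (i < n)%N -> x i <= x i <= x i.+1.
Proof. by move=> [_ _ H] i iN; apply/andP; split=> //; exact/ltW/H. Qed.

Lemma is_RS_integral_cvg h g a b I : a < b -> is_RS_integral h g a b I ->
  unif_sum h g a b n @[n --> \oo] --> I.
Proof.
move=> ab /is_RS_integralP HI; apply/cvgrPdist_lt => e /HI[dl dl0 H].
have [n0 Hn] := unif_part_fine ab dl0.
exists n0 => // n /= nn; rewrite distrC; have P := unif_partP n ab.
by apply: H => // [i _|]; [exact: Hn|exact: rs_sum_tag_left P].
Qed.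

Lemma is_RS_integral_unique h g a b I J : a < b ->
  is_RS_integral h g a b I -> is_RS_integral h g a b J -> I = J.
Proof.
move=> ab /(is_RS_integral_cvg ab) cI /(is_RS_integral_cvg ab) cJ.
by apply: (cvg_unique _ cI cJ).
Qed.

Lemma RS_integral_val h g a b I : a < b -> is_RS_integral h g a b I ->
  RS_integral h g a b = I.
Proof.
move=> ab HI; rewrite /RS_integral; apply: (is_RS_integral_unique ab) (HI).
by apply: xgetI HI.
Qed.

Lemma rs_exists_mono h g a b : a < b -> unif_cont_on h a b ->
  (forall s t, a <= s -> s <= t -> t <= b -> g s <= g t) ->
  exists I, is_RS_integral h g a b I.
Proof.
move=> ab hu gm; have gab : 0 <= g b - g a by rewrite subr_ge0 gm// ltW.
have fine_bound (e : R) : 0 < e -> exists2 dl : R, 0 < dl & forall n x xi m y eta,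
    is_partition a b n x -> is_partition a b m y ->
    (forall i, (i < n)%N -> x i.+1 - x i < dl) ->
    (forall i, (i < m)%N -> y i.+1 - y i < dl) ->
    (forall i, (i < n)%N -> x i <= xi i <= x i.+1) ->
    (forall i, (i < m)%N -> y i <= eta i <= y i.+1) ->
    `|rs_sum h g n x xi - rs_sum h g m y eta| < e.
  (* The added 1 covers a constant [g]. The mesh below is [dl / 2] because [rs_sum_compare] compares
     tags at distance up to twice the mesh. *)
  move=> e0; pose w := e / (g b - g a + 1).
  have D0 : 0 < g b - g a + 1 by rewrite ltr_wpDl.
  have w0 : 0 < w by rewrite divr_gt0.
  have [dl dl0 H] := hu _ w0; exists (dl / 2); first by rewrite divr_gt0.
  move=> n x xi m y eta xP yP xd yd xxi yeta.
  have wlt : w * (g b - g a) < e by rewrite mulrAC ltr_pdivrMr// mulrDr; lra.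
  apply: le_lt_trans wlt.
  apply: (rs_sum_compare gm xP yP xd yd xxi yeta (ltW w0)) => s t sab tab st.
  by apply/ltW/H => //; rewrite (lt_le_trans st)//; lra.
pose u := unif_sum h g a b.
have ucvg : cvgn u.
  apply/cauchy_cvgP/cauchy_exP => e e0.
  have [dl dl0 H] := fine_bound _ e0.
  have [n0 Hn] := unif_part_fine ab dl0.
  exists (u n0); exists n0 => // n /= nn; rewrite /ball/= /u /unif_sum.
  have Pn := unif_partP n ab; have P0 := unif_partP n0 ab.
  apply: (H _ _ _ _ _ _ P0 Pn) => [i _|i _||]; [exact: Hn|exact: Hn|..];
    by [exact: rs_sum_tag_left P0|exact: rs_sum_tag_left Pn].
exists (limn u); apply/is_RS_integralP => e e0.
have e20 : 0 < e / 2 by rewrite divr_gt0.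
have [dl dl0 H] := fine_bound _ e20.
have [n0 Hn] := unif_part_fine ab dl0.
move/cvgrPdist_lt : ucvg => /(_ _ e20) [n1 _ Hu].
exists dl => // n x xi xP xd xxi.
pose k := maxn n0 n1; have Pk := unif_partP k ab.
have -> : rs_sum h g n x xi - limn u =
  (rs_sum h g n x xi - u k) + (u k - limn u) by ring.
rewrite (le_lt_trans (ler_normD _ _))// [ltRHS](splitr e) ltrD//; last first.
  by rewrite distrC; apply: Hu; rewrite /= leq_maxr.
apply: (H _ _ _ _ _ _ xP Pk xd) => // [i _|]; last exact: rs_sum_tag_left Pk.
by apply: Hn; rewrite leq_maxl.
Qed.

Lemma rs_sum_eqB h g g1 g2 a b n x xi : is_partition a b n x ->
  (forall s, a <= s <= b -> g s = g1 s - g2 s) ->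
  rs_sum h g n x xi = rs_sum h g1 n x xi - rs_sum h g2 n x xi.
Proof.
move=> xP gE; rewrite /rs_sum -sumrB; apply: eq_bigr => i _.
have xI := is_partition_itv xP; have iN := ltn_ord i.
by rewrite !gE ?xI// 1?ltnW//; ring.
Qed.

Lemma bounded_variation_of_sums g a b V :
  (forall n x, (forall i, (i <= n)%N -> a <= x i <= b) ->
     (forall i, (i < n)%N -> x i <= x i.+1) ->
     \sum_(i < n) `|g (x i.+1) - g (x i)| <= V) ->
  bounded_variation a b g.
Proof.
move=> H; exists V => _ [s [sp /eqP sl] <-].
rewrite /variation /= big_mkord; apply: (H (size s) (nth b (a :: s))) => i iN.
- have : nth b (a :: s) i \in a :: s by rewrite mem_nth.
  have : sorted <=%O (a :: s) by apply: sub_path sp => ? ?; exact: ltW.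
  rewrite -sl; move: (nth _ _ _) => t srt ts.
  have nd j k : (j <= k)%N -> (k < (size s).+1)%N ->
      nth b (a :: s) j <= nth b (a :: s) k.
    move=> jk ks.
    by apply: (sorted_leq_nth le_trans le_refl _ srt) => //; rewrite inE/= (leq_ltn_trans jk).
  have := nth_index b ts; have := ts; rewrite -index_mem /= => i1 <-.
  rewrite -[X in X <= _ <= _]/(nth b (a :: s) 0) (last_nth b) !nd//.
- apply/ltW; have := sp; move/(pathP b) => /(_ i iN).
  by case: i iN.
Qed.

(** The Jordan decomposition reduces the claim to two nondecreasing integrators. *)
Lemma rs_exists h g a b : a < b -> unif_cont_on h a b -> bounded_variation a b g ->
  exists I, is_RS_integral h g a b I.
Proof.
move=> ab hu bv.
pose g1 := fine \o pos_tv a g; pose g2 := fine \o neg_tv a g.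
have gE s : a <= s <= b -> g s = g1 s - g2 s.
  by move=> sab; rewrite (bounded_variation_pos_neg_tvE bv)// in_itv.
have m2 s t : a <= s -> s <= t -> t <= b -> g2 s <= g2 t.
  move=> as_ st tb; apply: (fine_neg_tv_nondecreasing bv) => //;
    by rewrite in_itv/=; apply/andP; split; lra.
have m1 s t : a <= s -> s <= t -> t <= b -> g1 s <= g1 t.
  move=> as_ st tb.
  apply: (fine_neg_tv_nondecreasing (bounded_variationN bv)) => //;
    by rewrite in_itv/=; apply/andP; split; lra.
have [I1 H1] := rs_exists_mono ab hu m1; have [I2 H2] := rs_exists_mono ab hu m2.
exists (I1 - I2); apply/is_RS_integralP => e e0.
have e20 : 0 < e / 2 by rewrite divr_gt0.
have [d1 d10 {}H1] := (is_RS_integralP _ _ _ _ _).1 H1 _ e20.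
have [d2 d20 {}H2] := (is_RS_integralP _ _ _ _ _).1 H2 _ e20.
exists (Num.min d1 d2); first by rewrite lt_min d10.
move=> n x xi xP xd xxi; rewrite (rs_sum_eqB _ _ xP gE).
have -> : rs_sum h g1 n x xi - rs_sum h g2 n x xi - (I1 - I2) =
  (rs_sum h g1 n x xi - I1) - (rs_sum h g2 n x xi - I2) by ring.
rewrite (le_lt_trans (ler_normB _ _))// [ltRHS](splitr e) ltrD//.
- by apply: H1 => // i /xd; rewrite lt_min => /andP[].
- apply: H2 => // i /xd.
  by rewrite lt_min => /andP[].
Qed.

(** The quantified [P] carries any cellwise condition to the concatenation; [rs_additive] applies it
    to the mesh bound and to the position of the tags. *)
Lemma rs_sum_cat h g a b c n x xi m y eta :
  is_partition a b n x -> is_partition b c m y ->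
  let z i := if (i <= n)%N then x i else y (i - n)%N in
  let ze i := if (i < n)%N then xi i else eta (i - n)%N in
  is_partition a c (n + m) z /\
  rs_sum h g (n + m) z ze = rs_sum h g n x xi + rs_sum h g m y eta /\
  (forall P : R -> R -> R -> Prop,
    (forall i, (i < n)%N -> P (x i) (xi i) (x i.+1)) ->
    (forall i, (i < m)%N -> P (y i) (eta i) (y i.+1)) ->
    forall i, (i < n + m)%N -> P (z i) (ze i) (z i.+1)).
Proof.
move=> [x0 xn xlt] [y0 ym ylt] z ze.
have zL i : (i <= n)%N -> z i = x i by move=> iN; rewrite /z iN.
have zR i : z (n + i)%N = y i.
  rewrite /z; case: ifPn => [|_]; last by rewrite addKn.
  by rewrite -[X in (_ <= X)%N]addn0 leq_add2l leqn0 => /eqP ->; rewrite addn0 xn.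
have zeL i : (i < n)%N -> ze i = xi i by move=> iN; rewrite /ze iN.
have zeR i : ze (n + i)%N = eta i.
  by rewrite /ze ltnNge leq_addr/= addKn.
split; last split.
- split; [by rewrite zL|by rewrite zR|move=> i iN].
  have [ilt|ige] := ltnP i n; first by rewrite !zL ?xlt// ltnW.
  by rewrite -(subnKC ige) -addnS !zR ylt// ltn_subLR.
- rewrite /rs_sum big_split_ord /=; congr (_ + _); apply: eq_bigr => i _.
    by rewrite /= !zL ?zeL// ltnW.
  by rewrite /= -addnS !zR zeR.
- move=> P Px Py i iN.
  have [ilt|ige] := ltnP i n.
    by rewrite !zL// ?zeL//; [exact: Px|exact: ltnW].
  by rewrite -(subnKC ige) -addnS !zR zeR; apply: Py; rewrite ltn_subLR.
Qed.

Lemma rs_additive h g a b c I1 I2 I : a < b -> b < c ->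
  is_RS_integral h g a b I1 -> is_RS_integral h g b c I2 ->
  is_RS_integral h g a c I -> I = I1 + I2.
Proof.
move=> ab bc /is_RS_integralP H1 /is_RS_integralP H2 /is_RS_integralP H.
apply/eqP; rewrite -subr_eq0 -normr_eq0; apply/negPn/negP => N0.
(* Three sums, each within a third of the supposed gap of its integral, contradict the gap, since
   the concatenated sum is the sum of the other two. *)
have e0 : 0 < `|I - (I1 + I2)| / 3 by rewrite divr_gt0// lt0r N0/=.
have [d1 d10 {}H1] := H1 _ e0; have [d2 d20 {}H2] := H2 _ e0.
have [d3 d30 {}H] := H _ e0.
have d0 : 0 < Num.min d3 (Num.min d1 d2) by rewrite !lt_min d30 d10.
have [n0 Hn] := unif_part_fine ab d0; have [m0 Hm] := unif_part_fine bc d0.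
have Pn := unif_partP n0 ab; have Pm := unif_partP m0 bc.
have [zP [zE zQ]] := rs_sum_cat h g (unif_part a b n0.+1) (unif_part b c m0.+1) Pn Pm.
have Tn := rs_sum_tag_left Pn; have Tm := rs_sum_tag_left Pm.
have A1 := H1 _ _ _ Pn (fun i _ => lt_le_trans (Hn n0 i (leqnn _)) _) Tn.
have A2 := H2 _ _ _ Pm (fun i _ => lt_le_trans (Hm m0 i (leqnn _)) _) Tm.
have {}A1 := A1 ltac:(by rewrite !ge_min lexx ?orbT).
have {}A2 := A2 ltac:(by rewrite !ge_min lexx ?orbT).
have A3 := H _ _ _ zP.
have := A3 _ (zQ (fun u s v => v - u < d3) _ _) (zQ (fun u s v => u <= s <= v) Tn Tm).
move=> {}A3; have {}A3 := A3 ltac:(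
  by move=> i _; apply: (lt_le_trans (Hn n0 i (leqnn _))); rewrite ge_min lexx).
have {}A3 := A3 ltac:(
  by move=> i _; apply: (lt_le_trans (Hm m0 i (leqnn _))); rewrite ge_min lexx).
rewrite zE in A3; move: A1 A2 A3.
move: (rs_sum h g n0.+1 _ _) (rs_sum h g m0.+1 _ _) => s1 s2 A1 A2 A3.
have : `|I - (I1 + I2)| < `|I - (I1 + I2)|; last by rewrite ltxx.
have {1}-> : I - (I1 + I2) = (s1 - I1) + (s2 - I2) - (s1 + s2 - I) by ring.
apply: (le_lt_trans (ler_normB _ _)).
have := ler_normD (s1 - I1) (s2 - I2); lra.
Qed.

(** Subadditivity bounds the p-th power of each uniform sum by [s * V]. The p-th root is taken
    before the limit, so that continuity of the absolute value suffices. *)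
Lemma rs_powR_bound h g a b I p s V : a < b -> 0 < p <= 1 ->
  (forall t, a <= t <= b -> `|h t| `^ p <= s) ->
  (forall n x, (forall i, (i <= n)%N -> a <= x i <= b) ->
     (forall i, (i < n)%N -> x i <= x i.+1) ->
     \sum_(i < n) `|g (x i.+1) - g (x i)| `^ p <= V) ->
  is_RS_integral h g a b I -> `|I| `^ p <= s * V.
Proof.
move=> ab p01 hs gV /(is_RS_integral_cvg ab) cI.
have s0 : 0 <= s by apply: le_trans (powR_ge0 _ _) (hs a _); rewrite lexx ltW.
have V0 : 0 <= V by have := gV 0%N (fun=> a); rewrite big_ord0; apply => // i _; rewrite lexx ltW.
have p0 : p != 0 by case/andP: p01 => /gt_eqF ->.
have H : `|I| <= (s * V) `^ p^-1.
  have cN : `|unif_sum h g a b n| @[n --> \oo] --> `|I| by exact: cvg_norm.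
  rewrite -(cvg_lim _ cN)//; apply: limr_le; first by apply/cvg_ex; exists `|I|.
  near=> n; apply: (powR_le_inv p01) => //; rewrite /unif_sum /rs_sum.
  have P := unif_partP n ab; have PI := is_partition_itv P.
  apply: (le_trans (normpow_sum p01 _ _)).
  apply: (@le_trans _ _ (\sum_(i < n.+1) s * `|g (unif_part a b n.+1 i.+1) - g (unif_part a b n.+1 i)| `^ p)).
    apply: ler_sum => i _; rewrite normrM powRM//.
    by apply: ler_wpM2r; [exact: powR_ge0|apply: hs; apply: PI; rewrite ltnW].
  rewrite -mulr_sumr ler_wpM2l//; apply: gV => [i iN|i iN]; first exact: PI.
  by have [_ _ lt] := P; rewrite ltW// lt.
apply: (le_trans (powR_le_mono p01 _ H)) => //.
by rewrite -powRrM mulVf// powRr1// mulr_ge0.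
Unshelve. all: by end_near. Qed.

End riemann_stieltjes.

(** * Domination of iterated maps *)

Section iterated_maps.
Context {R : realType}.
Variables (z0 p : R).
Hypothesis p01 : 0 < p <= 1.
Local Notation point := ((R * R) * LipG R)%type.
Implicit Types (q : point) (l : seq point) (z : R).

Definition compose l : R := foldr (fun q z => lfun q.2 z) z0 l.
Definition compose_le l z : R := compose [seq q <- l | q.1.2 <= z].
Definition slope (f : LipG R) : R := Lf f `^ p.
Definition displacement (f : LipG R) : R := `|lfun f z0 - z0| `^ p.

Lemma slope_ge0 f : 0 <= slope f. Proof. exact: powR_ge0. Qed.
Lemma displacement_ge0 f : 0 <= displacement f. Proof. exact: powR_ge0. Qed.

Lemma slopeP (f : LipG R) s t : `|lfun f s - lfun f t| `^ p <= slope f * `|s - t| `^ p.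
Proof.
rewrite -powRM ?Lf_ge0//; apply: (powR_le_mono p01) => //; exact: LfP.
Qed.

Variables x y : R.
Hypothesis xy : x <= y.

Definition is_old q : bool := q.1.2 <= x.
Definition is_new q : bool := (x < q.1.2) && (q.1.2 <= y).
(* Along the time-ordered list of points, [wW l] bounds [`|compose_le l z - z0| `^ p]
   simultaneously for all cutoffs [x <= z <= y], and [wV l] bounds the sum of the
   [p]-th powers of the increments of [compose_le l] along any partition of [[x, y]].
   A point of level in [(x, y]] acts on part of the cutoffs only, whence the factor
   [1 + slope]; the points of level at most [x] contract for every cutoff. *)
Definition wr q : R :=
  if is_old q then slope q.2 else if is_new q then 1 + slope q.2 else 1.
Definition wb q : R := if q.1.2 <= y then displacement q.2 else 0.
Definition wc q : R := if q.1.2 <= y then 1 + slope q.2 + displacement q.2 else 1.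
(* With [prod f] the product of [f] over the points of a cell, [wW] of the cell is at
   most [prod wc] and [wV] at most [prod wd - prod wc], which vanishes when the cell
   has no point of level in [(x, y]]. *)
Definition wd q : R := if is_new q then 2 * wc q else wc q.

Fixpoint wW l : R := if l is q :: l' then wb q + wr q * wW l' else 0.
Fixpoint wV l : R := if l is q :: l' then
  wr q * wV l' + (if is_new q then displacement q.2 + (1 + slope q.2) * wW l' else 0)
  else 0.

Let H := (slope_ge0, displacement_ge0).

Lemma wr_ge0 q : 0 <= wr q.
Proof. by rewrite /wr; case: ifP; [|case: ifP]; rewrite ?addr_ge0 ?H. Qed.
Lemma wb_ge0 q : 0 <= wb q. Proof. by rewrite /wb; case: ifP; rewrite ?H. Qed.
Lemma wc_ge1 q : 1 <= wc q.
Proof. by rewrite /wc; case: ifP => //; rewrite -addrA lerDl addr_ge0 ?H. Qed.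
Lemma wc_ge0 q : 0 <= wc q. Proof. exact: le_trans (wc_ge1 q). Qed.
Lemma wd_gec q : wc q <= wd q.
Proof. by rewrite /wd; case: ifP => // _; have := wc_ge0 q; lra. Qed.
Lemma wW_ge0 l : 0 <= wW l.
Proof. by elim: l => //= q l IH; rewrite addr_ge0 ?wb_ge0 ?mulr_ge0 ?wr_ge0. Qed.
Lemma wV_ge0 l : 0 <= wV l.
Proof.
elim: l => //= q l IH; rewrite addr_ge0 ?mulr_ge0 ?wr_ge0//.
by case: ifP => _ //; rewrite addr_ge0 ?mulr_ge0 ?addr_ge0 ?H ?wW_ge0.
Qed.

Lemma is_old_le q : is_old q -> q.1.2 <= y. Proof. by move/le_trans; apply. Qed.

Lemma wr_wb_wc q : wr q + wb q <= wc q.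
Proof.
rewrite /wr /wb /wc; have [co|no] := boolP (is_old q).
  by rewrite is_old_le// lerD2r lerDr.
rewrite /is_new ltNge no/=; case: ifP => // _; by rewrite addr0.
Qed.

Lemma compose_le_bound l z : x <= z -> z <= y ->
  `|compose_le l z - z0| `^ p <= wW l.
Proof.
move=> xz zy; elim: l => [|q l IH] /=.
  by rewrite /compose_le/= subrr normr0 powR0//; case/andP: p01 => /gt_eqF ->.
rewrite /compose_le/=; case: ifPn => [qz|qz] /=; rewrite -/(compose_le l z).
  rewrite /wb (le_trans qz zy).
  have -> : lfun q.2 (compose_le l z) - z0 =
    (lfun q.2 z0 - z0) + (lfun q.2 (compose_le l z) - lfun q.2 z0) by ring.
  apply: (le_trans (normpowD p01 _ _)); rewrite lerD2l.
  apply: (le_trans (slopeP _ _ _)).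
  apply: (@le_trans _ _ (slope q.2 * wW l)); first by rewrite ler_wpM2l ?H.
  rewrite ler_wpM2r ?wW_ge0// /wr; case: ifPn => // no.
  by rewrite /is_new ltNge no/= (le_trans qz zy) lerDr.
apply: (le_trans IH); rewrite ler_wpDl ?wb_ge0// ler_peMl ?wW_ge0// /wr.
have -> : is_old q = false.
  by apply/negP => o; move: qz; rewrite (le_trans o xz).
by case: ifP => // _; rewrite lerDl H.
Qed.

Lemma wW_cat l l' : wW (l ++ l') = wW l + (\prod_(q <- l) wr q) * wW l'.
Proof.
elim: l => [|q l IH] /=; first by rewrite big_nil mul1r add0r.
by rewrite IH big_cons mulrDr addrA mulrA.
Qed.

Lemma prod_wr_ge0 l : 0 <= \prod_(q <- l) wr q.
Proof. by apply: prodr_ge0 => q _; exact: wr_ge0. Qed.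
Lemma prod_wc_ge1 l : 1 <= \prod_(q <- l) wc q.
Proof. by elim/big_ind: _ => [//|u v ? ?|q _]; [exact: mulr_ege1|exact: wc_ge1]. Qed.

(** Appending later points changes the innermost argument only, so the change is scaled by the
    product of [wr] over [l]. It makes [compose_le] Cauchy in time once [wW] stays bounded. *)
Lemma compose_le_cat l l' z : x <= z -> z <= y ->
  `|compose_le (l ++ l') z - compose_le l z| `^ p <= wW (l ++ l') - wW l.
Proof.
move=> xz zy; rewrite wW_cat addrAC subrr add0r.
elim: l => [|q l IH]; first by rewrite big_nil mul1r; exact: compose_le_bound.
rewrite big_cons /compose_le/= -mulrA; case: ifPn => [qz|qz] /=.
  apply: (le_trans (slopeP _ _ _)).
  apply: (@le_trans _ _ (slope q.2 * (\prod_(j <- l) wr j * wW l'))).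
    by rewrite ler_wpM2l ?H.
  rewrite ler_wpM2r ?mulr_ge0 ?prod_wr_ge0 ?wW_ge0// /wr; case: ifPn => // no.
  by rewrite /is_new ltNge no/= (le_trans qz zy) lerDr.
apply: (le_trans IH); rewrite ler_peMl ?mulr_ge0 ?prod_wr_ge0 ?wW_ge0// /wr.
have -> : is_old q = false.
  by apply/negP => o; move: qz; rewrite (le_trans o xz).
by case: ifP => // _; rewrite lerDl H.
Qed.

Lemma wW_le_cat l l' : wW l <= wW (l ++ l').
Proof. by rewrite wW_cat lerDl mulr_ge0 ?prod_wr_ge0 ?wW_ge0. Qed.

Lemma wV_le_cat l l' : wV l <= wV (l ++ l').
Proof.
elim: l => [|q l IH] /=; first exact: wV_ge0.
apply: lerD; first by rewrite ler_wpM2l ?wr_ge0.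
by case: ifP => // _; rewrite lerD2l ler_wpM2l ?wW_le_cat ?addr_ge0 ?H.
Qed.

(* The weights bracketed by [z i < u <= z i.+1] telescope. *)
Lemma sum_bracket_le1 (u : R) n (z : nat -> R) :
  (forall i, (i < n)%N -> z i <= z i.+1) ->
  \sum_(i < n) ((z i < u) && (u <= z i.+1))%R%:R <= 1 :> R.
Proof.
move=> zm; have -> : \sum_(i < n) ((z i < u) && (u <= z i.+1))%R%:R =
    \sum_(i < n) ((u <= z i.+1)%R%:R - (u <= z i)%R%:R) :> R.
  apply: eq_bigr => i _; have := zm i (ltn_ord i).
  have [uz|uz] := leP u (z i); have [uz'|uz'] := leP u (z i.+1);
    rewrite /= ?subrr ?subr0//; lra.
rewrite -(big_mkord xpredT (fun i => (u <= z i.+1)%R%:R - (u <= z i)%R%:R)).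
rewrite (telescope_sumr (fun i => (u <= z i)%R%:R))//.
by case: (u <= z n); case: (u <= z 0); rewrite /=; lra.
Qed.

(** The level of [q] is bracketed by at most one step [z i < q.1.2 <= z i.+1]. On the other steps
    [q] acts on both cutoffs or on neither, which costs the factor [wr q]; on that one it acts on
    the upper cutoff only, which costs the extra [K]. *)
Lemma compose_le_variation l n (z : nat -> R) :
  (forall i, (i <= n)%N -> x <= z i <= y) ->
  (forall i, (i < n)%N -> z i <= z i.+1) ->
  \sum_(i < n) `|compose_le l (z i.+1) - compose_le l (z i)| `^ p <= wV l.
Proof.
move=> zI zm; elim: l => [|q l IH] /=.
  rewrite big1// => i _.
  by rewrite /compose_le/= subrr normr0 powR0//; case/andP: p01 => /gt_eqF ->.
pose K := if is_new q then displacement q.2 + (1 + slope q.2) * wW l else 0.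
have K0 : 0 <= K.
  by rewrite /K; case: ifP => _ //; rewrite addr_ge0 ?mulr_ge0 ?addr_ge0 ?H ?wW_ge0.
apply: (@le_trans _ _ (\sum_(i < n) (wr q * `|compose_le l (z i.+1) - compose_le l (z i)| `^ p
   + K * ((z i < q.1.2) && (q.1.2 <= z i.+1))%R%:R))); last first.
  rewrite big_split/= -!mulr_sumr; apply: lerD; first by rewrite ler_wpM2l ?wr_ge0.
  by rewrite -[leRHS]mulr1 ler_wpM2l// sum_bracket_le1.
apply: ler_sum => i _; have iN := ltn_ord i; have zz := zm _ iN.
have /andP[xz zy] := zI _ (ltnW iN); have /andP[xz' zy'] := zI _ iN.
rewrite /compose_le/=; have [c1|c1] := leP q.1.2 (z i).
  rewrite (le_trans c1 zz)/= mulr0 addr0; apply: (le_trans (slopeP _ _ _)).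
  rewrite ler_wpM2r ?powR_ge0// /wr; case: ifPn => // no.
  by rewrite /is_new ltNge no/= (le_trans c1 zy) lerDr.
have no : is_old q = false by apply/negP => o; move: o; rewrite /is_old leNgt (le_lt_trans xz c1).
have [c2|c2] := leP q.1.2 (z i.+1); last first.
  rewrite /= mulr0 addr0 ler_peMl ?powR_ge0// /wr no.
  by case: ifP => // _; rewrite lerDl H.
have nq : is_new q by rewrite /is_new (le_lt_trans xz c1) (le_trans c2 zy').
rewrite /= mulr1 /K nq /wr no nq -/(compose_le l (z i)) -/(compose_le l (z i.+1)).
set A := compose_le l (z i.+1); set B := compose_le l (z i).
(* The image of [A] is compared with the unmapped [B] through the images of [B] and [z0]; all but
   the first difference go into [K]. *)
have -> : lfun q.2 A - B = (lfun q.2 A - lfun q.2 B) +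
   ((lfun q.2 z0 - z0) + ((lfun q.2 B - lfun q.2 z0) + (z0 - B))) by ring.
apply: (le_trans (normpowD p01 _ _)); apply: lerD.
  apply: (le_trans (slopeP _ _ _)); rewrite ler_wpM2r ?powR_ge0//.
  by rewrite lerDr.
apply: (le_trans (normpowD p01 _ _)); rewrite lerD2l.
apply: (le_trans (normpowD p01 _ _)).
have BW : `|B - z0| `^ p <= wW l by exact: compose_le_bound.
rewrite mulrDl mul1r addrC; apply: lerD; first by rewrite distrC.
by apply: (le_trans (slopeP _ _ _)); rewrite ler_wpM2l ?H.
Qed.

(** The product of [wr] is added to close the induction: the tail is then at most the product of
    [wc], which is at least 1 and so absorbs [wb q], and [wr q + wb q <= wc q] finishes. *)
Lemma wW_prod l : wW l + \prod_(q <- l) wr q <= \prod_(q <- l) wc q.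
Proof.
elim: l => [|q l IH] /=; first by rewrite !big_nil add0r.
rewrite !big_cons -addrA -mulrDr.
apply: (@le_trans _ _ (wb q + wr q * \prod_(j <- l) wc j)).
  by rewrite lerD2l ler_wpM2l ?wr_ge0.
apply: (@le_trans _ _ ((wr q + wb q) * \prod_(j <- l) wc j)).
  by rewrite mulrDl addrC lerD2l ler_peMr ?wb_ge0 ?prod_wc_ge1.
by rewrite ler_wpM2r ?wr_wb_wc// (le_trans _ (prod_wc_ge1 l)).
Qed.

Lemma wW_cat_le l l' :
  wW (l ++ l') <= \prod_(q <- l) wc q + (\prod_(q <- l) wr q) * wW l'.
Proof. by rewrite wW_cat lerD2r (le_trans _ (wW_prod l))// lerDl prod_wr_ge0. Qed.

Lemma prod_wc_le_wd l : \prod_(q <- l) wc q <= \prod_(q <- l) wd q.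
Proof. by apply: ler_prod => q _; rewrite wc_ge0 wd_gec. Qed.

(** The factor 2 in [wd] pays for the jump at a new point [q]. With [c], [d] the products of [wc],
    [wd] over the rest of the cell, [2 * wc q * d - wc q * c] exceeds [wc q * (d - c)] by
    [wc q * d], which is at least [wc q * c]; times [1 + wW l'], this bounds the jump. *)
Lemma wV_cat_le l l' : wV (l ++ l') <= (\prod_(q <- l) wr q) * wV l' +
  (\prod_(q <- l) wd q - \prod_(q <- l) wc q) * (1 + wW l').
Proof.
elim: l => [|q l IH] /=; first by rewrite !big_nil mul1r subrr mul0r addr0.
rewrite !big_cons wW_cat; have := wW_prod l; have := prod_wc_le_wd l.
have := prod_wr_ge0 l; have := prod_wc_ge1 l; move: IH; have := wW_ge0 l'.
have := wV_ge0 l'; have := wW_ge0 l.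
move: (wW l) (wW l') (wV l') (wV (l ++ l')) => W W' V' V.
move: (\prod_(j <- l) wr j) (\prod_(j <- l) wc j) (\prod_(j <- l) wd j) => r c d.
move=> W0 V'0 W'0 IH c1 r0 cd Wrc.
have rq0 := wr_ge0 q; have rc := wr_wb_wc q; have b0 := wb_ge0 q.
have rleC : wr q <= wc q by apply: le_trans rc; rewrite lerDl.
have dc0 : 0 <= d - c by rewrite subr_ge0.
have W'1 : 0 <= 1 + W' by rewrite addr_ge0.
have step1 : wr q * V <= wr q * r * V' + wc q * (d - c) * (1 + W').
  apply: (@le_trans _ _ (wr q * (r * V' + (d - c) * (1 + W')))).
    by rewrite ler_wpM2l.
  by rewrite mulrDr !mulrA lerD2l ler_wpM2r// ler_wpM2r.
rewrite /wd; case: ifPn => nq; last first.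
  by rewrite addr0 (le_trans step1)// -mulrBr lexx.
suff : displacement q.2 + (1 + slope q.2) * (W + r * W') <= wc q * c * (1 + W').
  move=> h; apply: (le_trans (lerD step1 h)).
  rewrite -addrA lerD2l -mulrDl ler_wpM2r//.
  have : 0 <= wc q * (d - c) by rewrite mulr_ge0 ?wc_ge0.
  lra.
have -> : wc q = 1 + slope q.2 + displacement q.2.
  by move: nq => /andP[_ qy]; rewrite /wc qy.
have c0 : 0 <= c by lra.
have h1 : W + r * W' <= c * (1 + W').
  rewrite mulrDr mulr1 lerD//; first lra.
  by rewrite ler_wpM2r//; lra.
have h2 : 1 <= c * (1 + W') by rewrite -[leLHS]mulr1 ler_pM//; lra.
rewrite -mulrA (mulrDl (1 + slope q.2)) addrC lerD//.
  by rewrite ler_wpM2l ?addr_ge0 ?H.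
by rewrite ler_peMr ?H.
Qed.

End iterated_maps.

(** * Product functionals of a Poisson process *)

Section enumeration.
Context {T : choiceType}.
Implicit Types S : set T.

(** The order is arbitrary; the list is used for finite sets, through counts and commutative
    products, up to [perm_eq]. *)
Definition enum_pts S : seq T := finmap.enum_fset (fset_set S).

Lemma enum_pts_uniq S : uniq (enum_pts S).
Proof. exact: finmap.fset_uniq. Qed.

Lemma mem_enum_pts S q : finite_set S -> (q \in enum_pts S) = (q \in S).
Proof. by move=> fS; rewrite -(in_fset_set fS). Qed.

Lemma enum_ptsP S q : finite_set S -> (q \in enum_pts S) <-> S q.
Proof. by move=> fS; rewrite mem_enum_pts// inE. Qed.

Lemma perm_enum_pts S (s : seq T) : finite_set S -> uniq s ->
  (forall q, q \in s <-> S q) -> perm_eq (enum_pts S) s.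
Proof.
move=> fS us Hs; apply: uniq_perm => //; first exact: enum_pts_uniq.
move=> q; apply/idP/idP => [/enum_ptsP|/Hs/enum_ptsP]; last exact.
by move=> /(_ fS)/Hs.
Qed.

Lemma size_enum_pts S n : finite_set S ->
  (S #= `I_n)%card <-> size (enum_pts S) = n.
Proof.
move=> fS; split; first exact: card_fset_set.
by move=> <-; rewrite -[X in (X #= _)%card](fset_setK fS); apply/card_eq_fsetP.
Qed.

End enumeration.

Section exponential_series.
Context {R : realType}.
Local Open Scope ereal_scope.

(** The generating function of the Poisson law of mean [m], evaluated at [c]. *)
Lemma nneseries_poisson (m c : R) : (0 <= m)%R -> (0 <= c)%R ->
  \sum_(0 <= k <oo) ((c ^+ k)%:E * (expR (- m) * m ^+ k / (k`!)%:R)%:E) =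
  (expR (m * (c - 1)))%:E.
Proof.
move=> m0 c0; apply/cvg_lim => //.
have -> : (fun n => \sum_(0 <= k < n) ((c ^+ k)%:E * (expR (- m) * m ^+ k / (k`!)%:R)%:E)) =
   EFin \o (fun n => expR (- m) * series (exp_coeff (m * c)) n)%R.
  apply/funext => n /=; rewrite /series/= mulr_sumr -sumEFin.
  by apply: eq_bigr => k _; rewrite -EFinM /exp_coeff/= exprMn; congr EFin; ring.
apply/fine_cvgP => /=; split; first exact: nearW.
rewrite (_ : expR (m * (c - 1)) = expR (- m) * expR (m * c))%R; last first.
  by rewrite -expRD; congr expR; ring.
by apply: cvgMr; exact: is_cvg_series_exp_coeff.
Qed.

End exponential_series.

Section poisson_functionals.
Context {R : realType} d (Omega : measurableType d) (P : probability Omega R).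
Context dT (T : measurableType dT) (mu : set T -> \bar R).
Variable N : Omega -> set T.
Hypothesis NP : poisson_process P mu N.
Hypothesis mu0 : forall B, (0 <= mu B)%E.
Local Open Scope ereal_scope.

Definition count_indic B k w : R := (`[< count_event N B k w >])%:R.

Lemma measurable_count_event B k : measurable B -> mu B < +oo ->
  measurable (count_event N B k).
Proof. by move=> mB fB; have [] := NP.1 B k mB fB. Qed.

Definition admissible (B : set T) := measurable B /\ mu B < +oo.
Definition disjointb (A B : set T) : bool := `[< A `&` B = set0 >].

Fixpoint count_events (l : seq (set T * nat)) : set Omega :=
  if l is Bk :: l' then count_event N Bk.1 Bk.2 `&` count_events l' else setT.

Lemma measurable_count_events l : {in l, forall Bk, admissible Bk.1} ->
  measurable (count_events l).
Proof.
elim: l => [|Bk l IH] H /=; first exact: measurableT.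
apply: measurableI; last by apply: IH => x xl; apply: H; rewrite inE xl orbT.
by have [] := H Bk (mem_head _ _); exact: measurable_count_event.
Qed.

Lemma count_events_nth l w :
  count_events l w <-> forall i, (i < size l)%N ->
    count_event N (nth (set0, 0%N) l i).1 (nth (set0, 0%N) l i).2 w.
Proof.
elim: l => [|Bk l IH] /=; first by split.
split=> [[h1 h2] [|i] //= iN|H]; first by apply/IH: i iN.
split; first exact: (H 0%N).
by apply/IH => i iN; exact: (H i.+1).
Qed.

Lemma prob_count_events l : {in l, forall Bk, admissible Bk.1} ->
  pairwise disjointb (map fst l) ->
  P (count_events l) = \prod_(Bk <- l) P (count_event N Bk.1 Bk.2).
Proof.
move=> Hl pw; pose dflt : set T * nat := (set0, 0%N).
have inl i : (i < size l)%N -> admissible (nth dflt l i).1.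
  by move=> iN; apply: Hl; exact: mem_nth.
have := NP.2 (size l) (fun i => (nth dflt l i).1) (fun i => (nth dflt l i).2).
move=> /(_ (fun i => (inl i (ltn_ord i)).1) (fun i => (inl i (ltn_ord i)).2)) H.
rewrite (big_nth dflt) big_mkord -H.
  congr (P _); apply/seteqP; split => w.
    by move=> /count_events_nth h i _; apply: h.
  by move=> h; apply/count_events_nth => i iN; exact: (h (Ordinal iN) I).
have dj (i j : nat) : (i < j)%N -> (j < size l)%N ->
    (nth dflt l i).1 `&` (nth dflt l j).1 = set0.
  move=> ij jN; move/(pairwiseP set0) : pw => /(_ i j).
  rewrite !inE size_map => /(_ (ltn_trans ij jN) jN ij).
  by rewrite !(nth_map dflt) ?(ltn_trans ij jN)// => /asboolP.
move=> i j; rewrite neq_ltn => /orP[ij|ij]; first exact: dj.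
by rewrite setIC; exact: dj.
Qed.

Section expectation.
Variable B0 : set T.
Hypothesis finB0 : forall w, finite_set (N w `&` B0).

Definition num_pts B w : nat := size (enum_pts (N w `&` B)).

Lemma finite_pts_sub B w : B `<=` B0 -> finite_set (N w `&` B).
Proof. by move=> BB0; apply: sub_finite_set (finB0 w); exact: setIS. Qed.

Lemma count_eventE B k w : B `<=` B0 -> count_event N B k w <-> num_pts B w = k.
Proof. by move=> BB0; apply: size_enum_pts; exact: finite_pts_sub. Qed.

Lemma measurable_num_pts B : B `<=` B0 -> admissible B ->
  measurable_fun setT (num_pts B).
Proof.
move=> BB0 [mB fB] _ Y _; rewrite setTI.
have -> : num_pts B @^-1` Y = \bigcup_(k in Y) count_event N B k.
  apply/seteqP; split => w /=.
    by move=> Yw; exists (num_pts B w) => //; apply/count_eventE.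
  by move=> [k Yk /(count_eventE _ _ BB0) ->].
by apply: bigcup_measurable => k _; exact: measurable_count_event.
Qed.

Lemma measurable_count_pow B (c : R) : B `<=` B0 -> admissible B ->
  measurable_fun setT (fun w => c ^+ num_pts B w)%R.
Proof.
move=> BB0 aB; have := @measurableT_comp _ _ _ _ _ _ (fun k : nat => c ^+ k)%R _ (num_pts B).
by apply=> //; exact: measurable_num_pts.
Qed.

(** Decompose over the value [k] of the count: on that event [c ^+ num_pts B w] is constant, the
    hypothesis on [count_indic] factors out [e], and the Poisson generating function remains. *)
Lemma expect_count_pow B (c e : R) (Y : Omega -> R) : B `<=` B0 -> admissible B ->
  (0 <= c)%R -> measurable_fun setT Y -> (forall w, 0 <= Y w)%R ->
  (forall k, \int[P]_w (count_indic B k w * Y w)%:E = e%:E * P (count_event N B k)) ->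
  \int[P]_w (c ^+ num_pts B w * Y w)%:E = (expR (fine (mu B) * (c - 1)) * e)%:E.
Proof.
move=> BB0 [mB fB] c0 mY Y0 H.
have mI k : measurable_fun setT (count_indic B k).
  rewrite (_ : count_indic B k = \1_(count_event N B k)).
    by apply: measurable_indic; exact: measurable_count_event.
  by apply/funext => w; rewrite /count_indic indicE.
have I0 k w : (0 <= count_indic B k w)%R by rewrite ler0n.
have PE k := (NP.1 B k mB fB).2.
have m0 : (0 <= fine (mu B))%R by rewrite fine_ge0.
pose g k w := (c ^+ k * (count_indic B k w * Y w))%R.
have -> : \int[P]_w (c ^+ num_pts B w * Y w)%:E =
    \int[P]_w \sum_(0 <= k <oo) (g k w)%:E.
  apply: eq_integral => w _.
  have g0 k : 0 <= (g k w)%:E by rewrite lee_fin !mulr_ge0 ?exprn_ge0.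
  rewrite (@nneseriesD1 _ _ (num_pts B w) xpredT)// eseries_mkcond/= eseries0 ?adde0.
    rewrite /g /count_indic (_ : `[< _ >] = true) ?mul1r//.
    exact/asboolP/count_eventE.
  move=> k _ _ /=; case: ifPn => // kn; rewrite /g /count_indic.
  rewrite (_ : `[< _ >] = false) ?mul0r ?mulr0//.
  by apply/asboolP => /(count_eventE _ _ BB0)/esym/eqP; rewrite (negPf kn).
have mg k : measurable_fun setT (fun w => count_indic B k w * Y w)%R.
  exact: measurable_funM.
rewrite integral_nneseries//; last 2 first.
- move=> k; apply/measurable_EFinP; apply: measurable_funM => //.
- by move=> k w _; rewrite lee_fin !mulr_ge0 ?exprn_ge0.
(* The sign of [e] is read off at [k = 0], an event of probability [expR (- fine (mu B))], which is
   positive. *)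
have e0 : (0 <= e)%R.
  have /= := H 0%N; rewrite PE expr0 mulr1 divr1 -EFinM => He.
  have : 0 <= (e * expR (- fine (mu B)))%:E.
    by rewrite -He; apply: integral_ge0 => w _; rewrite lee_fin mulr_ge0.
  by rewrite lee_fin pmulr_lge0// expR_gt0.
transitivity (\sum_(0 <= k <oo) e%:E * ((c ^+ k)%:E *
     (expR (- fine (mu B)) * fine (mu B) ^+ k / (k`!)%:R)%:E)).
  apply: eq_eseriesr => k _; rewrite /g.
  under eq_integral do rewrite EFinM.
  rewrite ge0_integralZl_EFin//.
  - by rewrite H PE muleCA.
  - by move=> w _; rewrite lee_fin mulr_ge0.
  - exact/measurable_EFinP.
  - exact: exprn_ge0.
rewrite nneseriesZl; last first.
  move=> k _; rewrite -EFinM lee_fin !mulr_ge0 ?exprn_ge0 ?expR_ge0 ?invr_ge0//.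
by rewrite nneseries_poisson// -EFinM mulrC.
Qed.

Lemma count_events_indic k B l w :
  (count_indic B k w * \1_(count_events l) w = \1_(count_events ((B, k) :: l)) w :> R)%R.
Proof. by rewrite /= indicI. Qed.

(** The events in [l2] serve the induction: the cell leaving [l1] joins [l2] with a prescribed count
    [k], and the induction hypothesis for the longer [l2] is the factorization that
    [expect_count_pow] asks for. *)
Lemma expect_prod_pow (l1 : seq (set T * R)) (l2 : seq (set T * nat)) :
  {in l1, forall Bc, [/\ Bc.1 `<=` B0, admissible Bc.1 & (0 <= Bc.2)%R]} ->
  {in l2, forall Bk, admissible Bk.1} ->
  pairwise disjointb (map fst l1 ++ map fst l2) ->
  measurable_fun setT (fun w => \prod_(Bc <- l1) Bc.2 ^+ num_pts Bc.1 w)%R /\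
  \int[P]_w ((\prod_(Bc <- l1) Bc.2 ^+ num_pts Bc.1 w)%R * \1_(count_events l2) w)%:E =
  (\prod_(Bc <- l1) expR (fine (mu Bc.1) * (Bc.2 - 1)))%:E * P (count_events l2).
Proof.
elim: l1 l2 => [|[B c] l1 IH] l2 H1 H2 pw.
  split; first by under eq_fun do rewrite big_nil; exact: measurable_cst.
  under eq_integral do rewrite big_nil mul1r.
  by rewrite big_nil mul1e integral_indic ?setIT//; exact: measurable_count_events.
have [/= BB0 aB c0] := H1 _ (mem_head _ _).
have H1' : {in l1, forall Bc, [/\ Bc.1 `<=` B0, admissible Bc.1 & (0 <= Bc.2)%R]}.
  by move=> x xl; apply: H1; rewrite inE xl orbT.
move: pw => /=; rewrite all_cat pairwise_cat -andbA => /and4P[dB1 dB2 ar /andP[pw1 pw2]].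
have pw' : pairwise disjointb (map fst l1 ++ map fst l2).
  by rewrite pairwise_cat ar pw1.
have [mY _] := IH l2 H1' H2 pw'.
have mE : measurable (count_events l2) by exact: measurable_count_events.
split.
  under eq_fun do rewrite big_cons /=.
  by apply: measurable_funM => //; exact: measurable_count_pow.
pose Y w := ((\prod_(Bc <- l1) Bc.2 ^+ num_pts Bc.1 w)%R * \1_(count_events l2) w)%R.
have mY1 : measurable_fun setT Y by apply: measurable_funM => //; exact: measurable_indic.
have Y0 w : (0 <= Y w)%R.
  rewrite mulr_ge0// big_seq; apply: prodr_ge0 => Bc Bcl; apply: exprn_ge0.
  by have [] := H1' _ Bcl.
have fE : P (count_events l2) \is a fin_num by rewrite fin_num_measure.
transitivity (\int[P]_w (c ^+ num_pts B w * Y w)%:E).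
  by apply: eq_integral => w _; rewrite big_cons /Y/= mulrA.
rewrite (@expect_count_pow _ _ (\prod_(Bc <- l1) expR (fine (mu Bc.1) * (Bc.2 - 1)) *
   fine (P (count_events l2)))%R)//.
  by rewrite big_cons/= mulrA EFinM fineK.
move=> k.
have H2' : {in (B, k) :: l2, forall Bk, admissible Bk.1}.
  by move=> x; rewrite inE => /predU1P[->//|]; exact: H2.
have pw'' : pairwise disjointb (map fst l1 ++ map fst ((B, k) :: l2)).
  rewrite pairwise_cat /= dB2 pw1 pw2 !andbT; apply/allrelP => A C A1.
  rewrite inE => /predU1P[->|C2]; last by move/allrelP : ar; apply.
  by move/allP : dB1 => /(_ _ A1); rewrite /disjointb setIC.
have [_ E2] := IH ((B, k) :: l2) H1' H2' pw''.
transitivity (\int[P]_w ((\prod_(Bc <- l1) Bc.2 ^+ num_pts Bc.1 w)%R *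
    \1_(count_events ((B, k) :: l2)) w)%:E).
  by apply: eq_integral => w _; rewrite -count_events_indic /Y mulrCA.
rewrite E2 EFinM fineK// -muleA; congr (_ * _).
rewrite (@prob_count_events ((B, k) :: l2))//; last by rewrite /= dB2.
by rewrite (@prob_count_events l2)// big_cons muleC.
Qed.

(* Its expectation is exp of the integral of [g - 1] over [B]; this is the only way in
   which the law of the process enters. *)
Definition point_prod (g : T -> R) B w : R :=
  (\prod_(q <- enum_pts (N w `&` B)) g q)%R.

Section simple_case.
Import HBNNSimple.

Lemma point_prod_simple (s : {nnsfun T >-> R}) B w : B `<=` B0 ->
  point_prod s B w =
  (\prod_(c <- enum_pts (range s)) c ^+ num_pts (B `&` s @^-1` [set c]) w)%R.
Proof.
move=> BB0; rewrite /point_prod.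
have fB := finite_pts_sub w BB0.
transitivity (\prod_(q <- enum_pts (N w `&` B))
    \prod_(c <- enum_pts (range s) | s q == c) c)%R.
  apply: eq_bigr => q _.
  rewrite (eq_bigl (fun c => c == s q)); last by move=> c; rewrite eq_sym.
  rewrite -big_filter filter_pred1_uniq ?enum_pts_uniq ?big_seq1//.
  by apply/enum_ptsP => //; exists q.
rewrite (exchange_big_dep xpredT)//=; apply: eq_bigr => c _.
rewrite big_const_seq iter_mulr_1; congr (_ ^+ _)%R.
rewrite -size_filter; apply/perm_size; rewrite perm_sym; apply: perm_enum_pts.
- by apply: finite_pts_sub; apply: subset_trans BB0 => q [].
- by rewrite filter_uniq// enum_pts_uniq.
- move=> q; rewrite mem_filter; split.
    by move=> /andP[/eqP sq /(enum_ptsP _ fB)[Nq Bq]].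
  by move=> [Nq [Bq /= ->]]; rewrite eqxx/=; apply/enum_ptsP.
Qed.

(** The level sets of [s] cut [B] into disjoint cells with independent Poisson counts, each
    contributing the exponent [m (Bc c) * (c - 1)]. Here [mu] is a mere set function, and [m] a
    measure agreeing with it inside [B]. *)
Lemma expect_point_prod_simple (m : {measure set T -> \bar R}) (s : {nnsfun T >-> R}) B :
  B `<=` B0 -> admissible B -> (forall A, measurable A -> A `<=` B -> mu A = m A) ->
  measurable_fun setT (point_prod s B) /\
  \int[P]_w (point_prod s B w)%:E =
  (expR (fine (\int[m]_(q in B) (s q)%:E) - fine (m B)))%:E.
Proof.
move=> BB0 [mB fB] mm; pose vs := enum_pts (range s).
pose Bc (c : R) := B `&` s @^-1` [set c].
have mBc c : measurable (Bc c) by exact: measurableI.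
have sBc c : Bc c `<=` B by move=> q [].
have muBc c : mu (Bc c) = m (Bc c) by exact: mm.
have fmB : m B < +oo by rewrite -mm.
have fmBc c : m (Bc c) < +oo by apply: le_lt_trans fmB; rewrite le_measure ?inE.
have BcU : B = \big[setU/set0]_(c <- vs) Bc c.
  rewrite -bigcup_seq; apply/seteqP; split => q.
    by move=> Bq; exists (s q) => //=; apply/enum_ptsP => //; exists q.
  by move=> [c _ []].
have tB : trivIset [set` vs] Bc.
  move=> c c' _ _ [q [[_ /= <-] [_ /= <-]]]//.
have mBE : fine (m B) = (\sum_(c <- vs) fine (m (Bc c)))%R.
  have -> : m B = \sum_(c <- vs) m (Bc c).
    have mE A : measurable A -> m A = \int[m]_(q in A) (1%R)%:E.
      by move=> mA; rewrite integral_cst// mul1e.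
    rewrite mE// {1}BcU ge0_integral_bigsetU ?enum_pts_uniq//.
    by apply: eq_bigr => c _; rewrite -mE.
  by rewrite -sum_fine// => c _; rewrite ge0_fin_numE.
have intE : fine (\int[m]_(q in B) (s q)%:E) = (\sum_(c <- vs) c * fine (m (Bc c)))%R.
  have -> : \int[m]_(q in B) (s q)%:E = \sum_(c <- vs) (c%:E * m (Bc c)).
    rewrite {1}BcU ge0_integral_bigsetU//=; last 3 first.
    - exact: enum_pts_uniq.
    - by rewrite -BcU; apply/measurable_EFinP; exact: measurable_funTS.
    - by move=> q _; rewrite lee_fin.
    apply: eq_bigr => c _; rewrite (@eq_integral _ _ _ _ _ (fun=> c%:E)).
      by rewrite integral_cst.
    by move=> q; rewrite inE => -[_ /= ->].
  have fmc c : m (Bc c) \is a fin_num by rewrite ge0_fin_numE.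
  rewrite -sum_fine; last by move=> c _; exact: fin_numM.
  by apply: eq_bigr => c _; rewrite fineM.
pose l1 := [seq (Bc c, c) | c <- vs].
have [| | |mF E] := @expect_prod_pow l1 [::].
- move=> _ /mapP[c cvs ->] /=; split.
  + exact: subset_trans BB0.
  + by split => //; rewrite muBc.
  + by move/enum_ptsP : cvs => /(_ (fimfunP s)) [q _ <-].
- by [].
- rewrite cats0 -map_comp (eq_map (g := Bc))// pairwise_map.
  apply/(pairwiseP 0%R) => i j; rewrite !inE => iN jN ij.
  rewrite -subset0 => q [[_ /= si] [_ /=]]; rewrite si => /eqP.
  by rewrite nth_uniq ?enum_pts_uniq// => /eqP ji; rewrite ji ltnn in ij.
have pE : point_prod s B = (fun w => \prod_(Bc <- l1) Bc.2 ^+ num_pts Bc.1 w)%R.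
  by apply/funext => w; rewrite point_prod_simple// big_map.
rewrite pE; split => //.
transitivity (\int[P]_w ((\prod_(Bc <- l1) Bc.2 ^+ num_pts Bc.1 w)%R *
    \1_(count_events [::]) w)%:E).
  by apply: eq_integral => w _; rewrite indicE in_setT mulr1.
rewrite E probability_setT mule1 big_map /= -expR_sum; congr (expR _)%:E.
rewrite intE mBE -sumrB; apply: eq_bigr => c _.
by rewrite muBc mulrBr mulr1 mulrC.
Qed.

Lemma point_prod_ge0 g B w : (forall q, 0 <= g q)%R -> (0 <= point_prod g B w)%R.
Proof. by move=> g0; apply: prodr_ge0. Qed.

(** Monotone convergence along simple functions: on each sample the product has finitely many
    factors and converges too, and finiteness of the integral of [g] makes the exponents converge in
    [R]. *)
Lemma expect_point_prod (m : {measure set T -> \bar R}) (g : T -> R) B :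
  B `<=` B0 -> admissible B -> (forall A, measurable A -> A `<=` B -> mu A = m A) ->
  measurable_fun setT g -> (forall q, 0 <= g q)%R ->
  \int[m]_(q in B) (g q)%:E < +oo ->
  measurable_fun setT (point_prod g B) /\
  \int[P]_w (point_prod g B w)%:E =
  (expR (fine (\int[m]_(q in B) (g q)%:E) - fine (m B)))%:E.
Proof.
move=> BB0 aB mm mg g0 gfin.
have mg' : measurable_fun setT (EFin \o g) by exact/measurable_EFinP.
have [|s [nds cvs]] := approximation measurableT mg'; first by move=> q _; rewrite lee_fin.
have [mB fB] := aB.
have sE k := expect_point_prod_simple (s k) BB0 aB mm.
have cvgs q : s k q @[k --> \oo] --> g q.
  by have /fine_cvgP[_] := cvs q I.
have nd q : {homo (fun k => s k q) : i j / (i <= j)%N >-> (i <= j)%R}.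
  by move=> i j ij; have /lefP := nds _ _ ij; exact.
have cvgp w : point_prod (s k) B w @[k --> \oo] --> point_prod g B w.
  rewrite /point_prod; elim: (enum_pts _) => [|q l IH].
    by under eq_fun do rewrite big_nil; rewrite big_nil; exact: cvg_cst.
  by under eq_fun do rewrite big_cons; rewrite big_cons; exact: cvgM.
have ndp w : {homo (fun k => point_prod (s k) B w) : i j / (i <= j)%N >-> (i <= j)%R}.
  move=> i j ij; apply: ler_prod => q _; rewrite nd// andbT.
  exact: (@fun_ge0 _ _ (s i)).
have s0 k q : (0 <= s k q)%R by exact: (@fun_ge0 _ _ (s k)).
have mp : measurable_fun setT (point_prod g B).
  apply: (@measurable_fun_cvg _ _ _ _ (fun k => point_prod (s k) B)).
    by move=> k; have [] := sE k.
  by move=> w _; exact: cvgp.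
split => //.
have L1 : \int[P]_w (point_prod (s k) B w)%:E @[k --> \oo] -->
    \int[P]_w (point_prod g B w)%:E.
  have := @cvg_monotone_convergence _ _ _ P _ measurableT
    (fun k w => (point_prod (s k) B w)%:E).
  rewrite (_ : (fun w => limn _) = (fun w => (point_prod g B w)%:E)); last first.
    apply/funext => w; apply/cvg_lim => //; apply: cvg_EFin; first exact: nearW.
    exact: cvgp.
  apply.
  - by move=> k; apply/measurable_EFinP; have [] := sE k.
  - by move=> k w _; rewrite lee_fin point_prod_ge0.
  - by move=> w _ i j ij; rewrite lee_fin ndp.
have L2 : \int[m]_(q in B) (s k q)%:E @[k --> \oo] --> \int[m]_(q in B) (g q)%:E.
  have := @cvg_monotone_convergence _ _ _ m _ mB (fun k q => (s k q)%:E).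
  rewrite (_ : (fun w => limn _) = (fun q => (g q)%:E)); last first.
    apply/funext => q; apply/cvg_lim => //; exact: cvs.
  apply.
  - by move=> k; apply/measurable_EFinP; exact: measurable_funTS.
  - by move=> k q _; rewrite lee_fin.
  - by move=> q _ i j ij; rewrite lee_fin nd.
have gf : \int[m]_(q in B) (g q)%:E \is a fin_num.
  by rewrite ge0_fin_numE//; apply: integral_ge0 => q _; rewrite lee_fin.
rewrite -(fineK gf) in L2; have /fine_cvgP[_ {}L2] := L2.
apply: (cvg_unique _ L1) => //.
rewrite (_ : (fun k => _) = EFin \o (fun k => expR (fine (\int[m]_(q in B) (s k q)%:E) - fine (m B)))).
  apply: cvg_EFin; first exact: nearW.
  apply: (@continuous_cvg _ _ _ _ _ _ expR); first exact: continuous_expR.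
  by apply: cvgB => //; exact: cvg_cst.
by apply/funext => k; have [_ ->] := sE k.
Qed.

End simple_case.

Lemma point_prodU g B C w : B `<=` B0 -> C `<=` B0 -> B `&` C = set0 ->
  point_prod g (B `|` C) w = (point_prod g B w * point_prod g C w)%R.
Proof.
move=> BB0 CB0 BC; rewrite /point_prod -big_cat; apply: perm_big.
have fB := finite_pts_sub w BB0; have fC := finite_pts_sub w CB0.
apply: perm_enum_pts.
- by rewrite setIUr finite_setU.
- rewrite cat_uniq !enum_pts_uniq andbT /=; apply/hasPn => q /(enum_ptsP _ fC)[_ Cq].
  apply/negP => /(enum_ptsP _ fB)[_ Bq].
  by have : (B `&` C) q by []; rewrite BC.
- move=> q; rewrite mem_cat; split.
    by move=> /orP[/(enum_ptsP _ fB)|/(enum_ptsP _ fC)] [Nq ?]; split => //; [left|right].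
  by move=> [Nq [Bq|Cq]]; apply/orP; [left|right]; apply/enum_ptsP.
Qed.

Lemma eq_point_prod g g' B w : B `<=` B0 -> (forall q, B q -> g q = g' q) ->
  point_prod g B w = point_prod g' B w.
Proof.
move=> BB0 gg'; rewrite /point_prod !big_seq; apply: eq_bigr => q.
by move=> /(enum_ptsP _ (finite_pts_sub w BB0))[_ /gg'].
Qed.

End expectation.
End poisson_functionals.

(** * Separated configurations *)

Section configurations.
Context {R : realType}.
Local Notation point := ((R * R) * LipG R)%type.
Implicit Types (S : set point) (q : point).

Definition strip (s t : R) : set point :=
  [set q | s < q.1.1 <= t /\ 0 <= q.1.2 <= 1].

Definition dyadic_strip (m j : nat) : set point :=
  strip (j%:R / (2 ^ m)%:R) (j.+1%:R / (2 ^ m)%:R).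

(* Deterministic properties of almost every configuration which make [time_enum]
   well posed: no point of level at most 1 sits at time 0, and on each bounded time
   interval the points are separated by some dyadic mesh (so they are finitely many,
   with distinct times). *)
Definition separated S : Prop :=
  [/\ forall q, S q -> 0 <= q.1.1 /\ 0 <= q.1.2,
      forall q, S q -> 0 <= q.1.2 <= 1 -> 0 < q.1.1 &
      forall n : nat, exists m : nat, forall j, (j < n * 2 ^ m)%N ->
        forall q q', (S `&` dyadic_strip m j) q ->
                     (S `&` dyadic_strip m j) q' -> q = q'].

Lemma dyadic_cell (n m : nat) (t : R) : 0 < t -> t <= n%:R ->
  exists2 j, (j < n * 2 ^ m)%N & j%:R / (2 ^ m)%:R < t <= j.+1%:R / (2 ^ m)%:R.
Proof.
move=> t0 tn; have p0 : 0 < (2 ^ m)%:R :> R by rewrite ltr0n expn_gt0.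
have ex : exists k, t * (2 ^ m)%:R <= k%:R.
  by exists (n * 2 ^ m)%N; rewrite natrM ler_wpM2r// ltW.
case: (ex_minnP ex) => -[|j] h1 h2.
  by move: h1; rewrite leNgt mulr_gt0.
exists j.
  by apply: h2; rewrite natrM ler_wpM2r// ltW.
rewrite ltr_pdivrMr// ler_pdivlMr// h1 andbT ltNge; apply/negP => /h2.
by rewrite ltnn.
Qed.

Lemma strip_sub s t s' t' : s' <= s -> t <= t' -> strip s t `<=` strip s' t'.
Proof.
move=> ss tt q [/andP[h1 h2] h3]; split => //.
by rewrite (le_lt_trans ss h1) (le_trans h2 tt).
Qed.

Lemma strip_cat s t u : s <= t -> t <= u -> strip s u = strip s t `|` strip t u.
Proof.
move=> st tu; apply/seteqP; split => q.
  move=> [/andP[h1 h2] h3]; have [h|h] := leP q.1.1 t; [left|right].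
    by split => //; rewrite h1.
  by split => //; rewrite h.
by move=> [|]; [exact: strip_sub|exact: strip_sub].
Qed.

Lemma strip_disjoint s t u : strip s t `&` strip t u = set0.
Proof.
apply/seteqP; split => // q [[/andP[_ h1] _] [/andP[h2 _] _]] /=.
by move: h2; rewrite ltNge h1.
Qed.

Section separated_configuration.
Variable S : set point.
Hypothesis sepS : separated S.

Lemma separated_time_inj (n : nat) q q' :
  (S `&` strip 0 n%:R) q -> (S `&` strip 0 n%:R) q' -> q.1.1 = q'.1.1 -> q = q'.
Proof.
have [_ _ /(_ n)[m Hm]] := sepS => -[Sq [/andP[q0 qn] qx]] -[Sq' [_ qx']] e.
have [j jn hj] := dyadic_cell m q0 qn.
by apply: (Hm j) => //; split => //; split => //; rewrite -?e.
Qed.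

Lemma separated_finite s t : 0 <= s -> finite_set (S `&` strip s t).
Proof.
move=> s0; have [t0|t0] := leP t 0.
  rewrite (_ : _ `&` _ = set0)//; apply/seteqP; split => // q [_ [/andP[h1 h2] _]] /=.
  by have := lt_le_trans (le_lt_trans s0 h1) h2; rewrite ltNge t0.
pose n := Num.bound t; have tn : t <= n%:R by apply/ltW/archi_boundP/ltW.
have [_ _ /(_ n)[m Hm]] := sepS.
apply: (@sub_finite_set _ _ (\bigcup_(j in `I_(n * 2 ^ m)) (S `&` dyadic_strip m j))).
  move=> q [Sq [/andP[q0 qn] qx]].
  have [j jn hj] := dyadic_cell m (le_lt_trans s0 q0) (le_trans qn tn).
  by exists j => //; split.
apply: bigcup_finite; first exact: finite_II.
move=> j /= jn; have [[q Hq]|H] := pselect (exists q, (S `&` dyadic_strip m j) q).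
  apply: (@sub_finite_set _ _ [set q]); last exact: finite_set1.
  by move=> q' Hq' /=; exact: (Hm j).
rewrite (_ : _ `&` _ = set0)//; apply/seteqP; split => // q Hq.
by apply: H; exists q.
Qed.

Definition le_time q q' : bool := q.1.1 <= q'.1.1.
Definition lt_time q q' : bool := q.1.1 < q'.1.1.

Definition time_list (A : set point) : seq point := sort le_time (enum_pts (S `&` A)).
Definition slist s t := time_list (strip s t).

Lemma mem_slist s t q : 0 <= s -> q \in slist s t <-> (S `&` strip s t) q.
Proof.
move=> s0; rewrite /slist /time_list mem_sort.
by apply: enum_ptsP; exact: separated_finite.
Qed.

Lemma perm_slist s t : perm_eq (enum_pts (S `&` strip s t)) (slist s t).
Proof. by rewrite perm_sym perm_sort. Qed.

Lemma sorted_slist s t : 0 <= s -> sorted lt_time (slist s t).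
Proof.
move=> s0; rewrite -(@sorted_map _ _ (fun q : point => q.1.1) <%R).
rewrite lt_sorted_uniq_le; apply/andP; split; last first.
  rewrite sorted_map; apply: sort_sorted => q q'; exact: le_total.
rewrite map_inj_in_uniq ?sort_uniq ?enum_pts_uniq// => q q'.
move=> /(mem_slist _ _ s0)[Sq Hq] /(mem_slist _ _ s0)[Sq' Hq'] e.
have [t0|t0] := leP t 0.
  case: Hq => /andP[h1 h2] _.
  by have := lt_le_trans (le_lt_trans s0 h1) h2; rewrite ltNge t0.
pose n := Num.bound t; have tn : t <= n%:R by apply/ltW/archi_boundP/ltW.
by apply: (@separated_time_inj n) => //; split => //; exact: (strip_sub s0 tn).
Qed.

Lemma lt_time_trans : transitive lt_time.
Proof. by move=> a b c; exact: lt_trans. Qed.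
Lemma lt_time_irr : irreflexive lt_time.
Proof. by move=> a; exact: ltxx. Qed.

(** A list sorted by strictly increasing times is determined by its members. *)
Lemma slist_cat s t u : 0 <= s -> s <= t -> t <= u ->
  slist s u = slist s t ++ slist t u.
Proof.
move=> s0 st tu; have t0 := le_trans s0 st.
apply: (irr_sorted_eq lt_time_trans lt_time_irr); first exact: sorted_slist.
  rewrite (sorted_pairwise lt_time_trans) pairwise_cat -!(sorted_pairwise lt_time_trans).
  rewrite !sorted_slist// !andbT; apply/allrelP => q q'.
  move=> /(mem_slist _ _ s0)[_ [/andP[_ h] _]] /(mem_slist _ _ t0)[_ [/andP[h' _] _]].
  exact: le_lt_trans h h'.
move=> q; rewrite mem_cat; apply/idP/idP.
  move=> /(mem_slist _ _ s0)[Sq]; rewrite (strip_cat st tu) => -[h|h]; apply/orP.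
    by left; apply/mem_slist.
  by right; apply/mem_slist.
move=> /orP[/(mem_slist _ _ s0)|/(mem_slist _ _ t0)][Sq h]; apply/mem_slist => //.
  by split => //; rewrite (strip_cat st tu); left.
by split => //; rewrite (strip_cat st tu); right.
Qed.

(** [compose_pts] picks an enumeration by choice; strict sorting leaves only one. *)
Lemma compose_ptsE (z0 : R) (A : set point) l : time_enum A l ->
  compose_pts z0 A = compose z0 l.
Proof.
move=> [l1 l2]; rewrite /compose_pts; set X := [set _ | _].
have Xl : X (compose z0 l) by exists l.
have [l' [[l1' l2'] ->]] : X (xget z0 X) by apply: xgetI Xl.
rewrite -/(compose z0 l'); congr (compose z0 _).
apply: (irr_sorted_eq lt_time_trans lt_time_irr) => // q.
by apply/idP/idP => [/l2'/l2|/l2/l2'].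
Qed.

(** [slist 0 t] omits time 0 and levels above 1. Both omissions are harmless: a separated
    configuration has no point of level at most 1 at time 0, and the cutoff [x] is at most 1. *)
Lemma zeta_tE (z0 t x : R) : 0 <= x <= 1 ->
  zeta_t z0 S t x = compose_le z0 (slist 0 t) x.
Proof.
move=> /andP[x0 x1]; apply: compose_ptsE; split.
  by apply: (sorted_filter lt_time_trans); exact: sorted_slist.
move=> q; rewrite mem_filter; split.
  move=> [Sq [/andP[t0 tt] /andP[y0 yx]]]; rewrite yx /=; apply/mem_slist => //.
  have y1 := le_trans yx x1; have [_ Spos _] := sepS.
  by split => //; split; rewrite ?y0 ?y1// tt andbT Spos// y0.
move=> /andP[qx /mem_slist -/(_ (lexx _)) [Sq [/andP[t0 tt] /andP[y0 _]]]].
by split => //; split; rewrite ?y0 ?qx// tt (ltW t0).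
Qed.

End separated_configuration.
End configurations.

(** * The intensity of boxes, strips and the line at time zero *)

Section intensity.
Context {R : realType} (nu : probability (LipG R) R).
Local Notation point := ((R * R) * LipG R)%type.
Local Open Scope ereal_scope.

Local Notation lebesgue2_nu := (((@lebesgue_measure R) \x (@lebesgue_measure R)) \x nu).

(* [lebesgue_measure] lives on an alias of [R] with another display; this is the
   product measure retyped on the canonical measurable structure. *)
Definition base_measure (B : set point) : \bar R := lebesgue2_nu B.

Let base_measure0 : base_measure set0 = 0. Proof. exact: measure0 lebesgue2_nu. Qed.
Let base_measure_ge0 B : 0 <= base_measure B. Proof. exact: measure_ge0 lebesgue2_nu B. Qed.
Let base_measure_additive : semi_sigma_additive base_measure.
Proof. move=> F mF tF mUF; exact: (@measure_semi_sigma_additive _ _ _ lebesgue2_nu F mF tF mUF). Qed.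

HB.instance Definition _ := isMeasure.Build _ point R base_measure
  base_measure0 base_measure_ge0 base_measure_additive.

Lemma pp_intensity_ge0 B : 0 <= pp_intensity nu B.
Proof. exact: measure_ge0 lebesgue2_nu _. Qed.

Lemma pp_intensityE B : B `<=` @pts_space R -> pp_intensity nu B = base_measure B.
Proof. by move=> BP; rewrite /pp_intensity; move/setIidl : BP => ->. Qed.

(** [l] and [r] tell whether the left endpoints belong to the box ([true]) or not; right endpoints
    always do. Half-open strips and the degenerate [zero_line] both take this form. *)
Definition box (l r : bool) (a b c e : R) : set (R * R) :=
  [set` Interval (BSide l a) (BRight b)] `*` [set` Interval (BSide r c) (BRight e)].

Lemma measurable_box l r a b c e : measurable (box l r a b c e).
Proof. by apply: measurableX; exact: measurable_itv. Qed.

Lemma base_measure_box (a b c e : R) (l r : bool) C : (a <= b)%R -> (c <= e)%R ->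
  measurable C ->
  base_measure (box l r a b c e `*` C) = ((b - a) * (e - c))%:E * nu C.
Proof.
move=> ab ce mC; have m1 := measurable_box l r a b c e.
have H1 := @product_measure1E _ _ _ _ R
  ((@lebesgue_measure R) \x (@lebesgue_measure R)) nu _ _ m1 mC.
have H2 := @product_measure1E _ _ _ _ R (@lebesgue_measure R) (@lebesgue_measure R)
  _ _ (measurable_itv (Interval (BSide l a) (BRight b)))
  (measurable_itv (Interval (BSide r c) (BRight e))).
transitivity (lebesgue2_nu (box l r a b c e `*` C)); first by [].
apply: (etrans H1); congr (_ * _); apply: (etrans H2).
have itvE u v (z : bool) : (u <= v)%R -> (@lebesgue_measure R)
    [set` Interval (BSide z u) (BRight v)] = (v - u)%:E.
  move=> uv; rewrite lebesgue_measure_itv/=; case: ifPn => //.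
  rewrite lte_fin -leNgt => vu; have -> : u = v by apply/eqP; rewrite eq_le uv vu.
  by rewrite subrr.
by rewrite EFinM; congr (_ * _); exact: itvE.
Qed.

Lemma base_measure_boxT (a b c e : R) (l r : bool) : (a <= b)%R -> (c <= e)%R ->
  base_measure (box l r a b c e `*` [set: LipG R]) = ((b - a) * (e - c))%:E.
Proof. by move=> ab ce; rewrite base_measure_box// probability_setT mule1. Qed.

(** Restricted to the box, the product measure is pushed forward by the mark to [nu] scaled by the
    area. *)
Lemma integral_box (a b c e : R) (l r : bool) (phi : LipG R -> \bar R) :
  (a <= b)%R -> (c <= e)%R -> measurable_fun setT phi -> (forall f, 0 <= phi f) ->
  \int[base_measure]_(q in box l r a b c e `*` setT) phi q.2 =
  ((b - a) * (e - c))%:E * \int[nu]_f phi f.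
Proof.
move=> ab ce mphi phi0; set D := _ `*` _.
have mD : measurable D by apply: measurableX => //; exact: measurable_box.
have mphi2 : measurable_fun setT (fun q : point => phi q.2).
  exact: measurableT_comp mphi (@measurable_snd _ _ (R * R)%type (LipG R)).
have k0 : (0 <= (b - a) * (e - c))%R by rewrite mulr_ge0// subr_ge0.
pose k : {nonneg R} := NngNum k0.
transitivity (\int[mrestr base_measure mD]_(q in D) phi q.2).
  apply: eq_measure_integral => A mA /setIidl AD.
  exact: (congr1 base_measure (esym AD)).
transitivity (\int[mrestr base_measure mD]_q phi q.2).
  rewrite [RHS](@ge0_negligible_integral _ _ _ (mrestr base_measure mD) setT (~` D))//.
  - by rewrite setTD setCK.
  - exact: measurableC.
  - exact: (etrans (congr1 base_measure (setICl D)) (measure0 base_measure)).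
transitivity (\int[pushforward (mrestr base_measure mD)
    (snd : point -> LipG R)]_f phi f).
  by rewrite ge0_integral_pushforward.
transitivity (\int[mscale k nu]_f phi f); last by rewrite ge0_integral_mscale.
apply: eq_measure_integral => C mC _.
apply: (etrans _ (base_measure_box l r ab ce mC)); congr base_measure.
by apply/seteqP; split => q /=; [move=> [? [? _]]|move=> [? ?]].
Qed.

Lemma stripE (s t : R) : strip s t =
  box false true s t 0 1 `*` [set: LipG R].
Proof.
apply/seteqP; split => q; rewrite /box /= !in_itv/=; first by case.
by case; case.
Qed.

Lemma measurable_strip (s t : R) : measurable (strip s t : set point).
Proof.
by rewrite stripE; apply: measurableX => //; exact: measurable_box.
Qed.

Lemma base_measure_strip (s t : R) : (s <= t)%R -> base_measure (strip s t) = (t - s)%:E.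
Proof.
by move=> st; rewrite stripE base_measure_boxT// subr0 mulr1.
Qed.

Lemma strip_pts_space (s t : R) : (0 <= s)%R -> strip s t `<=` @pts_space R.
Proof. by move=> s0 q [/andP[h _] /andP[h' _]]; split => //; rewrite (le_trans s0)// ltW. Qed.

Lemma pp_intensity_strip (s t : R) : (0 <= s)%R -> (s <= t)%R ->
  pp_intensity nu (strip s t) = (t - s)%:E.
Proof.
by move=> s0 st; rewrite pp_intensityE ?base_measure_strip//; exact: strip_pts_space.
Qed.

Definition zero_line : set point := [set q | q.1.1 = 0%R /\ (0 <= q.1.2 <= 1)%R].

Lemma zero_lineE : zero_line =
  box true true 0 0 0 1 `*` [set: LipG R].
Proof.
apply/seteqP; split => q; rewrite /box /= !in_itv/=.
  by move=> [h1 h2]; split => //; split => //; rewrite h1 lexx.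
by move=> [[h h2] _]; split => //; apply/eqP; rewrite eq_le andbC.
Qed.

Lemma measurable_zero_line : measurable zero_line.
Proof. by rewrite zero_lineE; apply: measurableX => //; exact: measurable_box. Qed.

Lemma pp_intensity_zero_line : pp_intensity nu zero_line = 0.
Proof.
rewrite pp_intensityE; last by move=> q [q0 /andP[q1 _]]; split; rewrite ?q0.
by rewrite zero_lineE base_measure_boxT// subrr mul0r.
Qed.

End intensity.

(** * Almost every configuration is separated *)

Section good_event.
Context {R : realType} (nu : probability (LipG R) R).
Local Notation point := ((R * R) * LipG R)%type.
Context d (Omega : measurableType d) (P : probability Omega R).
Variable N : Omega -> set point.
Hypothesis NP : poisson_process P (pp_intensity nu) N.
Hypothesis Npts : forall w, N w `<=` @pts_space R.
Local Open Scope ereal_scope.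

Definition at_most_one (B : set point) : set Omega :=
  count_event N B 0 `|` count_event N B 1.

(** With [x] the intensity of [B], two or more points have probability [1 - expR (- x) * (1 + x)],
    at most [x ^+ 2] because [expR (- x) >= 1 - x]. The square is what beats the number of dyadic
    cells. *)
Lemma at_most_one_measure B : measurable B -> pp_intensity nu B < +oo ->
  measurable (at_most_one B) /\
  P (~` at_most_one B) <= ((fine (pp_intensity nu B)) ^+ 2)%:E.
Proof.
move=> mB fB; have [m0 P0] := NP.1 B 0%N mB fB; have [m1 P1] := NP.1 B 1%N mB fB.
have mA : measurable (at_most_one B) by exact: measurableU.
split => //; rewrite probability_setC// measureU//.
  rewrite [X in 1 - X](etrans (congr2 +%E P0 P1) erefl).
  rewrite expr0 expr1 fact0 /= !divr1 mulr1.
  set x := fine _; have x0 : (0 <= x)%R by rewrite fine_ge0// pp_intensity_ge0.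
  rewrite -EFinD lee_fin.
  have := expR_ge1Dx (- x); have := expR_ge0 (- x); nra.
apply/seteqP; split => // w [] /=; rewrite /count_event/= => h0 h1.
by move: h0; rewrite card_eq_sym => /card_eq_trans/(_ h1)/card_eq_II.
Qed.

Lemma at_most_oneP B w : at_most_one B w ->
  forall q q', (N w `&` B) q -> (N w `&` B) q' -> q = q'.
Proof.
move=> [|] h q q' Hq Hq'.
  have e : N w `&` B = set0.
    by apply/eqP; rewrite -(@card_eq0 _ nat); move: h; rewrite /count_event/= II0.
  by move: Hq; rewrite e.
have fS : finite_set (N w `&` B) by exists 1%N.
have /size_enum_pts := h; move=> /(_ fS).
have := (enum_ptsP _ fS).2 Hq; have := (enum_ptsP _ fS).2 Hq'.
case: (enum_pts _) => [//|a [|]//=].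
by rewrite !inE => /eqP -> /eqP ->.
Qed.

Definition good_level n m : set Omega :=
  \bigcap_(j in `I_(n * 2 ^ m)) at_most_one (dyadic_strip m j).
Definition good_event : set Omega :=
  count_event N zero_line 0 `&` \bigcap_n \bigcup_m good_level n m.

Lemma dyadic_strip_measure m j :
  measurable (dyadic_strip m j : set point) /\
  pp_intensity nu (dyadic_strip m j) = ((2 ^ m)%:R^-1)%:E.
Proof.
split; first exact: measurable_strip.
rewrite pp_intensity_strip ?divr_ge0//.
  by rewrite -mulrBl -natr1 addrC addKr mul1r.
by rewrite ler_wpM2r// ?invr_ge0 // ler_nat.
Qed.

Lemma measurable_at_most_one_dyadic m j : measurable (at_most_one (dyadic_strip m j)).
Proof.
have [mD iD] := dyadic_strip_measure m j.
by have [] := at_most_one_measure mD _; rewrite // iD ltry.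
Qed.

Lemma measurable_good_level n m : measurable (good_level n m).
Proof. by apply: bigcap_measurableType => j _; exact: measurable_at_most_one_dyadic. Qed.

Lemma measurable_good_event : measurable good_event.
Proof.
apply: measurableI.
  have [] := NP.1 zero_line 0%N measurable_zero_line; last by [].
  by rewrite pp_intensity_zero_line ltry.
apply: bigcapT_measurable => n; apply: bigcupT_measurable => m.
exact: measurable_good_level.
Qed.

(** Union bound over [n * 2 ^ m] cells, each failing with probability at most the square of its
    length. *)
Lemma prob_bad_level n m : P (~` good_level n m) <= (n%:R * (2 ^ m)%:R^-1)%:E.
Proof.
have -> : ~` good_level n m = \bigcup_(j in `I_(n * 2 ^ m)) ~` at_most_one (dyadic_strip m j).
  by rewrite /good_level setC_bigcap.
rewrite bigcup_mkord.
have := @Boole_inequality _ _ _ P (fun j => ~` at_most_one (dyadic_strip m j)) (n * 2 ^ m).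
move=> /(_ (fun j _ => measurableC (measurable_at_most_one_dyadic m j))) H.
apply: (le_trans H).
apply: (@le_trans _ _ (\sum_(j < n * 2 ^ m) (((2 ^ m)%:R^-1) ^+ 2)%:E)).
  apply: lee_sum => j _; have [mD iD] := dyadic_strip_measure m j.
  have [|_] := at_most_one_measure mD _; first by rewrite iD ltry.
  by rewrite iD.
rewrite sumEFin lee_fin sumr_const card_ord -[X in (X <= _)%R]mulr_natl natrM.
have p0 : ((2 ^ m)%:R != 0 :> R)%R by rewrite pnatr_eq0 -lt0n expn_gt0.
by rewrite expr2 mulrA mulfK.
Qed.

Lemma prob_good_event : P (~` good_event) = 0.
Proof.
have mz := @measurable_zero_line R.
have zfin : pp_intensity nu zero_line < +oo by rewrite pp_intensity_zero_line ltry.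
have [mz0 Pz0] := NP.1 zero_line 0%N mz zfin.
rewrite /good_event setCI; apply: null_set_setU.
- exact: measurableC.
- by apply: measurableC; apply: bigcapT_measurable => n; apply: bigcupT_measurable => m;
    exact: measurable_good_level.
- apply: (etrans (probability_setC P mz0)); rewrite Pz0 pp_intensity_zero_line /=.
  by rewrite oppr0 expR0 expr0 mul1r fact0 divr1 subee.
rewrite setC_bigcap; apply/eqP; rewrite eq_le measure_ge0 andbT.
have mB n : measurable (~` \bigcup_m good_level n m).
  by apply: measurableC; apply: bigcupT_measurable => m; exact: measurable_good_level.
have B0 n : P (~` \bigcup_m good_level n m) = 0.
  apply/eqP; rewrite eq_le measure_ge0 andbT; apply/lee_addgt0Pr => e e0.
  rewrite add0e; have ne0 : (0 <= n%:R / e :> R)%R by rewrite divr_ge0// ltW.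
  (* Then [n / e < m < 2 ^ m], so the bound of [prob_bad_level] is at most [e]. *)
  pose m := Num.bound (n%:R / e).
  apply: (@le_trans _ _ (P (~` good_level n m))).
    rewrite le_measure ?inE//; first exact/measurableC/measurable_good_level.
    by apply: subsetC => w; exists m.
  apply: (le_trans (prob_bad_level n m)); rewrite lee_fin ler_pdivrMr ?ltr0n ?expn_gt0//.
  rewrite mulrC -ler_pdivrMr//; apply/ltW/(lt_le_trans (archi_boundP ne0)).
  by rewrite ler_nat ltnW// ltn_expl.
apply: (le_trans (generalized_Boole_inequality P mB _)).
  exact: bigcupT_measurable.
by rewrite eseries0 // => n _ _; exact: B0.
Qed.

Lemma good_separated w : good_event w -> separated (N w).
Proof.
move=> [Z H]; split.
- by move=> q /Npts[].
- move=> q Nq qx; have [q0 _] := Npts Nq; rewrite lt_def q0 andbT; apply/eqP => qt.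
  have : (N w `&` zero_line) q by split.
  suff -> : N w `&` zero_line = set0 by [].
  by apply/eqP; rewrite -(@card_eq0 _ nat); move: Z; rewrite /count_event/= II0.
- move=> n; have [m _ Hm] := H n I; exists m => j jn q q'.
  exact: (at_most_oneP (Hm j jn)).
Qed.

(* Still a Poisson process, since the law is unchanged off a null event, but now
   every configuration is separated. *)
Definition restrict_good w : set point := if w \in good_event then N w else set0.

Lemma separated0 : separated (set0 : set point).
Proof. by split => // n; exists 0%N => j _ q q' []. Qed.

Lemma restrict_good_separated w : separated (restrict_good w).
Proof.
rewrite /restrict_good; case: ifPn => [/set_mem/good_separated//|_].
exact: separated0.
Qed.

Lemma restrict_goodE w : good_event w -> restrict_good w = N w.
Proof. by move=> gw; rewrite /restrict_good ifT// inE. Qed.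

Lemma count_event_restrict B k :
  count_event restrict_good B k `&` good_event = count_event N B k `&` good_event.
Proof.
by apply/seteqP; split => w [h gw]; split => //; move: h;
  rewrite /count_event/= restrict_goodE.
Qed.

Lemma prob_eq_good A A' : measurable A -> measurable A' ->
  A `&` good_event = A' `&` good_event -> P A = P A'.
Proof.
move=> mA mA' e; have mG := measurable_good_event.
have H B : measurable B -> P B = P (B `&` good_event).
  move=> mB; rewrite -{1}(setIT B) -(setUv good_event) setIUr measureU; try exact: measurableI.
  - rewrite [X in _ + X](_ : _ = 0) ?adde0//.
    apply/eqP; rewrite eq_le measure_ge0 andbT -prob_good_event.
    by rewrite le_measure ?inE//; [apply: measurableI => //|]; exact: measurableC.
  - by apply: measurableI => //; exact: measurableC.
  - by rewrite setIACA setICr setI0.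
by rewrite (H A)// (H A')// e.
Qed.

(** Off [good_event] the modified configuration is empty, so there the event is everything for
    [k = 0] and nothing otherwise. *)
Lemma measurable_count_restrict B k : measurable (count_event N B k) ->
  measurable (count_event restrict_good B k).
Proof.
move=> mB; have mG := measurable_good_event.
rewrite -(setIT (count_event restrict_good B k)) -(setUv good_event) setIUr.
apply: measurableU; first by rewrite count_event_restrict; exact: measurableI.
have -> : count_event restrict_good B k `&` ~` good_event =
    if (k == 0)%N then ~` good_event else set0.
  have F w : ~ good_event w -> restrict_good w = set0.
    by move=> gw; rewrite /restrict_good ifF//; apply/negP => /set_mem.
  case: ifPn => k0.
    apply/seteqP; split => w; first by case.
    move=> gw; split => //; rewrite /count_event/= F//.
    by rewrite set0I (eqP k0) II0.
  apply/seteqP; split => w // [] /= h gw; move: h; rewrite /count_event/= F// set0I.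
  by rewrite card_eq_sym card_eq0 => /eqP/IIn_eq0/eqP; rewrite (negPf k0).
by case: ifP => _ //; exact: measurableC.
Qed.

Lemma restrict_good_poisson : poisson_process P (pp_intensity nu) restrict_good.
Proof.
split=> [B k mB fB|n B k mB fB dB].
  have [mN PN] := NP.1 B k mB fB; have mR := measurable_count_restrict mN.
  by split => //; rewrite -PN; apply: prob_eq_good => //; exact: count_event_restrict.
have mN i : measurable (count_event N (B i) (k i)) := (NP.1 (B i) (k i) (mB i) (fB i)).1.
have mR i := measurable_count_restrict (mN i).
rewrite (eq_bigr (fun i => P (count_event N (B i) (k i)))); last first.
  by move=> i _; apply: prob_eq_good => //; exact: count_event_restrict.
rewrite -NP.2//; apply: prob_eq_good.
- by apply: fin_bigcap_measurable => //; exact: finite_finset.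
- by apply: fin_bigcap_measurable => //; exact: finite_finset.
apply/seteqP; split => w [h gw]; split => // i _; have := h i I;
  by rewrite /count_event/= restrict_goodE.
Qed.


End good_event.

(** * Measurability of the composed maps *)

Section measurability.
Context {R : realType} (nu : probability (LipG R) R).
Local Notation point := ((R * R) * LipG R)%type.
Context d (Omega : measurableType d) (P : probability Omega R).
Variable N : Omega -> set point.
Hypothesis NP : poisson_process P (pp_intensity nu) N.
Hypothesis Nsep : forall w, separated (N w).

(** The value for several points is a default, not met once the mesh separates the points. *)
Definition pt_map (B : set point) (v : R) (w : Omega) : R :=
  if enum_pts (N w `&` B) is [:: q] then lfun q.2 v else v.

Lemma pp_intensity_sub_lty (B C : set point) : measurable B -> measurable C ->
  C `<=` B -> B `<=` @pts_space R -> (pp_intensity nu B < +oo)%E ->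
  (pp_intensity nu C < +oo)%E.
Proof.
move=> mB mC CB Bp; rewrite !pp_intensityE//; last exact: subset_trans CB Bp.
by apply: le_lt_trans; rewrite le_measure ?inE.
Qed.

Section one_cell.
Variable B : set point.
Hypothesis mB : measurable B.
Hypothesis Bpts : B `<=` @pts_space R.
Hypothesis fB : (pp_intensity nu B < +oo)%E.
Hypothesis finB : forall w, finite_set (N w `&` B).

(** Measurability is given for counts only, so the event is written with counts: either [B] has
    exactly one point and that point lies in [C], the part of [B] whose maps send [v] into [Y], or
    [B] does not have exactly one point and [v] itself is in [Y]. *)
Lemma measurable_pt_map_fixed (v : R) : measurable_fun setT (pt_map B v).
Proof.
move=> _ Y mY; rewrite setTI.
pose C := B `&` [set q : point | Y (lfun q.2 v)].
have mC : measurable C.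
  apply: measurableI => //; rewrite -[X in measurable X]setTI.
  have := measurableT_comp (measurable_eval v) (@measurable_snd _ _ (R * R)%type (LipG R)).
  by apply.
have CB : C `<=` B by move=> q [].
have fC := pp_intensity_sub_lty mB mC CB Bpts fB.
have finC w : finite_set (N w `&` C) by apply: sub_finite_set (finB w); exact: setIS.
have cE D k w : finite_set (N w `&` D) ->
    count_event N D k w <-> size (enum_pts (N w `&` D)) = k.
  exact: size_enum_pts.
have -> : pt_map B v @^-1` Y = (count_event N B 1 `&` count_event N C 1) `|`
    (if v \in Y then ~` count_event N B 1 else set0).
  apply/seteqP; split => w /=; rewrite /pt_map.
    case e : (enum_pts (N w `&` B)) => [|q [|q' l]] Yw.
    - by right; rewrite mem_set// => /(cE _ _ _ (finB w)); rewrite e.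
    - have [Nq Bq] : (N w `&` B) q by apply/(enum_ptsP q (finB w)); rewrite e mem_head.
      left; split; first by apply/(cE _ _ _ (finB w)); rewrite e.
      apply/(cE _ _ _ (finC w)).
      have /perm_size -> // : perm_eq (enum_pts (N w `&` C)) [:: q].
      apply: perm_enum_pts => // q'; rewrite inE; split => [/eqP ->//|[Nq' [Bq' _]]].
      have : q' \in enum_pts (N w `&` B) by apply/enum_ptsP.
      by rewrite e inE.
    - by right; rewrite mem_set// => /(cE _ _ _ (finB w)); rewrite e.
  move=> [[/(cE _ _ _ (finB w)) + /(cE _ _ _ (finC w))]|].
    case e : (enum_pts (N w `&` B)) => [|q [|q' l]]// _.
    case e' : (enum_pts (N w `&` C)) => [|q' [|q'' l]]// _.
    have [Nq [Bq Yq]] : (N w `&` C) q' by apply/(enum_ptsP q' (finC w)); rewrite e' mem_head.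
    have : q' \in enum_pts (N w `&` B) by apply/enum_ptsP.
    by rewrite e inE => /eqP <-.
  case: ifPn => // /set_mem Yv nB.
  case e : (enum_pts (N w `&` B)) => [|q [|q' l]]//.
  by case: nB; apply/(cE _ _ _ (finB w)); rewrite e.
have m1 : measurable (count_event N B 1) by have [] := NP.1 B 1%N mB fB.
apply: measurableU.
  by apply: measurableI => //; have [] := NP.1 C 1%N mC fC.
by case: ifP => _ //; exact: measurableC.
Qed.

Lemma pt_map_lipschitz w : exists2 L : R, 0 <= L &
  forall u v, `|pt_map B u w - pt_map B v w| <= L * `|u - v|.
Proof.
rewrite /pt_map; case: (enum_pts _) => [|q [|q' l]].
- by exists 1 => // u v; rewrite mul1r.
- by exists (Lf q.2) => [|u v]; [exact: Lf_ge0|exact: LfP].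
- by exists 1 => // u v; rewrite mul1r.
Qed.

(* Caratheodory: discretize the argument, using continuity in it. *)
Lemma measurable_pt_map (Z : Omega -> R) : measurable_fun setT Z ->
  measurable_fun setT (fun w => pt_map B (Z w) w).
Proof.
move=> mZ; pose grid (n : nat) (k : int) : R := k%:~R / n.+1%:R.
pose Zn n w : R := grid n (Num.floor (Z w * n.+1%:R)).
have Zlo n w : Zn n w <= Z w.
  by rewrite /Zn /grid ler_pdivrMr ?ltr0n// floor_le.
have Zhi n w : Z w - Zn n w <= n.+1%:R^-1.
  rewrite lerBlDr /Zn /grid -[X in X + _]div1r -mulrDl ler_pdivlMr ?ltr0n// addrC.
  by have := floorD1_gt (Z w * n.+1%:R); rewrite intrD1 => /ltW.
have mZn n k : measurable (Zn n @^-1` [set grid n k]).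
  suff -> : Zn n @^-1` [set grid n k] = setT `&` Z @^-1` `[grid n k, grid n (k + 1)[.
    by apply: mZ => //; exact: measurable_itv.
  have n0 : 0 < n.+1%:R :> R by rewrite ltr0n.
  apply/seteqP; split => w /=; rewrite in_itv/= /Zn /grid.
    move=> /(mulIf (invr_neq0 (lt0r_neq0 n0)))/eqP; rewrite eqr_int => /eqP <-.
    by rewrite ler_pdivrMr// ltr_pdivlMr// floor_itv.
  move=> [_]; rewrite ler_pdivrMr// ltr_pdivlMr// => h.
  by congr (_%:~R / _); apply: floor_def.
apply: (@measurable_fun_cvg _ _ _ _ (fun n w => pt_map B (Zn n w) w)).
  move=> n _ Y mY; rewrite setTI.
  have -> : (fun w => pt_map B (Zn n w) w) @^-1` Y = \bigcup_k
      (Zn n @^-1` [set grid n k] `&` (setT `&` pt_map B (grid n k) @^-1` Y)).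
    apply/seteqP; split => w /=.
      by move=> Yw; exists (Num.floor (Z w * n.+1%:R)).
    by move=> [k _ [<- [_]]].
  apply: countable_bigcupT_measurable => // k; apply: measurableI => //.
  exact: measurable_pt_map_fixed.
move=> w _; have [L L0 HL] := pt_map_lipschitz w.
apply/cvgrPdist_lt => e e0.
have L1 : 0 <= L / e by rewrite divr_ge0// ltW.
exists (Num.bound (L / e)) => // n /= nn.
apply: (le_lt_trans (HL _ _)); rewrite ger0_norm ?subr_ge0//.
apply: (@le_lt_trans _ _ (L * n.+1%:R^-1)); first by rewrite ler_wpM2l.
rewrite ltr_pdivrMr ?ltr0n// mulrC -ltr_pdivrMr//.
by apply: (lt_le_trans (archi_boundP L1)); rewrite ler_nat (leq_trans nn).
Qed.

End one_cell.

Definition below (x : R) : set point := [set q | q.1.2 <= x].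

(* Once the mesh separates the points, the composition over the points is the
   composition of these one-cell maps, each of which is measurable. *)
Fixpoint cell_compose (z0 x : R) m k len (w : Omega) : R :=
  if len is len'.+1 then
    pt_map (dyadic_strip m k `&` below x) (cell_compose z0 x m k.+1 len' w) w
  else z0.

Lemma measurable_below x : measurable (below x).
Proof.
have -> : below x = (setT `*` `]-oo, x]%classic) `*` setT.
  by apply/seteqP; split => q /=; rewrite in_itv//= => -[[]].
apply: measurableX => //; apply: measurableX => //; exact: measurable_itv.
Qed.

Lemma measurable_cell_compose z0 x m k len :
  measurable_fun setT (cell_compose z0 x m k len).
Proof.
elim: len k => [|len IH] k /=; first exact: measurable_cst.
have k0 : 0 <= k%:R / (2 ^ m)%:R :> R by rewrite divr_ge0.
have [mD iD] := dyadic_strip_measure nu m k.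
have mDx : measurable (dyadic_strip m k `&` below x).
  by apply: measurableI => //; exact: measurable_below.
have sD : dyadic_strip m k `&` below x `<=` dyadic_strip m k by move=> q [].
have Dp : dyadic_strip m k `<=` @pts_space R by exact: strip_pts_space.
apply: measurable_pt_map => //.
- exact: subset_trans sD Dp.
- by apply: (pp_intensity_sub_lty mD mDx sD Dp); rewrite iD ltry.
- move=> w; apply: (@sub_finite_set _ _ (N w `&` dyadic_strip m k)).
    exact: setIS.
  exact: separated_finite.
Qed.

Lemma compose_cat (z0 : R) l l' : compose z0 (l ++ l') = compose (compose z0 l') l.
Proof. by rewrite /compose foldr_cat. Qed.

Lemma compose_cell w x m k v : (forall q q', (N w `&` dyadic_strip m k) q ->
    (N w `&` dyadic_strip m k) q' -> q = q') ->
  compose v [seq q <- slist (N w) (k%:R / (2 ^ m)%:R) (k.+1%:R / (2 ^ m)%:R) | q.1.2 <= x]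
  = pt_map (dyadic_strip m k `&` below x) v w.
Proof.
move=> Hu; have k0 : 0 <= k%:R / (2 ^ m)%:R :> R by rewrite divr_ge0.
set l := [seq _ <- _ | _].
have mem_l q : q \in l <-> (N w `&` (dyadic_strip m k `&` below x)) q.
  rewrite mem_filter; split.
    by move=> /andP[qx /(mem_slist (Nsep w) _ _ k0)[]].
  by move=> [Nq [Dq /= ->]]; apply/(mem_slist (Nsep w) _ _ k0).
have ul : uniq l by rewrite filter_uniq// sort_uniq enum_pts_uniq.
have fin : finite_set (N w `&` (dyadic_strip m k `&` below x)).
  apply: (@sub_finite_set _ _ (N w `&` dyadic_strip m k)).
    by apply: setIS => q [].
  exact: separated_finite.
have pe := perm_enum_pts fin ul mem_l.
have sl : (size l <= 1)%N.
  case e : l ul mem_l => [//|a [//|b l']] ul mem_l.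
  have [Na [Da _]] := (mem_l a).1 (mem_head _ _).
  have [|Nb [Db _]] := (mem_l b).1; first by rewrite !inE eqxx orbT.
  by move: ul; rewrite (Hu a b)//= inE eqxx.
rewrite /pt_map (perm_small_eq sl pe).
by case: l sl {mem_l ul fin pe} => [|a [|b l']].
Qed.

Lemma compose_cells w z0 x m k len : (forall j, (j < k + len)%N -> forall q q',
    (N w `&` dyadic_strip m j) q -> (N w `&` dyadic_strip m j) q' -> q = q') ->
  compose_le z0 (slist (N w) (k%:R / (2 ^ m)%:R) ((k + len)%:R / (2 ^ m)%:R)) x =
  cell_compose z0 x m k len w.
Proof.
elim: len k => [|len IH] k Hu /=.
  rewrite addn0 (_ : slist _ _ _ = [::])//.
  have k0 : 0 <= k%:R / (2 ^ m)%:R :> R by rewrite divr_ge0.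
  case e : (slist _ _ _) => [//|q l].
  have /(mem_slist (Nsep w) _ _ k0)[_ [/andP[h1 h2] _]] :
      q \in slist (N w) (k%:R / (2 ^ m)%:R) (k%:R / (2 ^ m)%:R).
    by rewrite e mem_head.
  by have := lt_le_trans h1 h2; rewrite ltxx.
have p0 : 0 <= (2 ^ m)%:R^-1 :> R by rewrite invr_ge0.
rewrite (@slist_cat _ _ (Nsep w) _ (k.+1%:R / (2 ^ m)%:R)); last 3 first.
- by rewrite divr_ge0.
- by rewrite ler_wpM2r// ler_nat.
- by rewrite ler_wpM2r// ler_nat addnS ltnS leq_addr.
rewrite /compose_le filter_cat compose_cat compose_cell; last first.
  by apply: Hu; rewrite addnS ltnS leq_addr.
congr (pt_map _ _ _); rewrite -addSnnS; apply: IH => j jk; apply: Hu.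
by rewrite -addSnnS.
Qed.

Lemma subsingleton_at_most_one w B : finite_set (N w `&` B) ->
  (forall q q', (N w `&` B) q -> (N w `&` B) q' -> q = q') ->
  at_most_one N B w.
Proof.
move=> fB Hu; have cE k : count_event N B k w <-> size (enum_pts (N w `&` B)) = k.
  exact: size_enum_pts.
case e : (enum_pts (N w `&` B)) => [|a [|b l]].
- by left; apply/cE; rewrite e.
- by right; apply/cE; rewrite e.
- have /(enum_ptsP _ fB) Ha : a \in enum_pts (N w `&` B) by rewrite e mem_head.
  have /(enum_ptsP _ fB) Hb : b \in enum_pts (N w `&` B) by rewrite e !inE eqxx orbT.
  by have := enum_pts_uniq (N w `&` B); rewrite e (Hu a b)//= inE eqxx.
Qed.

(** The separating mesh depends on the sample. The preimage is cut along the measurable events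
    [good_level N n m], on each of which the composition equals a fixed [cell_compose]. *)
Lemma measurable_compose_slist (z0 x : R) (n : nat) :
  measurable_fun setT (fun w => compose_le z0 (slist (N w) 0 n%:R) x).
Proof.
move=> _ Y mY; rewrite setTI.
have -> : (fun w => compose_le z0 (slist (N w) 0 n%:R) x) @^-1` Y =
    \bigcup_m (good_level N n m `&` (setT `&` cell_compose z0 x m 0 (n * 2 ^ m) @^-1` Y)).
  have E w m : good_level N n m w ->
      compose_le z0 (slist (N w) 0 n%:R) x = cell_compose z0 x m 0 (n * 2 ^ m) w.
    move=> gw; rewrite -compose_cells; last first.
      by move=> j jn; apply: (at_most_oneP (gw j jn)).
    rewrite add0n mul0r natrM mulfK// pnatr_eq0 -lt0n expn_gt0//.
  apply/seteqP; split => w /=.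
    move=> Yw; have [_ _ /(_ n)[m Hm]] := Nsep w.
    have gw : good_level N n m w.
      move=> j /= jn; apply: subsingleton_at_most_one; last exact: Hm.
      by apply: separated_finite => //; rewrite divr_ge0.
    by exists m => //; split => //; split => //; rewrite /preimage/= -E.
  by move=> [m _ [gw [_]]]; rewrite /preimage/= -E.
apply: bigcupT_measurable => m; apply: measurableI.
  exact: (measurable_good_level NP).
by apply: measurable_cell_compose.
Qed.

End measurability.

(** * Independence over disjoint time strips *)

Section strip_integrals.
Context {R : realType} (nu : probability (LipG R) R).
Local Notation point := ((R * R) * LipG R)%type.
Local Notation mu := (base_measure nu).
Local Open Scope ereal_scope.

(** The common form of [wr], [wc] and [wd]. In a strip [f3] acts on levels in [(y, 1]], where those
    weights are 1. *)
Definition bylevel (x y : R) (f1 f2 f3 : LipG R -> R) (q : point) : R :=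
  if (q.1.2 <= x)%R then f1 q.2 else if (q.1.2 <= y)%R then f2 q.2 else f3 q.2.

Lemma measurable_level_le (x : R) : measurable_fun setT (fun q : point => q.1.2 <= x)%R.
Proof.
apply: (measurable_fun_bool true); rewrite setTI.
exact: measurable_below.
Qed.

Lemma measurable_mark (phi : LipG R -> R) : measurable_fun setT phi ->
  measurable_fun setT (fun q : point => phi q.2).
Proof.
by move=> mphi; exact: measurableT_comp mphi (@measurable_snd _ _ (R * R)%type (LipG R)).
Qed.

Lemma measurable_bylevel x y f1 f2 f3 : measurable_fun setT f1 ->
  measurable_fun setT f2 -> measurable_fun setT f3 ->
  measurable_fun setT (bylevel x y f1 f2 f3).
Proof.
move=> m1 m2 m3; apply: measurable_fun_ifT; first exact: measurable_level_le.
  exact: measurable_mark.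
apply: measurable_fun_ifT; first exact: measurable_level_le.
  exact: measurable_mark.
exact: measurable_mark.
Qed.

Lemma integral_strip_bylevel (s t x y : R) (f1 f2 f3 : LipG R -> R) (e1 e2 e3 : R) :
  (s <= t)%R -> (0 <= x)%R -> (x <= y)%R -> (y <= 1)%R ->
  measurable_fun setT f1 -> measurable_fun setT f2 -> measurable_fun setT f3 ->
  (forall f, 0 <= f1 f)%R -> (forall f, 0 <= f2 f)%R -> (forall f, 0 <= f3 f)%R ->
  \int[nu]_f (f1 f)%:E = e1%:E -> \int[nu]_f (f2 f)%:E = e2%:E ->
  \int[nu]_f (f3 f)%:E = e3%:E ->
  \int[mu]_(q in strip s t) (bylevel x y f1 f2 f3 q)%:E =
  ((t - s) * (x * e1 + (y - x) * e2 + (1 - y) * e3))%:E.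
Proof.
move=> st x0 xy y1 m1 m2 m3 p1 p2 p3 i1 i2 i3.
pose B1 : set point := box false true s t 0 x `*` setT.
pose B2 : set point := box false false s t x y `*` setT.
pose B3 : set point := box false false s t y 1 `*` setT.
have mB1 : measurable B1 by apply: measurableX => //; exact: measurable_box.
have mB2 : measurable B2 by apply: measurableX => //; exact: measurable_box.
have mB3 : measurable B3 by apply: measurableX => //; exact: measurable_box.
have inE1 q : B1 q <-> (s < q.1.1 <= t)%R /\ (0 <= q.1.2 <= x)%R.
  by rewrite /B1 /box/= !in_itv/=; split => [[[]]|[]].
have inE2 q : B2 q <-> (s < q.1.1 <= t)%R /\ (x < q.1.2 <= y)%R.
  by rewrite /B2 /box/= !in_itv/=; split => [[[]]|[]].
have inE3 q : B3 q <-> (s < q.1.1 <= t)%R /\ (y < q.1.2 <= 1)%R.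
  by rewrite /B3 /box/= !in_itv/=; split => [[[]]|[]].
have -> : strip s t = B1 `|` (B2 `|` B3).
  apply/seteqP; split => q.
    move=> [h1 /andP[h2 h3]]; have [h|h] := leP q.1.2 x.
      by left; apply/inE1; rewrite h2.
    right; have [h'|h'] := leP q.1.2 y; first by left; apply/inE2; rewrite h.
    by right; apply/inE3; rewrite h'.
  move=> [/inE1[h1 /andP[h2 h3]]|[/inE2[h1 /andP[h2 h3]]|/inE3[h1 /andP[h2 h3]]]];
    by split => //; apply/andP; split; lra.
have mg : measurable_fun setT (EFin \o bylevel x y f1 f2 f3).
  by apply/measurable_EFinP; exact: measurable_bylevel.
have g0 q : 0 <= (bylevel x y f1 f2 f3 q)%:E.
  by rewrite lee_fin /bylevel; case: ifP => // _; case: ifP.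
rewrite ge0_integral_setU//=; last 3 first.
- exact: measurableU.
- exact: measurable_funTS.
- apply/disj_setPS => q [/inE1[_ /andP[_ h1]] [/inE2|/inE3] [_ /andP[h2 _]]] /=; lra.
rewrite ge0_integral_setU//=; last 2 first.
- exact: measurable_funTS.
- apply/disj_setPS => q [/inE2[_ /andP[_ h1]] /inE3 [_ /andP[h2 _]]] /=; lra.
have eq1 : \int[mu]_(q in B1) (bylevel x y f1 f2 f3 q)%:E = ((t - s) * (x - 0))%:E * e1%:E.
  rewrite -i1 -(integral_box nu (phi := EFin \o f1) false true st x0)//.
  - by apply: eq_integral => q; rewrite inE => /inE1[_ /andP[_ h]]; rewrite /bylevel h.
  - exact/measurable_EFinP.
have eq2 : \int[mu]_(q in B2) (bylevel x y f1 f2 f3 q)%:E = ((t - s) * (y - x))%:E * e2%:E.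
  rewrite -i2 -(integral_box nu (phi := EFin \o f2) false false st xy)//.
  - apply: eq_integral => q; rewrite inE => /inE2[_ /andP[h h']].
    by rewrite /bylevel leNgt h /= h'.
  - exact/measurable_EFinP.
have eq3 : \int[mu]_(q in B3) (bylevel x y f1 f2 f3 q)%:E = ((t - s) * (1 - y))%:E * e3%:E.
  rewrite -i3 -(integral_box nu (phi := EFin \o f3) false false st y1)//.
  - apply: eq_integral => q; rewrite inE => /inE3[_ /andP[h h']].
    by rewrite /bylevel leNgt (le_lt_trans xy h) /= leNgt h.
  - exact/measurable_EFinP.
by rewrite eq1 eq2 eq3 -!EFinM -!EFinD; congr EFin; ring.
Qed.

End strip_integrals.

Section independence.
Context {R : realType} (nu : probability (LipG R) R).
Local Notation point := ((R * R) * LipG R)%type.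
Context d (Omega : measurableType d) (P : probability Omega R).
Variable N : Omega -> set point.
Hypothesis NP : poisson_process P (pp_intensity nu) N.
Hypothesis Nsep : forall w, separated (N w).
Local Notation mu := (base_measure nu).
Local Notation pprod := (point_prod N).
Local Open Scope ereal_scope.

Lemma integral_strip1 (s t : R) : (s <= t)%R ->
  \int[mu]_(q in strip s t) 1%:E = (t - s)%:E.
Proof.
move=> st; apply: (etrans (integral_cst mu (@measurable_strip R s t) 1%:E)).
by rewrite mul1e; exact: base_measure_strip.
Qed.

Definition strip_weight (s t : R) (g : point -> R) : Prop :=
  [/\ measurable_fun setT g, forall q, (0 <= g q)%R &
      \int[mu]_(q in strip s t) (g q)%:E < +oo].

Lemma expect_strip (s t : R) g : (0 <= s)%R -> (s <= t)%R -> strip_weight s t g ->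
  measurable_fun setT (pprod g (strip s t)) /\
  \int[P]_w (pprod g (strip s t) w)%:E =
  (expR (fine (\int[mu]_(q in strip s t) (g q)%:E) - (t - s)))%:E.
Proof.
move=> s0 st [mg g0 fg].
have fin w : finite_set (N w `&` strip s t) by exact: separated_finite.
have mS := @measurable_strip R s t.
have adm : admissible (pp_intensity nu) (strip s t).
  by split => //; rewrite pp_intensity_strip// ltry.
have ag A : measurable A -> A `<=` strip s t -> pp_intensity nu A = mu A.
  by move=> mA AS; apply: pp_intensityE; apply: subset_trans AS _; exact: strip_pts_space.
have [mp pE] := @expect_point_prod _ _ _ P _ _ _ N NP (pp_intensity_ge0 nu) (strip s t)
  fin mu g (strip s t) (fun q => id) adm ag mg g0 fg.
split => //; apply: (etrans pE); congr (expR (_ - _))%:E.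
exact: (congr1 fine (base_measure_strip nu st)).
Qed.

(* [X] has mean [e] and is uncorrelated with every product functional of the points of
   time at most [s]; testing against these alone avoids the generated sigma-algebras. *)
Definition future_indep (s : R) (X : Omega -> R) (e : R) : Prop :=
  [/\ measurable_fun setT X, forall w, (0 <= X w)%R &
   forall g, strip_weight 0 s g -> \int[P]_w (pprod g (strip 0 s) w * X w)%:E =
     \int[P]_w (pprod g (strip 0 s) w)%:E * e%:E].

Lemma future_indep_expect s X e : (0 <= s)%R -> future_indep s X e ->
  \int[P]_w (X w)%:E = e%:E.
Proof.
move=> s0 [mX X0 HX]; have g1 : strip_weight 0 s (fun=> 1%R).
  by split => //; rewrite integral_strip1// ltry.
have := HX _ g1; have [_ ->] := expect_strip (lexx 0%R) s0 g1.
rewrite integral_strip1//= subrr expR0 mul1e => <-; apply: eq_integral => w _.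
by rewrite /point_prod big1// mul1r.
Qed.

Lemma future_indep_cst s c : (0 <= c)%R -> (0 <= s)%R -> future_indep s (fun=> c) c.
Proof.
move=> c0 s0; split => // g [mg g0 fg].
have [mp _] := expect_strip (lexx 0%R) s0 (And3 mg g0 fg).
under eq_integral do rewrite EFinM.
rewrite ge0_integralZr//.
- exact/measurable_EFinP.
- by move=> w _; rewrite lee_fin point_prod_ge0.
Qed.

Lemma future_indepD s X Y e e' : (0 <= s)%R ->
  future_indep s X e -> future_indep s Y e' ->
  future_indep s (fun w => X w + Y w)%R (e + e').
Proof.
move=> s0 iX iY; have [mX X0 HX] := iX; have [mY Y0 HY] := iY.
split; [exact: measurable_funD|by move=> w; rewrite addr_ge0|move=> g Hg].
have [mp pE] := expect_strip (lexx 0%R) s0 Hg; have [_ g0 _] := Hg.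
under eq_integral do rewrite mulrDr EFinD.
rewrite ge0_integralD//; last 4 first.
- by move=> w _; rewrite lee_fin mulr_ge0 ?point_prod_ge0.
- by apply/measurable_EFinP; exact: measurable_funM.
- by move=> w _; rewrite lee_fin mulr_ge0 ?point_prod_ge0.
- by apply/measurable_EFinP; exact: measurable_funM.
by rewrite HX// HY// pE -!EFinM -EFinD mulrDr.
Qed.

(** The identity for [Y] is finite and can be subtracted from that for [X]; [Y <= X] keeps the
    integrand nonnegative. *)
Lemma future_indepB s X Y e e' : (0 <= s)%R -> (forall w, Y w <= X w)%R ->
  future_indep s X e -> future_indep s Y e' ->
  future_indep s (fun w => X w - Y w)%R (e - e').
Proof.
move=> s0 YX iX iY; have [mX X0 HX] := iX; have [mY Y0 HY] := iY.
split; [exact: measurable_funB|by move=> w; rewrite subr_ge0|move=> g Hg].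
have [mp pE] := expect_strip (lexx 0%R) s0 Hg; have [_ g0 _] := Hg.
have := HX _ Hg.
have -> : \int[P]_w (pprod g (strip 0 s) w * X w)%:E =
    \int[P]_w (pprod g (strip 0 s) w * (X w - Y w))%:E +
    \int[P]_w (pprod g (strip 0 s) w * Y w)%:E.
  rewrite -ge0_integralD//.
  - by apply: eq_integral => w _; rewrite -EFinD -mulrDr subrK.
  - by move=> w _; rewrite lee_fin mulr_ge0 ?point_prod_ge0// subr_ge0.
  - by apply/measurable_EFinP; apply: measurable_funM => //; exact: measurable_funB.
  - by move=> w _; rewrite lee_fin mulr_ge0 ?point_prod_ge0.
  - by apply/measurable_EFinP; exact: measurable_funM.
rewrite HY// pE -!EFinM => E; rewrite -[LHS](@addeK _ (expR (fine
  (\int[mu]_(q in strip 0 s) (g q)%:E) - (s - 0)) * e')%:E)// E.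
by rewrite -EFinB mulrBr.
Qed.

(** A test weight [h] on times up to [s] and the weight [g] on [(s, t]] glue to one weight [g1] on
    times up to [t]. The product of their functionals is thus a test functional for [X], and the
    exponential formula splits its mean. *)
Lemma future_indep_step (s t : R) g X e c : (0 <= s)%R -> (s <= t)%R ->
  strip_weight s t g -> \int[P]_w (pprod g (strip s t) w)%:E = c%:E ->
  future_indep t X e ->
  future_indep s (fun w => pprod g (strip s t) w * X w)%R (c * e).
Proof.
move=> s0 st Hg gE [mX X0 HX]; have [mg g0 fg] := Hg.
have [mp pE] := expect_strip s0 st Hg.
split; [exact: measurable_funM|by move=> w; rewrite mulr_ge0 ?point_prod_ge0|].
move=> h Hh; have [mh h0 fh] := Hh; have [mq qE] := expect_strip (lexx 0%R) s0 Hh.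
have t0 := le_trans s0 st.
pose g1 q := if (q.1.1 <= s)%R then h q else g q.
have inL q : strip 0 s q -> g1 q = h q by rewrite /g1 => -[/andP[_ ->]].
have inR q : strip s t q -> g1 q = g q.
  by rewrite /g1 => -[/andP[sq _] _]; rewrite leNgt sq.
have mS u v := @measurable_strip R u v.
have m1 : measurable_fun setT g1.
  apply: measurable_fun_ifT => //; apply: (measurable_fun_bool true); rewrite setTI.
  rewrite [X in measurable X](_ : _ = (`]-oo, s]%classic `*` setT) `*` setT).
    by apply: measurableX => //; apply: measurableX => //; exact: measurable_itv.
  by apply/seteqP; split => q /=; rewrite in_itv//= => -[[]].
have p1 q : (0 <= g1 q)%R by rewrite /g1; case: ifP.
have iE : \int[mu]_(q in strip 0 t) (g1 q)%:E =
    \int[mu]_(q in strip 0 s) (h q)%:E + \int[mu]_(q in strip s t) (g q)%:E.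
  rewrite (strip_cat s0 st) ge0_integral_setU//=.
  - congr (_ + _); apply: eq_integral => q; rewrite inE => Hq.
      by rewrite inL.
    by rewrite inR.
  - by apply/measurable_EFinP; exact: measurable_funTS.
  - by move=> q _; rewrite lee_fin.
  - by apply/disj_setPS; rewrite strip_disjoint.
have H1 : strip_weight 0 t g1.
  by split => //; rewrite iE lte_add_pinfty.
have fin u v w : (0 <= u)%R -> finite_set (N w `&` strip u v).
  by move=> u0; exact: separated_finite.
have ppE w : pprod g1 (strip 0 t) w = (pprod h (strip 0 s) w * pprod g (strip s t) w)%R.
  have S1 : strip 0 s `<=` strip 0 t := strip_sub (lexx 0%R) st.
  have S2 : strip s t `<=` strip 0 t := strip_sub s0 (lexx t).
  rewrite {1}(strip_cat s0 st).
  rewrite (point_prodU (B0 := strip 0 t))//; last 2 first.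
  - by move=> w'; exact: fin.
  - exact: strip_disjoint.
  by congr (_ * _)%R; apply: (eq_point_prod (B0 := strip 0 t)) => // w'; exact: fin.
have [_ p1E] := expect_strip (lexx 0%R) t0 H1.
have := HX _ H1; rewrite p1E.
under eq_integral do rewrite ppE -mulrA.
move=> ->; rewrite qE -!EFinM mulrA; congr ((_ * _)%R%:E).
move: gE; rewrite pE => -[<-]; rewrite -expRD iE; congr expR.
have fi u v (k : point -> R) : (forall q, 0 <= k q)%R -> \int[mu]_(q in strip u v) (k q)%:E < +oo ->
    \int[mu]_(q in strip u v) (k q)%:E \is a fin_num.
  by move=> k0 kf; rewrite ge0_fin_numE// integral_ge0// => q _; rewrite lee_fin.
by rewrite fineD ?fi//; ring.
Qed.

End independence.

(** * Moment bounds for the increments of zeta *)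

Section monotone_limits.
Context {R : realType}.

(** By subadditivity, p-th powers of absolute values differ by at most the p-th power of the
    distance. *)
Lemma cvg_normpow (T : Type) (F : set_system T) {FF : Filter F} (p : R) (u : T -> R) (l : R) :
  0 < p <= 1 -> u @ F --> l -> `|u t| `^ p @[t --> F] --> `|l| `^ p.
Proof.
move=> p01 /cvgrPdist_lt ul; apply/cvgrPdist_lt => e e0.
have p0 : 0 < p by case/andP: p01.
have e1 : 0 < e `^ p^-1 by rewrite powR_gt0.
have := ul _ e1; apply: filterS => t lt.
have H : `|l - u t| `^ p < e.
  have -> : e = (e `^ p^-1) `^ p by rewrite -powRrM mulVf ?gt_eqF// powRr1// ltW.
  by apply: gt0_ltr_powR; rewrite ?nnegrE// ltW.
have h1 : `|l| `^ p <= `|l - u t| `^ p + `|u t| `^ p.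
  by rewrite (le_trans _ (normpowD p01 _ _))// subrK.
have h2 : `|u t| `^ p <= `|l - u t| `^ p + `|l| `^ p.
  by rewrite distrC (le_trans _ (normpowD p01 _ _))// subrK.
by rewrite ltr_norml; apply/andP; split; lra.
Qed.

Lemma cvg_sum_fin (T : Type) (F : set_system T) {FF : Filter F} (n : nat)
    (u : nat -> T -> R) (l : nat -> R) :
  (forall i, (i < n)%N -> u i t @[t --> F] --> l i) ->
  \sum_(i < n) u i t @[t --> F] --> \sum_(i < n) l i.
Proof.
elim: n => [|n IH] H.
  by rewrite big_ord0; under eq_fun do rewrite big_ord0; exact: cvg_cst.
rewrite big_ord_recr; under eq_fun do rewrite big_ord_recr.
by apply: cvgD; [apply: IH => i iN; apply: H; exact: ltnW|exact: H].
Qed.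

Local Open Scope ereal_scope.

Definition esup_seq (T : Type) (u : nat -> T -> R) (w : T) : \bar R :=
  ereal_sup (range (fun m => (u m w)%:E)).

Lemma esup_seq_ge (T : Type) (u : nat -> T -> R) w m : (u m w)%:E <= esup_seq u w.
Proof. by apply: ereal_sup_ubound; exists m. Qed.

Lemma esup_seq_integral d (T : measurableType d) (P : {measure set T -> \bar R})
    (u : nat -> T -> R) (K : R) :
  (forall m, measurable_fun setT (u m)) -> (forall m w, 0 <= u m w)%R ->
  (forall m w, u m w <= u m.+1 w)%R -> (forall m, \int[P]_w (u m w)%:E <= K%:E) ->
  measurable_fun setT (esup_seq u) /\ \int[P]_w esup_seq u w <= K%:E.
Proof.
move=> mu u0 und uK.
have nd w : {homo (fun m => (u m w)%:E) : i j / (i <= j)%N >-> i <= j}.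
  by apply/nondecreasing_seqP => m; rewrite lee_fin.
have cv w : (u m w)%:E @[m --> \oo] --> esup_seq u w by exact: ereal_nondecreasing_cvgn.
split.
  apply: (emeasurable_fun_cvg (fun m w => (u m w)%:E)) => [m|w _]; last exact: cv.
  exact/measurable_EFinP.
have := @cvg_monotone_convergence _ _ _ P _ measurableT (fun m w => (u m w)%:E).
rewrite (_ : (fun w => limn _) = esup_seq u); last first.
  by apply/funext => w; apply/cvg_lim => //; exact: cv.
move=> H; have {}H := H _ _ _.
have cvI : \int[P]_w (u m w)%:E @[m --> \oo] --> \int[P]_w esup_seq u w.
  apply: H.
  - by move=> m; exact/measurable_EFinP.
  - by move=> m w _; rewrite lee_fin.
  - by move=> w _; exact: nd.
rewrite -(cvg_lim _ cvI)//; apply: lime_le; last exact: nearW.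
by apply/cvg_ex; eexists; exact: cvI.
Qed.

End monotone_limits.

Section increments.
Context {R : realType} (nu : probability (LipG R) R).
Local Notation point := ((R * R) * LipG R)%type.
Context d (Omega : measurableType d) (P : probability Omega R).
Variable N : Omega -> set point.
Hypothesis NP : poisson_process P (pp_intensity nu) N.
Hypothesis Nsep : forall w, separated (N w).
Variables (z0 p Phi beta : R).
Hypothesis p01 : 0 < p <= 1.
Hypothesis PhiE : (\int[nu]_f (slope p f)%:E = Phi%:E)%E.
Hypothesis betaE : (\int[nu]_f (displacement z0 p f)%:E = beta%:E)%E.
Hypothesis Phi1 : Phi < 1.
Local Notation pprod := (point_prod N).

Lemma measurable_slope : measurable_fun setT (slope p : LipG R -> R).
Proof.
apply: (@measurableT_comp _ _ _ _ _ _ (fun r : R => r `^ p)); first exact: measurable_powR.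
exact: measurable_Lf.
Qed.

Lemma measurable_displacement : measurable_fun setT (displacement z0 p : LipG R -> R).
Proof.
apply: (@measurableT_comp _ _ _ _ _ _ (fun r : R => r `^ p)); first exact: measurable_powR.
apply: measurableT_comp => //; apply: measurable_funB => //; exact: measurable_eval.
Qed.

Let Phi0 : 0 <= Phi.
Proof. by rewrite -lee_fin -PhiE integral_ge0// => f _; rewrite lee_fin slope_ge0. Qed.
Let beta0 : 0 <= beta.
Proof. by rewrite -lee_fin -betaE integral_ge0// => f _; rewrite lee_fin displacement_ge0. Qed.

Let one1 : (\int[nu]_f (1 : R)%:E = 1%:E)%E.
Proof.
apply: (etrans (integral_cst nu measurableT 1%:E)).
by rewrite mul1e; exact: probability_setT.
Qed.

Let slope1E : (\int[nu]_f (1 + slope p f)%:E = (1 + Phi)%:E)%E.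
Proof.
under eq_integral do rewrite EFinD.
rewrite ge0_integralD//; [by rewrite one1 PhiE| | ].
- by move=> f _; rewrite lee_fin slope_ge0.
- by apply/measurable_EFinP; exact: measurable_slope.
Qed.

Let weight (f : LipG R) : R := 1 + slope p f + displacement z0 p f.

Let mweight : measurable_fun setT weight.
Proof.
apply: measurable_funD; last exact: measurable_displacement.
by apply: measurable_funD => //; exact: measurable_slope.
Qed.

Let weight0 f : 0 <= weight f.
Proof. by rewrite !addr_ge0 ?slope_ge0 ?displacement_ge0. Qed.

Let weightE : (\int[nu]_f (weight f)%:E = (1 + Phi + beta)%:E)%E.
Proof.
under eq_integral do rewrite EFinD.
rewrite ge0_integralD//; [by rewrite slope1E betaE| | | |].
- by move=> f _; rewrite lee_fin addr_ge0 ?slope_ge0.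
- by apply/measurable_EFinP; apply: measurable_funD => //; exact: measurable_slope.
- by move=> f _; rewrite lee_fin displacement_ge0.
- by apply/measurable_EFinP; exact: measurable_displacement.
Qed.

(* [rho0], [kappa0] bound the means of the cell products of [wr] and [wc] over a time
   cell of length [1 / x], uniformly in [0 < x <= y <= 1] as long as
   [y - x <= step_ratio * x]; then [dconst * (y - x) / x] bounds the excess of the mean
   of the product of [wd] over that of [wc]. *)
Definition rho0 : R := expR (- (1 - Phi) / 2).
Definition kappa0 : R := expR (2 * (Phi + beta)).
Definition wconst : R := kappa0 / (1 - rho0).
Definition dconst : R := kappa0 * ((1 + Phi + beta) * expR (1 + Phi + beta)).
Definition kconst : R := wconst + dconst * (1 + wconst) / (1 - rho0).
Definition step_ratio : R := (1 - Phi) / 2.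

Let rho01 : 0 < rho0 < 1.
Proof. by rewrite /rho0 expR_gt0 /= expR_lt1 mulNr oppr_lt0 divr_gt0// subr_gt0. Qed.

Let kappa0_ge0 : 0 <= kappa0. Proof. exact: expR_ge0. Qed.
Let wconst_ge0 : 0 <= wconst.
Proof. by case/andP: rho01 => ? ?; rewrite divr_ge0// subr_ge0 ltW. Qed.
Let dconst_ge0 : 0 <= dconst.
Proof. by rewrite mulr_ge0// mulr_ge0 ?expR_ge0// !addr_ge0. Qed.

Lemma kconst_ge0 : 0 <= kconst.
Proof.
case/andP: rho01 => ? ?.
by rewrite addr_ge0// divr_ge0 ?subr_ge0 ?mulr_ge0 ?addr_ge0// ltW.
Qed.

Section one_interval.
Variables x y : R.
Hypothesis x0 : 0 < x.
Hypothesis xy : x <= y.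
Hypothesis y1 : y <= 1.
Hypothesis xystep : y - x <= step_ratio * x.

(** Mean number of points of level in [(x, y]] in one cell; for levels at most [x] it is 1. *)
Let lam : R := (y - x) / x.
Let lam0 : 0 <= lam. Proof. by rewrite divr_ge0 ?subr_ge0// ltW. Qed.
Let lam_step : lam <= (1 - Phi) / 2. Proof. by rewrite ler_pdivrMr. Qed.
Let lam1 : lam <= 1. Proof. by have := lam_step; have := Phi0; lra. Qed.

Let cell (j : nat) : set point := strip (j%:R / x) (j.+1%:R / x).
Let past_ge0 (j : nat) : 0 <= j%:R / x. Proof. by rewrite divr_ge0// ltW. Qed.
Let cell_le (j : nat) : j%:R / x <= j.+1%:R / x.
Proof. by rewrite ler_wpM2r ?invr_ge0 ?ltW// ltr_nat. Qed.

Let wrE : wr p x y = bylevel x y (slope p) (fun f => 1 + slope p f) (fun=> 1).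
Proof.
apply/funext => q; rewrite /wr /bylevel /is_old /is_new.
by case: leP => //= xq; case: leP.
Qed.
Let wcE : wc z0 p y = bylevel x y weight weight (fun=> 1).
Proof.
apply/funext => q; rewrite /wc /bylevel /weight; case: ifP => [qy|qy].
  by rewrite ?qy; case: ifP.
by case: ifPn => [qx|_]; [move: qy; rewrite (le_trans qx xy)|rewrite ?qy].
Qed.
Let wdE : wd z0 p x y = bylevel x y weight (fun f => 2 * weight f) (fun=> 1).
Proof.
apply/funext => q; rewrite /wd wcE /bylevel /is_new.
by case: (leP q.1.2 x) => //= xq; case: leP.
Qed.

Let bylevel_weight (f1 f2 f3 : LipG R -> R) (e1 e2 e3 : R) j :
  measurable_fun setT f1 -> measurable_fun setT f2 -> measurable_fun setT f3 ->
  (forall f, 0 <= f1 f) -> (forall f, 0 <= f2 f) -> (forall f, 0 <= f3 f) ->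
  (\int[nu]_f (f1 f)%:E = e1%:E)%E -> (\int[nu]_f (f2 f)%:E = e2%:E)%E ->
  (\int[nu]_f (f3 f)%:E = e3%:E)%E ->
  strip_weight nu (j%:R / x) (j.+1%:R / x) (bylevel x y f1 f2 f3) /\
  (\int[P]_w (pprod (bylevel x y f1 f2 f3) (cell j) w)%:E =
   (expR ((x * e1 + (y - x) * e2 + (1 - y) * e3 - 1) / x))%:E)%E.
Proof.
move=> m1 m2 m3 p1 p2 p3 i1 i2 i3.
have iE := integral_strip_bylevel (cell_le j) (ltW x0) xy y1 m1 m2 m3 p1 p2 p3 i1 i2 i3.
have sw : strip_weight nu (j%:R / x) (j.+1%:R / x) (bylevel x y f1 f2 f3).
  split; first exact: measurable_bylevel.
    by move=> q; rewrite /bylevel; case: ifP => // _; case: ifP.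
  by rewrite iE ltry.
split => //; have [_ ->] := expect_strip NP Nsep (past_ge0 j) (cell_le j) sw.
rewrite iE /=; congr (expR _)%:E.
by rewrite -mulrBl -natr1 (addrC _ 1) addrK; ring.
Qed.

(** [rho], [kappa] and [delta] are the exact means of the cell products of [wr], [wc] and [wd]:
    exponentials of the integral over a cell of the weight minus 1. *)
Let rho : R := expR ((x * Phi + (y - x) * (1 + Phi) + (1 - y) * 1 - 1) / x).
Let kappa : R := expR ((x * (1 + Phi + beta) + (y - x) * (1 + Phi + beta) + (1 - y) * 1 - 1) / x).
Let delta : R := expR ((x * (1 + Phi + beta) + (y - x) * (2 * (1 + Phi + beta)) + (1 - y) * 1 - 1) / x).

Let xN0 : x != 0. Proof. by rewrite gt_eqF. Qed.

(** The exponent is [lam * Phi - (1 - Phi)]; [step_ratio] is chosen so that the new points spoil at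
    most half of the gap [1 - Phi]. *)
Let rho_le : rho <= rho0.
Proof.
rewrite ler_expR.
have -> : (x * Phi + (y - x) * (1 + Phi) + (1 - y) * 1 - 1) / x = - (1 - Phi) + lam * Phi.
  by rewrite /lam; field.
have : lam * Phi <= lam * 1 by rewrite ler_wpM2l// ltW.
have := lam_step; lra.
Qed.

Let kappa_le : kappa <= kappa0.
Proof.
rewrite ler_expR.
have -> : (x * (1 + Phi + beta) + (y - x) * (1 + Phi + beta) + (1 - y) * 1 - 1) / x =
  (1 + lam) * (Phi + beta) by rewrite /lam; field.
by rewrite ler_wpM2r ?addr_ge0//; have := lam1; lra.
Qed.

(** [delta = kappa * expR (lam * c)], and [expR u - 1 <= u * expR u] with [lam <= 1] makes the
    excess linear in [lam]. This is the source of the factor [(y - x) / x] in [Vsup_integral]. *)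
Let delta_kappa : delta - kappa <= dconst * lam.
Proof.
set c := 1 + Phi + beta.
have c0 : 0 <= c by rewrite !addr_ge0.
have -> : delta = kappa * expR (lam * c).
  by rewrite /delta /kappa -expRD; congr expR; rewrite /lam /c; field.
have u0 : 0 <= lam * c by rewrite mulr_ge0.
have h1 : expR (lam * c) - 1 <= lam * c * expR (lam * c).
  have := expR_ge1Dx (- (lam * c)); rewrite expRN => h.
  have e0 := expR_gt0 (lam * c).
  have : (1 - lam * c) * expR (lam * c) <= 1.
    by rewrite -ler_pdivlMr// mul1r.
  lra.
have h2 : lam * c * expR (lam * c) <= lam * c * expR c.
  by rewrite ler_wpM2l// ler_expR -[leRHS]mul1r ler_wpM2r.
rewrite -[X in _ - X]mulr1 -mulrBr /dconst -/c.
apply: (@le_trans _ _ (kappa * (lam * c * expR c))).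
  by rewrite ler_wpM2l ?expR_ge0// (le_trans h1).
rewrite (_ : kappa0 * _ * lam = kappa0 * (lam * c * expR c)); last by ring.
by apply: ler_wpM2r; [rewrite mulr_ge0 ?expR_ge0// mulr_ge0|exact: kappa_le].
Qed.

Let wr_cell j : strip_weight nu (j%:R / x) (j.+1%:R / x) (wr p x y) /\
  (\int[P]_w (pprod (wr p x y) (cell j) w)%:E = rho%:E)%E.
Proof.
rewrite wrE; apply: bylevel_weight => //.
- exact: measurable_slope.
- by apply: measurable_funD => //; exact: measurable_slope.
- by move=> f; exact: slope_ge0.
- by move=> f; rewrite addr_ge0 ?slope_ge0.
Qed.

Let wc_cell j : strip_weight nu (j%:R / x) (j.+1%:R / x) (wc z0 p y) /\
  (\int[P]_w (pprod (wc z0 p y) (cell j) w)%:E = kappa%:E)%E.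
Proof. by rewrite wcE; exact: bylevel_weight. Qed.

Let wd_cell j : strip_weight nu (j%:R / x) (j.+1%:R / x) (wd z0 p x y) /\
  (\int[P]_w (pprod (wd z0 p x y) (cell j) w)%:E = delta%:E)%E.
Proof.
rewrite wdE; apply: bylevel_weight => //.
- by apply: measurable_funM.
- by move=> f; rewrite mulr_ge0.
- under eq_integral do rewrite EFinM.
  rewrite ge0_integralZl_EFin//; [by rewrite weightE| |].
  + by move=> f _; rewrite lee_fin.
  + exact/measurable_EFinP.
Qed.

(* Dominating recursions over [m] cells from the [j]-th one on; the cell factors are
   independent of the later ones, so the means [ew], [ev] obey the same recursions. *)
Fixpoint What (m j : nat) (w : Omega) : R := if m is m'.+1 then
  pprod (wc z0 p y) (cell j) w + pprod (wr p x y) (cell j) w * What m' j.+1 w else 0.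

Fixpoint Vhat (m j : nat) (w : Omega) : R := if m is m'.+1 then
  pprod (wr p x y) (cell j) w * Vhat m' j.+1 w +
  (pprod (wd z0 p x y) (cell j) w - pprod (wc z0 p y) (cell j) w) * (1 + What m' j.+1 w)
  else 0.

Fixpoint ew (m : nat) : R := if m is m'.+1 then kappa + rho * ew m' else 0.
Fixpoint ev (m : nat) : R := if m is m'.+1 then
  rho * ev m' + (delta * (1 + ew m') - kappa * (1 + ew m')) else 0.

Let pr_ge0 j w : 0 <= pprod (wr p x y) (cell j) w.
Proof. by apply: point_prod_ge0 => q; exact: wr_ge0. Qed.
Let pc_ge0 j w : 0 <= pprod (wc z0 p y) (cell j) w.
Proof. by apply: point_prod_ge0 => q; exact: wc_ge0. Qed.
Let pcd j w : pprod (wc z0 p y) (cell j) w <= pprod (wd z0 p x y) (cell j) w.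
Proof. exact: prod_wc_le_wd. Qed.

Let What_ge0 m j w : 0 <= What m j w.
Proof. by elim: m j => //= m IH j; rewrite addr_ge0 ?mulr_ge0. Qed.
Let Vhat_ge0 m j w : 0 <= Vhat m j w.
Proof.
by elim: m j => //= m IH j; rewrite addr_ge0 ?mulr_ge0 ?subr_ge0 ?addr_ge0.
Qed.
Let What_mono m j w : What m j w <= What m.+1 j w.
Proof.
elim: m j => [|m IH] j; first exact: What_ge0.
by rewrite [leLHS]/= [leRHS]/= lerD2l ler_wpM2l.
Qed.
Let Vhat_mono m j w : Vhat m j w <= Vhat m.+1 j w.
Proof.
elim: m j => [|m IH] j; first exact: Vhat_ge0.
change (pprod (wr p x y) (cell j) w * Vhat m j.+1 w +
  (pprod (wd z0 p x y) (cell j) w - pprod (wc z0 p y) (cell j) w) * (1 + What m j.+1 w) <=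
  pprod (wr p x y) (cell j) w * Vhat m.+1 j.+1 w +
  (pprod (wd z0 p x y) (cell j) w - pprod (wc z0 p y) (cell j) w) * (1 + What m.+1 j.+1 w)).
by apply: lerD; rewrite ler_wpM2l// ?subr_ge0// lerD2l.
Qed.

(** [wconst] is the fixed point of [w = kappa0 + rho0 * w], which dominates the recursion;
    [ev_bound] uses a fixed point in the same way. *)
Let ew_bound m : 0 <= ew m <= wconst.
Proof.
case/andP: rho01 => r0 r1; elim: m => [|m /andP[IH0 IH1]] /=; first by rewrite lexx.
rewrite addr_ge0 ?mulr_ge0 ?expR_ge0//=.
have -> : wconst = kappa0 + rho0 * wconst.
  by rewrite /wconst; field; rewrite gt_eqF// subr_gt0.
by apply: lerD => //; rewrite ler_pM// expR_ge0.
Qed.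

Let ev_bound m : ev m <= dconst * (1 + wconst) / (1 - rho0) * lam.
Proof.
case/andP: rho01 => r0 r1.
set B := dconst * (1 + wconst) / (1 - rho0) * lam.
have B0 : 0 <= B.
  by rewrite mulr_ge0// divr_ge0 ?subr_ge0 ?mulr_ge0 ?addr_ge0// ltW.
elim: m => [//|m IH] /=; have /andP[e0 e1] := ew_bound m.
have -> : B = rho0 * B + dconst * lam * (1 + wconst).
  by rewrite /B; field; rewrite gt_eqF// subr_gt0.
apply: lerD.
  apply: (@le_trans _ _ (rho * B)); first by rewrite ler_wpM2l ?expR_ge0.
  by rewrite ler_wpM2r.
rewrite -mulrBl; apply: (@le_trans _ _ (dconst * lam * (1 + ew m))).
  by rewrite ler_wpM2r ?addr_ge0.
by apply: ler_wpM2l; [exact: mulr_ge0|rewrite lerD2l].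
Qed.

Let What_indep m j : future_indep nu P N (j%:R / x) (What m j) (ew m).
Proof.
elim: m j => [|m IH] j /=; first exact: (future_indep_cst NP Nsep).
apply: (future_indepD NP Nsep) => //.
  have := future_indep_step NP Nsep (past_ge0 j) (cell_le j) (wc_cell j).1 (wc_cell j).2
    (future_indep_cst NP Nsep ler01 (past_ge0 j.+1)).
  by rewrite mulr1; under [X in future_indep _ _ _ _ X]eq_fun do rewrite mulr1.
exact: (future_indep_step NP Nsep (past_ge0 j) (cell_le j) (wr_cell j).1 (wr_cell j).2).
Qed.

Let Vhat_indep m j : future_indep nu P N (j%:R / x) (Vhat m j) (ev m).
Proof.
elim: m j => [|m IH] j /=; first exact: (future_indep_cst NP Nsep).
apply: (future_indepD NP Nsep) => //.
  exact: (future_indep_step NP Nsep (past_ge0 j) (cell_le j) (wr_cell j).1 (wr_cell j).2).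
(* [future_indep_step] takes a single product functional, so the difference is expanded; [ev] is
   written as the matching difference. *)
under [X in future_indep _ _ _ _ X]eq_fun do rewrite mulrBl.
have i1 : future_indep nu P N (j.+1%:R / x) (fun w => 1 + What m j.+1 w) (1 + ew m).
  by apply: (future_indepD NP Nsep) => //; exact: (future_indep_cst NP Nsep).
apply: (future_indepB NP Nsep) => //.
- by move=> w; rewrite ler_wpM2r ?addr_ge0.
- exact: (future_indep_step NP Nsep (past_ge0 j) (cell_le j) (wd_cell j).1 (wd_cell j).2).
- exact: (future_indep_step NP Nsep (past_ge0 j) (cell_le j) (wc_cell j).1 (wc_cell j).2).
Qed.

Let slist_cell w j m : slist (N w) (j%:R / x) ((j + m.+1)%:R / x) =
  slist (N w) (j%:R / x) (j.+1%:R / x) ++ slist (N w) (j.+1%:R / x) ((j.+1 + m)%:R / x).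
Proof.
rewrite (slist_cat (Nsep w) (past_ge0 j) (cell_le j)) ?addSnnS//.
by apply: ler_wpM2r; [rewrite invr_ge0 ltW|rewrite ler_nat -addSnnS leq_addr].
Qed.

Let prod_cell (g : point -> R) w j :
  \prod_(q <- slist (N w) (j%:R / x) (j.+1%:R / x)) g q = pprod g (cell j) w.
Proof. by rewrite /point_prod; apply: perm_big; rewrite perm_sym perm_slist. Qed.

Let slist_nil w j : slist (N w) (j%:R / x) (j%:R / x) = [::].
Proof.
case e : (slist _ _ _) => [//|q l].
have /(mem_slist (Nsep w) _ _ (past_ge0 j))[_ [/andP[h1 h2] _]] :
  q \in slist (N w) (j%:R / x) (j%:R / x) by rewrite e mem_head.
by have := lt_le_trans h1 h2; rewrite ltxx.
Qed.

Let wW_What w m j : wW z0 p x y (slist (N w) (j%:R / x) ((j + m)%:R / x)) <= What m j w.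
Proof.
elim: m j => [|m IH] j; first by rewrite addn0 slist_nil.
rewrite slist_cell; apply: (le_trans (wW_cat_le _ _ xy _ _)).
by rewrite !prod_cell /= lerD2l ler_wpM2l.
Qed.

Let wV_Vhat w m j : wV z0 p x y (slist (N w) (j%:R / x) ((j + m)%:R / x)) <= Vhat m j w.
Proof.
elim: m j => [|m IH] j; first by rewrite addn0 slist_nil.
rewrite slist_cell; apply: (le_trans (wV_cat_le _ _ xy _ _)).
rewrite !prod_cell /=; apply: lerD; first by rewrite ler_wpM2l.
by rewrite ler_wpM2l ?subr_ge0// lerD2l; exact: wW_What.
Qed.

Definition Wsup : Omega -> \bar R := esup_seq (fun m => What m 0).
Definition Vsup : Omega -> \bar R := esup_seq (fun m => Vhat m 0).

Lemma Wsup_ge0 w : (0 <= Wsup w)%E.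
Proof. exact: (esup_seq_ge (fun m => What m 0) w 0). Qed.
Lemma Vsup_ge0 w : (0 <= Vsup w)%E.
Proof. exact: (esup_seq_ge (fun m => Vhat m 0) w 0). Qed.

Lemma Wsup_integral : measurable_fun setT Wsup /\ (\int[P]_w Wsup w <= kconst%:E)%E.
Proof.
case/andP: rho01 => r0 r1.
apply: esup_seq_integral => // m; first by have [] := What_indep m 0.
rewrite (future_indep_expect NP Nsep (past_ge0 0) (What_indep m 0)) lee_fin.
case/andP: (ew_bound m) => _ /le_trans; apply.
by rewrite lerDl divr_ge0 ?subr_ge0 ?mulr_ge0 ?addr_ge0// ltW.
Qed.

Lemma Vsup_integral : measurable_fun setT Vsup /\
  (\int[P]_w Vsup w <= (kconst * ((y - x) / x))%:E)%E.
Proof.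
apply: esup_seq_integral => // m; first by have [] := Vhat_indep m 0.
rewrite (future_indep_expect NP Nsep (past_ge0 0) (Vhat_indep m 0)) lee_fin.
by rewrite (le_trans (ev_bound m))// ler_wpM2r// lerDr.
Qed.

Let slist_le (w : Omega) (t : R) : 0 <= t -> exists (m : nat) l',
  slist (N w) 0 (m%:R / x) = slist (N w) 0 t ++ l'.
Proof.
move=> t0; have tx0 : 0 <= t * x by rewrite mulr_ge0// ltW.
exists (Num.bound (t * x)), (slist (N w) t ((Num.bound (t * x))%:R / x)).
apply: slist_cat => //; rewrite ler_pdivlMr//.
exact/ltW/archi_boundP.
Qed.

Lemma wW_Wsup w t : 0 <= t -> ((wW z0 p x y (slist (N w) 0 t))%:E <= Wsup w)%E.
Proof.
move=> t0; have [m [l' e]] := slist_le w t0.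
apply: (le_trans _ (esup_seq_ge (fun m => What m 0) w m)); rewrite lee_fin.
apply: (le_trans (wW_le_cat z0 p x y _ l')); rewrite -e.
by have := wW_What w m 0; rewrite mul0r add0n.
Qed.

Lemma wV_Vsup w t : 0 <= t -> ((wV z0 p x y (slist (N w) 0 t))%:E <= Vsup w)%E.
Proof.
move=> t0; have [m [l' e]] := slist_le w t0.
apply: (le_trans _ (esup_seq_ge (fun m => Vhat m 0) w m)); rewrite lee_fin.
apply: (le_trans (wV_le_cat z0 p x y _ l')); rewrite -e.
by have := wV_Vhat w m 0; rewrite mul0r add0n.
Qed.

Let in01 z : x <= z <= y -> 0 <= z <= 1.
Proof. by case/andP=> xz zy; rewrite (le_trans (ltW x0) xz) (le_trans zy y1). Qed.

(** Take [T] with [U T] within the p-th power of [e] of the supremum of [U]; later changes of the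
    composition have p-th power at most [U t - U T]. Since [Wsup] does not involve [z], its
    finiteness gives convergence at all levels of [[x, y]] at once. *)
Lemma zeta_cvg w z : (Wsup w < +oo)%E -> x <= z <= y ->
  zeta_t z0 (N w) t z @[t --> +oo] --> zeta z0 (N w) z.
Proof.
move=> Wfin xzy; have /andP[xz zy] := xzy.
have Wf : Wsup w \is a fin_num by rewrite ge0_fin_numE// Wsup_ge0.
pose U t := wW z0 p x y (slist (N w) 0 t).
have Ule t : 0 <= t -> U t <= fine (Wsup w).
  by move=> t0; rewrite -lee_fin fineK//; exact: wW_Wsup.
pose E := [set U t | t in [set t | 0 <= t]].
have hsE : has_sup E.
  split; first by exists (U 0), 0 => //=.
  by exists (fine (Wsup w)) => _ [t t0 <-]; exact: Ule.
suff : cvg (zeta_t z0 (N w) t z @[t --> +oo]) by [].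
apply/cauchy_cvgP/cauchy_exP => e e0.
have ep0 : 0 < e `^ p by rewrite powR_gt0.
have [_ [T T0 <-] HT] := sup_adherent ep0 hsE.
exists (zeta_t z0 (N w) T z).
suff : \forall t \near +oo, ball (zeta_t z0 (N w) T z) e (zeta_t z0 (N w) t z) by [].
near=> t; rewrite /ball/=.
have Tt : T <= t by near: t; exact: (nbhs_pinfty_ge (num_real T)).
have t0 : 0 <= t by exact: le_trans T0 Tt.
rewrite !zeta_tE ?in01// (slist_cat (Nsep w) (lexx 0) T0 Tt) distrC.
rewrite ltNge; apply/negP => le_e.
have := compose_le_cat z0 p01 (slist (N w) 0 T) (slist (N w) T t) xz zy.
rewrite -(slist_cat (Nsep w) (lexx 0) T0 Tt) leNgt => /negP; apply.
apply: (@lt_le_trans _ _ (e `^ p)); last first.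
  by rewrite (slist_cat (Nsep w) (lexx 0) T0 Tt); apply: powR_le_mono => //; exact: ltW.
have : U t <= sup E by apply: sup_upper_bound => //; exists t.
by move: HT; rewrite /U; lra.
Unshelve. all: by end_near. Qed.

Lemma zeta_bound w z : x <= z <= y ->
  ((`|zeta z0 (N w) z - z0| `^ p)%:E <= Wsup w)%E.
Proof.
move=> xzy; have /andP[xz zy] := xzy.
have [Wfin|] := ltP (Wsup w) +oo%E; last by rewrite leye_eq => /eqP ->; rewrite leey.
have Wf : Wsup w \is a fin_num by rewrite ge0_fin_numE// Wsup_ge0.
have cv : `|zeta_t z0 (N w) t z - z0| `^ p @[t --> +oo] --> `|zeta z0 (N w) z - z0| `^ p.
  by apply: cvg_normpow => //; apply: cvgB; [exact: zeta_cvg|exact: cvg_cst].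
rewrite -(fineK Wf) lee_fin -(cvg_lim _ cv)//; apply: limr_le.
  by apply/cvg_ex; eexists; exact: cv.
near=> t; have t0 : 0 <= t by near: t; exact: (nbhs_pinfty_ge (num_real 0)).
rewrite zeta_tE ?in01//; apply: (le_trans (compose_le_bound z0 p01 _ xz zy)).
by rewrite -lee_fin fineK//; exact: wW_Wsup.
Unshelve. all: by end_near. Qed.

Lemma zeta_variation w n (z : nat -> R) : (Wsup w < +oo)%E ->
  (forall i, (i <= n)%N -> x <= z i <= y) ->
  (forall i, (i < n)%N -> z i <= z i.+1) ->
  ((\sum_(i < n) `|zeta z0 (N w) (z i.+1) - zeta z0 (N w) (z i)| `^ p)%:E <= Vsup w)%E.
Proof.
move=> Wfin zI zm.
have [Vfin|] := ltP (Vsup w) +oo%E; last by rewrite leye_eq => /eqP ->; rewrite leey.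
have Vf : Vsup w \is a fin_num by rewrite ge0_fin_numE// Vsup_ge0.
have cv : \sum_(i < n) `|zeta_t z0 (N w) t (z i.+1) - zeta_t z0 (N w) t (z i)| `^ p
    @[t --> +oo] --> \sum_(i < n) `|zeta z0 (N w) (z i.+1) - zeta z0 (N w) (z i)| `^ p.
  apply: (cvg_sum_fin (u := fun i t =>
      `|zeta_t z0 (N w) t (z i.+1) - zeta_t z0 (N w) t (z i)| `^ p)
    (l := fun i => `|zeta z0 (N w) (z i.+1) - zeta z0 (N w) (z i)| `^ p)) => i iN.
  by apply: cvg_normpow => //; apply: cvgB; apply: zeta_cvg => //; apply: zI => //; exact: ltnW.
rewrite -(fineK Vf) lee_fin -(cvg_lim _ cv)//; apply: limr_le.
  by apply/cvg_ex; eexists; exact: cv.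
near=> t; have t0 : 0 <= t by near: t; exact: (nbhs_pinfty_ge (num_real 0)).
apply: (@le_trans _ _ (wV z0 p x y (slist (N w) 0 t))); last first.
  by rewrite -lee_fin fineK//; exact: wV_Vsup.
apply: (le_trans _ (compose_le_variation z0 p01 _ zI zm)).
apply: ler_sum => i _; rewrite !zeta_tE// in01// zI//.
exact: ltnW.
Unshelve. all: by end_near. Qed.

End one_interval.
End increments.

(** * Integration over dyadic blocks *)

Section dyadic_blocks.
Context {R : realType}.
Variables (h g : R -> R) (p : R).
Hypothesis p01 : 0 < p <= 1.
Hypothesis hu : unif_cont_on h 0 1.

Definition dy (m : nat) : R := 2^-1 ^+ m.

Lemma dy_gt0 m : 0 < dy m. Proof. by rewrite exprn_gt0// invr_gt0. Qed.
Lemma dyS m : dy m.+1 = dy m / 2. Proof. by rewrite /dy exprS mulrC. Qed.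
Lemma dy_lt m : dy m.+1 < dy m.
Proof. by rewrite dyS; have := dy_gt0 m; lra. Qed.
Lemma dy_le1 m : dy m <= 1.
Proof. by apply: exprn_ile1; lra. Qed.
Lemma dy_anti m n : (m <= n)%N -> dy n <= dy m.
Proof. by move=> mn; apply: ler_wiXn2l => //; lra. Qed.

Lemma dy_locate (a : R) : 0 < a < 1 -> exists M : nat, dy M.+1 <= a < dy M.
Proof.
move=> /andP[a0 a1].
have ex : exists n, dy n <= a.
  have ia0 : 0 <= a^-1 by rewrite invr_ge0 ltW.
  exists (Num.bound a^-1); rewrite /dy exprVn -[leRHS]invrK lef_pV2 ?posrE ?invr_gt0 ?exprn_gt0//.
  apply/ltW/(lt_le_trans (archi_boundP ia0)).
  by rewrite -natrX ler_nat ltnW// ltn_expl.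
case: (ex_minnP ex) => -[|M] h1 h2; first by move: h1; rewrite /dy expr0 leNgt a1.
exists M; rewrite h1 /= ltNge; apply/negP => /h2; by rewrite ltnn.
Qed.

Lemma partition_locate a b n (x : nat -> R) z : is_partition a b n x -> (0 < n)%N ->
  a <= z <= b -> exists2 i, (i < n)%N & x i <= z <= x i.+1.
Proof.
move=> [x0 xn xlt] n0 /andP[az zb].
have ex : exists i, (i < n)%N && (z <= x i.+1).
  by exists n.-1; rewrite prednK// xn leqnn.
case: (ex_minnP ex) => i /andP[iN zi] imin; exists i => //; rewrite zi andbT.
case: i iN zi imin => [|i] iN zi imin; first by rewrite x0.
rewrite leNgt; apply/negP => zx.
by have := imin i; rewrite (ltnW iN) (ltW zx) ltnn => /(_ isT).
Qed.

Variables (n : nat -> nat) (x s V : nat -> nat -> R).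
Hypothesis xP : forall m, is_partition (dy m.+1) (dy m) (n m).+1 (x m).
Hypothesis hs : forall m i, (i <= n m)%N -> forall t, x m i <= t <= x m i.+1 ->
  `|h t| `^ p <= s m i.
Hypothesis gV : forall m i, (i <= n m)%N -> forall k (z : nat -> R),
  (forall j, (j <= k)%N -> x m i <= z j <= x m i.+1) ->
  (forall j, (j < k)%N -> z j <= z j.+1) ->
  \sum_(j < k) `|g (z j.+1) - g (z j)| `^ p <= V m i.

Definition block_bound m : R := \sum_(i < (n m).+1) s m i * V m i.

Hypothesis summable : (\sum_(0 <= m <oo) (block_bound m)%:E < +oo)%E.

Let xlt m i : (i <= n m)%N -> x m i < x m i.+1.
Proof. by have [_ _ H] := xP m; exact: H. Qed.
Let sV0 m i : (i <= n m)%N -> 0 <= s m i * V m i.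
Proof.
move=> iN; have := gV iN (k := 0) (z := fun=> x m i).
rewrite big_ord0 => V0; apply: mulr_ge0; last first.
  by apply: V0 => // j _; rewrite lexx ltW ?xlt.
by apply: le_trans (powR_ge0 _ _) (hs iN (t := x m i) _); rewrite lexx ltW ?xlt.
Qed.
Let bb0 m : 0 <= block_bound m.
Proof. by apply: sumr_ge0 => i _; apply: sV0; rewrite -ltnS. Qed.

(** For [p <= 1] a sum is at most the [p^-1]-th power of the sum of p-th powers, so [V m i] controls
    the variation on each cell; variations add over cells. *)
Lemma block_variation m : bounded_variation (dy m.+1) (dy m) g.
Proof.
have [x0 xn _] := xP m; have xm := is_partition_mono (xP m).
suff H j : (j <= (n m).+1)%N -> total_variation (x m 0) (x m j) g \is a fin_num.
  rewrite -x0 -xn; apply/bounded_variationP; last exact: H.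
  by rewrite x0 xn ltW// dy_lt.
elim: j => [_|j IH jn].
  by apply/(bounded_variationP _ (lexx _)); exact: bounded_variationxx.
rewrite (total_variationD _ (xm 0 j isT (ltnW jn)) (xm j j.+1 (leqnSn _) jn)).
rewrite fin_numD IH 1?ltnW//=; apply/bounded_variationP; first exact: xm.
have jn' : (j <= n m)%N by [].
apply: (@bounded_variation_of_sums _ _ _ _ (V m j `^ p^-1)) => k z zI zm.
have := gV jn' zI zm => H; apply: (powR_le_inv p01); first exact: sumr_ge0.
exact: le_trans (powR_sum_le p01 _ _) H.
Qed.

Lemma dyadic_variation M : bounded_variation (dy M) 1 g.
Proof.
apply/bounded_variationP; first exact: dy_le1.
elim: M => [|M IH].
  by apply/(bounded_variationP _ (lexx _)); exact: bounded_variationxx.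
rewrite (total_variationD _ (ltW (dy_lt M)) (dy_le1 M)) fin_numD IH andbT.
by apply/bounded_variationP; [exact/ltW/dy_lt|exact: block_variation].
Qed.

Lemma rs_exists01 a c : 0 < a -> a < c -> c <= 1 ->
  is_RS_integral h g a c (RS_integral h g a c).
Proof.
move=> a0 ac c1; have a1 : 0 < a < 1 by rewrite a0 (lt_le_trans ac).
have [M /andP[Ma aM]] := dy_locate a1.
have bv : bounded_variation a c g.
  apply: (@bounded_variationl _ _ _ 1) => //; first exact: ltW.
  apply: (bounded_variationr Ma (ltW (lt_le_trans ac c1))).
  exact: dyadic_variation.
have [I HI] := rs_exists ac (unif_cont_on_sub (ltW a0) c1 hu) bv.
by rewrite (RS_integral_val ac HI).
Qed.

Lemma rs_add01 a b c : 0 < a -> a < b -> b < c -> c <= 1 ->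
  RS_integral h g a c = RS_integral h g a b + RS_integral h g b c.
Proof.
move=> a0 ab bc c1.
apply: (rs_additive ab bc); apply: rs_exists01 => //.
- exact/ltW/(lt_le_trans bc).
- exact: lt_trans a0 ab.
- exact: lt_trans bc.
Qed.

(** The left end [a] may fall inside a cell, so the induction along the grid meets a truncated cell,
    on which the bounds of the full cell still hold. The choice [a = dy m.+1] covers the whole
    block. *)
Lemma rs_in_block m a : dy m.+1 <= a < dy m ->
  `|RS_integral h g a (dy m)| `^ p <= block_bound m.
Proof.
move=> /andP[ma am]; have a0 : 0 < a := lt_le_trans (dy_gt0 _) ma.
have [x0 xn _] := xP m; have xI := is_partition_itv (xP m).
suff H j : (j <= (n m).+1)%N -> a < x m j ->
    `|RS_integral h g a (x m j)| `^ p <= \sum_(i < j) s m i * V m i.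
  by rewrite -xn /block_bound; apply: H => //; rewrite xn.
elim: j => [_|j IH jn axj]; first by rewrite x0 ltNge ma.
have jn' : (j <= n m)%N by [].
have /andP[xj1 xj2] := xI _ jn; have xj11 : x m j.+1 <= 1 := le_trans xj2 (dy_le1 m).
rewrite big_ord_recr /=; have [xa|ax] := leP (x m j) a.
  apply: (@le_trans _ _ (s m j * V m j)); last first.
    by rewrite lerDr; apply: sumr_ge0 => i _; apply: sV0; rewrite (leq_trans (ltnW (ltn_ord i))).
  apply: (rs_powR_bound axj p01 _ _ (rs_exists01 a0 axj xj11)).
    by move=> t /andP[t1 t2]; apply: hs => //; rewrite (le_trans xa t1).
  move=> k z zI zm; apply: gV => // i ik.
  by have /andP[z1 z2] := zI _ ik; rewrite (le_trans xa z1).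
have xxj := xlt jn'.
rewrite (rs_add01 a0 ax xxj xj11); apply: (le_trans (normpowD p01 _ _)).
apply: lerD; first by apply: IH => //; exact: ltnW.
apply: (rs_powR_bound xxj p01 _ _ (rs_exists01 (lt_trans a0 ax) xxj xj11)).
  by move=> t; exact: hs.
by move=> k z zI zm; exact: gV.
Qed.

Definition block_int m : R := RS_integral h g (dy m.+1) (dy m).
Definition block_sum (k : nat) : R := \sum_(m < k) block_int m.

Lemma block_int_bound m : `|block_int m| `^ p <= block_bound m.
Proof. by apply: rs_in_block; rewrite lexx dy_lt. Qed.

Definition tail_bound M : \bar R := (\sum_(M <= m <oo) (block_bound m)%:E)%E.

Let bb0e m : (0 <= (block_bound m)%:E)%E. Proof. by rewrite lee_fin. Qed.

Lemma tail_fin M : tail_bound M \is a fin_num.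
Proof.
rewrite ge0_fin_numE; last by apply: nneseries_ge0.
apply: le_lt_trans summable.
rewrite (@nneseries_split _ _ 0 M)// add0n leeDr// sume_ge0//.
Qed.

Lemma tail_ge_block M : ((block_bound M)%:E <= tail_bound M)%E.
Proof.
rewrite /tail_bound (@nneseries_split _ _ M 1)// addn1 big_nat1.
by rewrite leeDl// nneseries_ge0.
Qed.

Lemma block_sum_dist M k : (M <= k)%N ->
  ((`|block_sum k - block_sum M| `^ p)%:E <= tail_bound M)%E.
Proof.
move=> Mk; rewrite /block_sum.
have -> : \sum_(m < k) block_int m - \sum_(m < M) block_int m = \sum_(M <= m < k) block_int m.
  rewrite -!(big_mkord xpredT block_int) (big_cat_nat _ Mk)//=.
  by rewrite addrAC subrr add0r.
apply: (@le_trans _ _ (\sum_(M <= m < k) (block_bound m)%:E)%E).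
  rewrite sumEFin lee_fin (le_trans (normpow_sum p01 _ _))//.
  by apply: ler_sum => m _; exact: block_int_bound.
by apply: nneseries_lim_ge.
Qed.

Lemma block_sum_cvg : cvgn block_sum.
Proof.
apply/cauchy_cvgP/cauchy_exP => e e0.
have ep0 : 0 < e `^ p by rewrite powR_gt0.
have := nneseries_tail_cvg summable (fun m _ => bb0e m).
move=> /fine_cvgP[_ /cvgrPdist_lt/(_ _ ep0)[M _ /(_ M (leqnn _)) HM]].
exists (block_sum M); exists M => // k /= Mk; rewrite /ball/= distrC.
rewrite ltNge; apply/negP => le_e.
have := block_sum_dist Mk; rewrite -(fineK (tail_fin M)) lee_fin leNgt => /negP; apply.
apply: (@lt_le_trans _ _ (e `^ p)); last by apply: powR_le_mono => //; exact: ltW.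
move: HM; rewrite /= sub0r normrN; apply: le_lt_trans.
exact: ler_norm.
Qed.

Definition block_lim : R := limn block_sum.

Lemma block_lim_dist M : ((`|block_lim - block_sum M| `^ p)%:E <= tail_bound M)%E.
Proof.
have cv : `|block_sum k - block_sum M| `^ p @[k --> \oo] --> `|block_lim - block_sum M| `^ p.
  by apply: cvg_normpow => //; apply: cvgB; [exact: block_sum_cvg|exact: cvg_cst].
rewrite -(fineK (tail_fin M)) lee_fin -(cvg_lim _ cv)//; apply: limr_le.
  by apply/cvg_ex; eexists; exact: cv.
exists M => // k /= Mk.
by rewrite -lee_fin fineK ?tail_fin//; exact: block_sum_dist.
Qed.

Lemma RS_block_split M a : dy M.+1 <= a < dy M ->
  RS_integral h g a 1 = RS_integral h g a (dy M) + block_sum M.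
Proof.
move=> /andP[Ma aM]; have a0 : 0 < a := lt_le_trans (dy_gt0 _) Ma.
have H k : (0 < k)%N -> RS_integral h g (dy k) 1 = block_sum k.
  elim: k => [//|[|k] IH] _; first by rewrite /block_sum big_ord1.
  rewrite (@rs_add01 _ (dy k.+1))//; try exact: dy_gt0; try exact: dy_lt.
    by rewrite IH// /block_sum [RHS]big_ord_recr /= addrC.
  by apply: (lt_le_trans (dy_lt k)); exact: dy_le1.
case: M Ma aM => [|M] Ma aM; first by rewrite /block_sum big_ord0 addr0 /dy expr0.
rewrite (@rs_add01 _ (dy M.+1))//; first by rewrite H.
by apply: (lt_le_trans (dy_lt M)); exact: dy_le1.
Qed.

(** One tail pays for the incomplete block between [a] and [dy M], the other for the distance from
    [block_sum M] to its limit. *)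
Lemma RS_lim_dist M a : dy M.+1 <= a < dy M ->
  ((`|RS_integral h g a 1 - block_lim| `^ p)%:E <= tail_bound M + tail_bound M)%E.
Proof.
move=> Ma; rewrite (RS_block_split Ma).
have -> : RS_integral h g a (dy M) + block_sum M - block_lim =
  RS_integral h g a (dy M) - (block_lim - block_sum M) by ring.
apply: (@le_trans _ _ ((`|RS_integral h g a (dy M)| `^ p)%:E +
    (`|block_lim - block_sum M| `^ p)%:E)%E).
  by rewrite -EFinD lee_fin -[in leRHS](normrN (block_lim - _)); exact: normpowD.
apply: leeD; last exact: block_lim_dist.
by apply: le_trans (tail_ge_block M); rewrite lee_fin rs_in_block.
Qed.

Lemma block_lim_bound : ((`|block_lim| `^ p)%:E <= tail_bound 0)%E.
Proof. by have := block_lim_dist 0; rewrite /block_sum big_ord0 subr0. Qed.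

End dyadic_blocks.

(** * Partitions adapted to the integrability condition on h *)

Section weighted_integral.
Context {R : realType}.
Variables (h : R -> R) (p : R).
Hypothesis p01 : 0 < p <= 1.
Hypothesis hc : {within `[0, 1], continuous h}.
Local Notation leb := (@lebesgue_measure R).
Local Notation k t := ((`|h t| `^ p) / t).
Hypothesis kint : (\int[leb]_(t in `]0%R, 1%R]) (k t)%:E < +oo)%E.

(** The 2 pays for replacing [1 / x i] by [1 / t] inside a dyadic block, the 1 for the oscillation
    of [h] on a cell; see [block_choice]. *)
Definition dens (t : R) : \bar R := (2 * k t + 1)%:E.

Let k_ge0 t : 0 < t -> 0 <= k t.
Proof. by move=> t0; rewrite divr_ge0 ?powR_ge0// ltW. Qed.

Lemma measurable_k : measurable_fun (`]0, 1]%classic : set R) (fun t => k t).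
Proof.
have m01 : measurable (`[0, 1]%classic : set R) by exact: measurable_itv.
have mh0 : measurable_fun (`[0, 1]%classic : set R) h.
  exact: (@subspace_continuous_measurable_fun _ _ (h : subspace `[0, 1] -> R)).
have sub : (`]0, 1]%classic : set R) `<=` `[0, 1]%classic.
  by apply: subset_itv; rewrite bnd_simp.
have mh := measurable_funS m01 sub mh0.
apply: (@eq_measurable_fun _ _ _ _ _ (fun t => `|h t| `^ p * t `^ (-1))).
  by move=> t; rewrite inE/= in_itv/= => /andP[t0 _]; rewrite powR_inv1// ltW.
apply: measurable_funM; last exact: measurable_funTS (@measurable_powR R (-1)).
apply: (@measurableT_comp _ _ _ _ _ _ (fun r : R => r `^ p)); first exact: measurable_powR.
exact: measurableT_comp.
Qed.

Lemma measurable_dens (A : set R) : A `<=` `]0, 1]%classic -> measurable_fun A dens.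
Proof.
move=> A01; apply: (measurable_funS (measurable_itv `]0, 1]) A01).
apply/measurable_EFinP; apply: measurable_funD => //.
by apply: measurable_funM => //; exact: measurable_k.
Qed.

Lemma dens_ge0 t : 0 < t -> (0 <= dens t)%E.
Proof. by move=> t0; rewrite lee_fin addr_ge0// mulr_ge0// k_ge0. Qed.

Let dens_ge0' (t : R) : `]0, 1]%classic t -> (0 <= dens t)%E.
Proof. by rewrite /= in_itv/= => /andP[t0 _]; exact: dens_ge0. Qed.

Lemma integral_itv_cst (a b c : R) : a < b ->
  (\int[leb]_(t in `]a, b]) c%:E = (c * (b - a))%:E)%E.
Proof.
move=> ab; apply: (etrans (integral_cst leb (measurable_itv `]a, b]) c%:E)).
rewrite EFinM; congr (_ * _)%E; apply: (etrans (lebesgue_measure_itv `]a, b])).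
by rewrite /= lte_fin ab -EFinB.
Qed.

Lemma dens_lty : (\int[leb]_(t in `]0%R, 1%R]) dens t < +oo)%E.
Proof.
rewrite (_ : dens = fun t => (2%:E * (k t)%:E + 1%:E)%E); last first.
  by apply/funext => t; rewrite /dens EFinD EFinM.
rewrite ge0_integralD//=; last 2 first.
- by move=> t; rewrite in_itv/= => /andP[t0 _]; rewrite -EFinM lee_fin mulr_ge0// k_ge0.
- apply: emeasurable_funM => //; apply/measurable_EFinP; exact: measurable_k.
rewrite ge0_integralZl_EFin//; last 2 first.
- by move=> t; rewrite /= in_itv/= => /andP[t0 _]; rewrite lee_fin k_ge0.
- by apply/measurable_EFinP; exact: measurable_k.
apply: lte_add_pinfty; first by rewrite lte_mul_pinfty.
by rewrite integral_itv_cst ?ltr01// ltry.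
Qed.

Lemma integral_chain (u : nat -> R) n : (forall i, (i < n)%N -> u i <= u i.+1) ->
  0 <= u 0%N -> u n <= 1 ->
  (\int[leb]_(t in `]u 0%N, u n]) dens t =
  \sum_(i < n) \int[leb]_(t in `]u i, u i.+1]) dens t)%E.
Proof.
move=> um u0; elim: n um => [|n IH] um un.
  by rewrite big_ord0 set_itvoc0 integral_set0.
have unn := um n (ltnSn n).
have u0n : u 0%N <= u n.
  elim: n um {IH un unn} => // n IH um; apply: (le_trans (IH _)); last exact: um.
  by move=> i iN; apply: um; exact: ltnW.
rewrite big_ord_recr /= -IH; last 2 first.
- by move=> i iN; apply: um; exact: ltnW.
- exact: le_trans un.
have -> : (`]u 0%N, u n.+1] = `]u 0%N, u n] `|` `]u n, u n.+1])%classic.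
  apply/seteqP; split => t /=; rewrite !in_itv/=.
    by move=> /andP[h1 h2]; have [h3|h3] := leP t (u n); [left; rewrite h1|right].
  by move=> [/andP[h1 h2]|/andP[h1 h2]]; apply/andP; split; lra.
have sub : (`]u 0%N, u n] `|` `]u n, u n.+1] `<=` `]0, 1])%classic.
  by move=> t [] /=; rewrite !in_itv/= => /andP[h1 h2]; apply/andP; split; lra.
rewrite ge0_integral_setU//; [exact: measurable_dens| |].
- by move=> t /sub/dens_ge0'.
- apply/disj_setPS => t [] /=; rewrite !in_itv/= => /andP[_ h1] /andP[h2 _]; lra.
Qed.

Definition block_mass (m : nat) : \bar R :=
  (\int[leb]_(t in `]dy m.+1, dy m]) dens t)%E.

Lemma block_mass_ge0 m : (0 <= block_mass m)%E.
Proof.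
apply: integral_ge0 => t; rewrite /= in_itv/= => /andP[t0 _]; apply: dens_ge0.
exact: lt_trans (dy_gt0 _) t0.
Qed.

Lemma block_mass_sum M : (\sum_(0 <= m < M) block_mass m = \int[leb]_(t in `]dy M, 1%R]) dens t)%E.
Proof.
elim: M => [|M IH].
  by rewrite big_geq// /dy expr0 set_itvoc0 integral_set0.
rewrite big_nat_recr//= IH.
have := @integral_chain (fun i => if i is i'.+1 then (if i' is 0%N then dy M else 1) else dy M.+1) 2.
rewrite big_ord_recr big_ord1 /= => ->; rewrite ?dy_le1 ?(ltW (dy_gt0 _))//.
  by rewrite addeC.
by case=> [|[|]]// _; rewrite ?dy_le1// ltW// dy_lt.
Qed.

Lemma block_mass_summable : (\sum_(0 <= m <oo) block_mass m < +oo)%E.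
Proof.
apply: le_lt_trans dens_lty; apply: lime_le.
  by apply: is_cvg_nneseries => m _ _; exact: block_mass_ge0.
apply: nearW => M; rewrite block_mass_sum; apply: ge0_subset_integral => //.
- exact: measurable_dens.
- by apply: subset_itv; rewrite bnd_simp// ltW// dy_gt0.
Qed.

Lemma unif_cont_h : unif_cont_on h 0 1.
Proof. exact: within_unif_continuous. Qed.

Lemma normpow_diff (u v : R) : `|u| `^ p <= `|v| `^ p + `|u - v| `^ p.
Proof. by rewrite (le_trans _ (normpowD p01 _ _))// addrC subrK. Qed.

(** The mesh is below [eta * dy m.+1], hence below [eta * x i], and so fine that the p-th power of
    [|h (x i) - h t|] is at most [dy m.+1 / 4]. Thus [s i] exceeds the p-th power of [|h t|] by at
    most [dy m.+1 / 2], and the last claim follows from [dy m.+1 <= x i] and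
    [t <= dy m = 2 * dy m.+1 <= 2 * x i]. *)
Lemma block_choice (eta : R) m : 0 < eta -> exists n : nat,
  let x := unif_part (dy m.+1) (dy m) n.+1 in
  let s i := `|h (x i)| `^ p + dy m.+1 / 4 in
  forall i, (i <= n)%N -> [/\ x i.+1 - x i <= eta * x i,
    forall t, x i <= t <= x i.+1 -> `|h t| `^ p <= s i &
    forall t, x i <= t <= x i.+1 -> s i / x i <= 2 * k t + 1].
Proof.
move=> eta0; have d0 := @dy_gt0 R m.+1; have dlt := @dy_lt R m.
have e0 : 0 < (dy m.+1 / 4) `^ p^-1 by rewrite powR_gt0// divr_gt0.
have [dl dl0 Hdl] := unif_cont_h e0.
have mn0 : 0 < Num.min dl (eta * dy m.+1) by rewrite lt_min dl0 mulr_gt0.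
have [n Hn] := unif_part_fine dlt mn0; exists n => x s i iN.
have xP := unif_partP n dlt; have xI := is_partition_itv xP.
have /andP[xi1 xi2] := xI i (leq_trans iN (leqnSn _)); have /andP[xj1 xj2] := xI i.+1 iN.
have := Hn n i (leqnn n); rewrite -/(x i) -/(x i.+1) lt_min => /andP[w1 w2].
have xi0 : 0 < x i := lt_le_trans d0 xi1.
have osc t : x i <= t <= x i.+1 -> `|h (x i) - h t| `^ p <= dy m.+1 / 4.
  move=> /andP[t1 t2].
  have -> : dy m.+1 / 4 = ((dy m.+1 / 4) `^ p^-1) `^ p.
    by rewrite -powRrM mulVf ?powRr1 ?gt_eqF//; [rewrite divr_ge0// ltW|case/andP: p01].
  apply: powR_le_mono => //; apply/ltW/Hdl.
  - by rewrite (ltW xi0) (le_trans xi2)// dy_le1.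
  - by rewrite (le_trans (ltW xi0) t1) (le_trans t2)// (le_trans xj2)// dy_le1.
  - by rewrite distrC ger0_norm; lra.
split.
- by rewrite (le_trans (ltW w2))// ler_wpM2l// ltW.
- move=> t Ht; rewrite /s (le_trans (normpow_diff _ (h (x i))))// lerD2l distrC.
  exact: osc.
- move=> t Ht; have /andP[t1 t2] := Ht; have t0 : 0 < t := lt_le_trans xi0 t1.
  have st : s i <= `|h t| `^ p + dy m.+1 / 2.
    rewrite /s; have := normpow_diff (h (x i)) (h t); have := osc t Ht; lra.
  have tx : t <= 2 * x i.
    have xi1' : dy m.+1 <= x i by [].
    have := @dyS R m; have xj2' : x i.+1 <= dy m by []; lra.
  rewrite ler_pdivrMr// (le_trans st)//.
  have -> : (2 * k t + 1) * x i = `|h t| `^ p * (2 * x i / t) + x i.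
    by field; rewrite gt_eqF.
  apply: lerD; last by have xi1' : dy m.+1 <= x i by []; lra.
  by rewrite ler_peMr ?powR_ge0// ler_pdivlMr// mul1r.
Qed.

(** Otherwise, with [c] the p-th power of [|h 0|], [dens] is at least [c / dy m] on every deep
    block, whose length is [dy m / 2]. Each such block then has mass at least [c / 2], against
    summability. *)
Lemma h0_eq0 : h 0 = 0.
Proof.
have p0 : 0 < p by case/andP: p01.
apply/eqP/negPn/negP => h0; have c0 : 0 < `|h 0| `^ p by rewrite powR_gt0 ?normr_gt0.
have e0 : 0 < (`|h 0| `^ p / 2) `^ p^-1 by rewrite powR_gt0// divr_gt0.
have [dl dl0 Hdl] := unif_cont_h e0.
have := nneseries_tail_cvg block_mass_summable (fun m _ => block_mass_ge0 m).
have q0 : 0 < `|h 0| `^ p / 2 by rewrite divr_gt0.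
move=> /fine_cvgP[[M1 _ HM1] /cvgrPdist_lt/(_ _ q0)[M2 _ HM2]].
have [M3 HM3] : exists M, dy M < dl.
  have ia0 : 0 <= dl^-1 by rewrite invr_ge0 ltW.
  exists (Num.bound dl^-1); rewrite /dy exprVn -[ltRHS]invrK ltf_pV2 ?posrE ?invr_gt0 ?exprn_gt0//.
  apply/(lt_le_trans (archi_boundP ia0)).
  by rewrite -natrX ler_nat ltnW// ltn_expl.
pose m := maxn M1 (maxn M2 M3).
have {}HM1 := HM1 m; have {}HM2 := HM2 m.
have m1 : (M1 <= m)%N by rewrite leq_maxl.
have m2 : (M2 <= m)%N by rewrite /m maxnCA leq_maxl.
have m3 : (M3 <= m)%N by rewrite /m maxnA leq_maxr.
have /= := HM2 m2; rewrite sub0r normrN => tail_small.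
have tail_fin : (\sum_(m <= i <oo) block_mass i)%E \is a fin_num := HM1 m1.
suff : ((`|h 0| `^ p / 2)%:E <= \sum_(m <= i <oo) block_mass i)%E.
  rewrite -(fineK tail_fin) lee_fin leNgt => /negP; apply.
  exact: le_lt_trans (ler_norm _) tail_small.
have -> : (\sum_(m <= i <oo) block_mass i = block_mass m + \sum_(m.+1 <= i <oo) block_mass i)%E.
  rewrite (@nneseries_split _ _ m 1) ?addn1 ?big_nat1// => i _; exact: block_mass_ge0.
apply: (@le_trans _ _ (block_mass m)); last first.
  by rewrite leeDl// nneseries_ge0// => i _ _; exact: block_mass_ge0.
have dm0 := @dy_gt0 R m; have dlt := @dy_lt R m.
apply: (@le_trans _ _ (\int[leb]_(t in `]dy m.+1, dy m]) (`|h 0| `^ p / dy m)%:E)%E).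
  rewrite integral_itv_cst// lee_fin.
  by rewrite dyS le_eqVlt; apply/orP; left; apply/eqP; field; rewrite gt_eqF.
have sub : (`]dy m.+1, dy m]%classic : set R) `<=` `]0, 1]%classic.
  by move=> t; rewrite /= !in_itv/= => /andP[t1 t2];
    rewrite (lt_trans (dy_gt0 m.+1) t1) (le_trans t2)// dy_le1.
apply: ge0_le_integral => //.
- by move=> t _; rewrite lee_fin divr_ge0 ?powR_ge0// ltW.
- exact: measurable_dens.
- move=> t; rewrite /= in_itv/= => /andP[t1 t2]; rewrite lee_fin.
  have t0 : 0 < t := lt_trans (@dy_gt0 R m.+1) t1.
  have ht : `|h 0 - h t| `^ p <= `|h 0| `^ p / 2.
    have -> : `|h 0| `^ p / 2 = ((`|h 0| `^ p / 2) `^ p^-1) `^ p.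
      by rewrite -powRrM mulVf ?gt_eqF// powRr1// divr_ge0// ltW.
    apply: powR_le_mono => //; apply/ltW/Hdl; rewrite ?lexx ?ler01//.
      by rewrite (ltW t0) (le_trans t2)// dy_le1.
    rewrite sub0r normrN gtr0_norm//; apply: (le_lt_trans t2).
    by apply: le_lt_trans HM3; exact: dy_anti.
  have hh : `|h 0| `^ p <= 2 * `|h t| `^ p.
    have := normpow_diff (h 0) (h t); lra.
  apply: (@le_trans _ _ (2 * k t)); last by rewrite lerDl.
  rewrite mulrA; apply: ler_pM => //; first by rewrite invr_ge0 ltW.
  by rewrite lef_pV2.
Qed.

Lemma h_vanish e : 0 < e -> exists2 dl : R, 0 < dl &
  forall a, 0 < a < dl -> a <= 1 -> `|h a| `^ p < e.
Proof.
move=> e0; have p0 : 0 < p by case/andP: p01.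
have e1 : 0 < e `^ p^-1 by rewrite powR_gt0.
have [dl dl0 H] := unif_cont_h e1; exists dl => // a /andP[a0 adl] a1.
have -> : e = (e `^ p^-1) `^ p by rewrite -powRrM mulVf ?gt_eqF// powRr1// ltW.
apply: gt0_ltr_powR; rewrite ?nnegrE//; first exact: ltW.
have : `|h 0 - h a| < e `^ p^-1.
  apply: H; rewrite ?lexx ?ler01 ?(ltW a0)//.
  by rewrite sub0r normrN gtr0_norm.
by rewrite h0_eq0 sub0r normrN.
Qed.

End weighted_integral.

(** * Convergence near zero *)

Section integral_near_zero.
Context {R : realType} (nu : probability (LipG R) R).
Local Notation point := ((R * R) * LipG R)%type.
Context d (Omega : measurableType d) (P : probability Omega R).
Variable N : Omega -> set point.
Hypothesis NP : poisson_process P (pp_intensity nu) N.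
Hypothesis Nsep : forall w, separated (N w).
Variables (z0 p Phi beta : R).
Hypothesis p01 : 0 < p <= 1.
Hypothesis PhiE : (\int[nu]_f (slope p f)%:E = Phi%:E)%E.
Hypothesis betaE : (\int[nu]_f (displacement z0 p f)%:E = beta%:E)%E.
Hypothesis Phi1 : Phi < 1.
Variable h : R -> R.
Hypothesis hc : {within `[0, 1], continuous h}.
Hypothesis kint :
  (\int[@lebesgue_measure R]_(t in `]0%R, 1%R]) ((`|h t| `^ p) / t)%:E < +oo)%E.
Variable n : nat -> nat.
Local Notation xx m := (@unif_part R (dy m.+1) (dy m) (n m).+1).
Local Notation ss m i := (`|h (xx m i)| `^ p + dy m.+1 / 4).
Hypothesis nP : forall m i, (i <= n m)%N ->
  [/\ xx m i.+1 - xx m i <= step_ratio Phi * xx m i,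
    forall t, xx m i <= t <= xx m i.+1 -> `|h t| `^ p <= ss m i &
    forall t, xx m i <= t <= xx m i.+1 ->
      ss m i / xx m i <= 2 * ((`|h t| `^ p) / t) + 1].
Local Notation K := (kconst Phi beta).
Local Notation zt w := (zeta z0 (N w)).

Let xP m : is_partition (dy m.+1) (dy m) (n m).+1 (xx m).
Proof. by apply: unif_partP; exact: dy_lt. Qed.

Let x_gt0 m i : (i <= (n m).+1)%N -> 0 < xx m i.
Proof.
by move=> iN; have /andP[] := is_partition_itv (xP m) iN => /(lt_le_trans (dy_gt0 _)).
Qed.
Let x_le1 m i : (i <= (n m).+1)%N -> xx m i <= 1.
Proof.
by move=> iN; have /andP[_] := is_partition_itv (xP m) iN => /le_trans; apply; exact: dy_le1.
Qed.
Let x_lt m i : (i <= n m)%N -> xx m i < xx m i.+1.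
Proof. by move=> iN; have [_ _] := xP m; apply. Qed.
Let s_gt0 m i : 0 < ss m i.
Proof. by rewrite ltr_wpDl ?powR_ge0// divr_gt0// dy_gt0. Qed.

Let K0 : 0 <= K. Proof. exact: (kconst_ge0 PhiE betaE Phi1). Qed.

Let Ws m i := Wsup N z0 p (xx m i) (xx m i.+1).
Let Vs m i := Vsup N z0 p (xx m i) (xx m i.+1).

Let WsI m i : (i <= n m)%N ->
  measurable_fun setT (Ws m i) /\ (\int[P]_w Ws m i w <= K%:E)%E.
Proof.
move=> iN; have [st _ _] := nP iN.
exact: (Wsup_integral NP Nsep PhiE betaE Phi1 (x_gt0 (leqW iN)) (ltW (x_lt iN)) (x_le1 (i := i.+1) iN) st).
Qed.
Let VsI m i : (i <= n m)%N -> measurable_fun setT (Vs m i) /\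
  (\int[P]_w Vs m i w <= (K * ((xx m i.+1 - xx m i) / xx m i))%:E)%E.
Proof.
move=> iN; have [st _ _] := nP iN.
exact: (Vsup_integral NP Nsep PhiE betaE Phi1 (x_gt0 (leqW iN)) (ltW (x_lt iN)) (x_le1 (i := i.+1) iN) st).
Qed.

Let Ws0 m i w : (0 <= Ws m i w)%E. Proof. exact: Wsup_ge0. Qed.
Let Vs0 m i w : (0 <= Vs m i w)%E. Proof. exact: Vsup_ge0. Qed.

(** [Xe m] will dominate the p-th power of the integral over block [m], and [Te M] the sum of these
    from block [M] on; finiteness of [Wm m] makes the limits defining [zeta] exist on block [m]. *)
Let Xe m w : \bar R := (\sum_(i < (n m).+1) (ss m i)%:E * Vs m i w)%E.
Let Wm m w : \bar R := (\sum_(i < (n m).+1) Ws m i w)%E.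
Let Te M w : \bar R := (\sum_(M <= m <oo) Xe m w)%E.
Let mass m := block_mass h p m.
Let tailK M : \bar R := (\sum_(M <= m <oo) K%:E * mass m)%E.

Let Xe0 m w : (0 <= Xe m w)%E.
Proof. by apply: sume_ge0 => i _; rewrite mule_ge0// lee_fin ltW. Qed.
Let mXe m : measurable_fun setT (Xe m).
Proof.
apply: emeasurable_sum => i; apply: emeasurable_funM => //.
by have [] := @VsI m i (ltn_ord i).
Qed.

(** On a cell from [x] to [x'] the mean of [Vs] is at most [K * (x' - x) / x], and the supremum
    bound divided by [x] is at most [dens] throughout the cell; summing the integrals over the cells
    gives the mass of the block. *)
Let XeI m : (\int[P]_w Xe m w <= K%:E * mass m)%E.
Proof.
rewrite /Xe ge0_integral_sum//; last 2 first.
- move=> i; apply: emeasurable_funM => //; by have [] := @VsI m i (ltn_ord i).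
- by move=> i w _; rewrite mule_ge0// lee_fin ltW.
have [u0 un _] := xP m.
have d0 := dy_gt0 (R := R) m.+1.
have -> : mass m = (\sum_(i < (n m).+1)
    \int[@lebesgue_measure R]_(t in `]xx m i, xx m i.+1]) dens h p t)%E.
  have := @integral_chain R h p hc (xx m) (n m).+1 (fun i iN => ltW (x_lt iN)).
  by rewrite u0 un dy_le1 (ltW d0) /mass /block_mass => ->.
rewrite ge0_sume_distrr; last first.
  move=> i _; apply: integral_ge0 => t; rewrite /= in_itv/= => /andP[t1 _].
  by apply: dens_ge0; apply: lt_trans t1; apply: x_gt0; exact: ltnW (ltn_ord i).
apply: lee_sum => i _; have iN : (i <= n m)%N by rewrite -ltnS.
have [mV IV] := VsI iN; have [_ _ sk] := nP iN.
rewrite ge0_integralZl_EFin//; last exact: ltW.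
have xi0 := x_gt0 (leqW iN : (i <= (n m).+1)%N).
apply: (@le_trans _ _ ((ss m i)%:E * (K * ((xx m i.+1 - xx m i) / xx m i))%:E)%E).
  by apply: lee_wpmul2l => //; rewrite lee_fin ltW.
rewrite -EFinM.
have -> : ss m i * (K * ((xx m i.+1 - xx m i) / xx m i)) =
  K * (ss m i / xx m i * (xx m i.+1 - xx m i)) by ring.
rewrite EFinM; apply: lee_wpmul2l; first by rewrite lee_fin.
rewrite -integral_itv_cst ?x_lt//.
have sub : (`]xx m i, xx m i.+1]%classic : set R) `<=` `]0, 1]%classic.
  move=> t; rewrite /= !in_itv/= => /andP[t1 t2].
  by rewrite (lt_trans xi0 t1) (le_trans t2)// x_le1.
apply: ge0_le_integral => //.
- by move=> t _; rewrite lee_fin divr_ge0 ?ltW.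
- exact: measurable_dens.
- move=> t; rewrite /= in_itv/= => /andP[t1 t2]; rewrite lee_fin; apply: sk.
  by rewrite (ltW t1).
Qed.

Let Te0 M w : (0 <= Te M w)%E. Proof. by apply: nneseries_ge0. Qed.

Let TeE M : Te M = (fun w => \sum_(0 <= m <oo) Xe (m + M) w)%E.
Proof. by apply/funext => w; apply/esym/(@nneseries_addn R (Xe^~ w)) => m. Qed.

Let mTe M : measurable_fun setT (Te M).
Proof. by rewrite TeE; apply: ge0_emeasurable_sum. Qed.

Let mass0 m : (0 <= mass m)%E. Proof. exact: block_mass_ge0. Qed.
Let Kmass0 m : (0 <= K%:E * mass m)%E. Proof. by rewrite mule_ge0// lee_fin. Qed.

Let TeI M : (\int[P]_w Te M w <= tailK M)%E.
Proof.
rewrite TeE integral_nneseries// /tailK -(@nneseries_addn R (fun m => K%:E * mass m)%E)//.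
by apply: lee_nneseries => m *; [apply: integral_ge0|exact: XeI].
Qed.

Let tailK_lty : (tailK 0 < +oo)%E.
Proof.
rewrite /tailK nneseriesZl//; have := block_mass_summable hc kint => H.
by rewrite lte_mul_pinfty// lee_fin.
Qed.

Let tailK_cvg0 : tailK M @[M --> \oo] --> 0%E.
Proof. by apply: nneseries_tail_cvg. Qed.

Let tailK_anti M M' : (M <= M')%N -> (tailK M' <= tailK M)%E.
Proof.
move=> MM; rewrite /tailK (@nneseries_split _ _ M (M' - M)) ?subnKC//.
by rewrite leeDr// sume_ge0.
Qed.

Let mWm m : measurable_fun setT (Wm m).
Proof. by apply: emeasurable_sum => i; have [] := @WsI m i (ltn_ord i). Qed.
Let Wm0 m w : (0 <= Wm m w)%E. Proof. exact: sume_ge0. Qed.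
Let WmI m : (\int[P]_w Wm m w < +oo)%E.
Proof.
rewrite /Wm ge0_integral_sum//; last first.
  by move=> i; have [] := @WsI m i (ltn_ord i).
apply: (@le_lt_trans _ _ (\sum_(i < (n m).+1) K%:E)%E); last by rewrite sumEFin ltry.
by apply: lee_sum => i _; have [] := @WsI m i (ltn_ord i).
Qed.

Definition reg_event : set Omega :=
  (\bigcap_m [set w | Wm m w < +oo] `&` [set w | Te 0 w < +oo])%E.

Lemma finite_ae_null (f : Omega -> \bar R) : measurable_fun setT f ->
  (forall w, 0 <= f w)%E -> (\int[P]_w f w < +oo)%E ->
  measurable [set w | (f w < +oo)%E] /\ P (~` [set w | (f w < +oo)%E]) = 0%E.
Proof.
move=> mf f0 fi.
have mF : measurable [set w | (f w < +oo)%E].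
  by rewrite -[X in measurable X]setTI; exact: emeasurable_fun_infty_o.
split => //; have intf : P.-integrable setT f.
  apply/integrableP; split => //.
  rewrite (eq_integral f)// => w _; exact: gee0_abs.
have [A [mA A0 sA]] := integrable_ae measurableT intf.
apply/eqP; rewrite eq_le measure_ge0 andbT -A0 le_measure ?inE//; first exact: measurableC.
move=> w /= nf; apply: sA => /= H; apply: nf.
by have := H I; rewrite ge0_fin_numE.
Qed.

Lemma reg_event_full : measurable reg_event /\ P (~` reg_event) = 0%E.
Proof.
have [m1 n1] := finite_ae_null (mTe 0) (Te0 0) (le_lt_trans (TeI 0) tailK_lty).
have H m := finite_ae_null (mWm m) (Wm0 m) (WmI m).
have m2 : measurable (\bigcap_m [set w | Wm m w < +oo])%E.
  by apply: bigcapT_measurable => m; have [] := H m.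
split; first exact: measurableI.
rewrite setCI; apply: null_set_setU => //; try exact: measurableC.
rewrite setC_bigcap; apply/eqP; rewrite eq_le measure_ge0 andbT.
have mC m : measurable (~` [set w | Wm m w < +oo])%E by apply: measurableC; have [] := H m.
apply: (le_trans (generalized_Boole_inequality P mC _)); first exact: bigcupT_measurable.
by rewrite eseries0// => m _ _; have [] := H m.
Qed.

Section regular_sample.
Variable w : Omega.
Hypothesis Gw : reg_event w.

Let Wfin m i : (i <= n m)%N -> (Ws m i w < +oo)%E.
Proof.
move=> iN; have [/(_ m I) /= H _] := Gw; apply: le_lt_trans H.
rewrite /Wm (bigD1 (Ordinal (iN : (i < (n m).+1)%N)))//= leeDl// sume_ge0//.
Qed.

(** [ss m i] is strictly positive thanks to its term [dy m.+1 / 4], even where [h] vanishes, so an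
    infinite [Vs m i w] would make [Te 0 w] infinite. *)
Let Vfin m i : (i <= n m)%N -> Vs m i w \is a fin_num.
Proof.
move=> iN; have [_ /= H] := Gw; rewrite ge0_fin_numE// ltNge leye_eq; apply/negP => /eqP Vy.
move: H; rewrite ltNge leye_eq => /negP; apply; rewrite -leye_eq.
rewrite /Te (@nneseriesD1 _ _ m xpredT)//.
apply: (@le_trans _ _ (Xe m w)); last by rewrite leeDl// nneseries_ge0.
rewrite /Xe (bigD1 (Ordinal (iN : (i < (n m).+1)%N)))//= Vy gt0_muley ?lte_fin//.
by rewrite leeDl// sume_ge0// => j _; rewrite mule_ge0// lee_fin ltW.
Qed.

Let V m i := fine (Vs m i w).
Let s m i := ss m i.

Let hs m i : (i <= n m)%N -> forall t, xx m i <= t <= xx m i.+1 -> `|h t| `^ p <= s m i.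
Proof. by move=> /nP[]. Qed.

Let gV m i : (i <= n m)%N -> forall k (z : nat -> R),
  (forall j, (j <= k)%N -> xx m i <= z j <= xx m i.+1) ->
  (forall j, (j < k)%N -> z j <= z j.+1) ->
  \sum_(j < k) `|zt w (z j.+1) - zt w (z j)| `^ p <= V m i.
Proof.
move=> iN k z zI zm; rewrite -lee_fin fineK ?Vfin//.
exact: (zeta_variation Nsep p01 (x_gt0 (leqW iN)) (ltW (x_lt iN)) (x_le1 (i := i.+1) iN) (Wfin iN) zI zm).
Qed.

Let bbE m : ((block_bound n s V m)%:E = Xe m w)%E.
Proof.
rewrite /block_bound -sumEFin; apply: eq_bigr => i _.
by rewrite EFinM fineK// Vfin// -ltnS.
Qed.

Let summ : (\sum_(0 <= m <oo) (block_bound n s V m)%:E < +oo)%E.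
Proof. by under eq_eseriesr do rewrite bbE; have [] := Gw. Qed.

Let hu := unif_cont_h hc.

Let tailE M : tail_bound n s V M = Te M w.
Proof. by rewrite /tail_bound; under eq_eseriesr do rewrite bbE. Qed.

Lemma zeta_cvg_reg z : 0 < z <= 1 -> zeta_t z0 (N w) t z @[t --> +oo] --> zt w z.
Proof.
move=> /andP[z_gt0 z1]; have [m mz] : exists m, dy m.+1 <= z <= dy m.
  move: z1; rewrite le_eqVlt => /predU1P[->|z1].
    by exists 0%N; rewrite dy_le1 /dy expr0 lexx.
  have [|M /andP[M1 M2]] := @dy_locate _ z; first by rewrite z_gt0.
  by exists M; rewrite M1 ltW.
have [i iN zi] := partition_locate (xP m) (ltn0Sn _) mz.
by apply: (zeta_cvg Nsep p01 (x_gt0 (leqW iN)) (ltW (x_lt iN)) (x_le1 (i := i.+1) iN) (Wfin iN)).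
Qed.

Lemma rs_reg a c : 0 < a -> a < c -> c <= 1 ->
  is_RS_integral h (zt w) a c (RS_integral h (zt w) a c).
Proof. exact: (rs_exists01 p01 hu xP gV). Qed.

Lemma block_sum_cvg_reg : block_sum h (zt w) k @[k --> \oo] --> block_lim h (zt w).
Proof. exact: (block_sum_cvg p01 hu xP hs gV summ). Qed.

Lemma RS_lim_dist_reg M a : dy M.+1 <= a < dy M ->
  ((`|RS_integral h (zt w) a 1 - block_lim h (zt w)| `^ p)%:E <= Te M w + Te M w)%E.
Proof. by rewrite -tailE; exact: (RS_lim_dist p01 hu xP hs gV summ). Qed.

Lemma block_lim_bound_reg : ((`|block_lim h (zt w)| `^ p)%:E <= Te 0 w)%E.
Proof. by rewrite -tailE; exact: (block_lim_bound p01 hu xP hs gV summ). Qed.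

End regular_sample.

(* [reg_zero f] is used because [f] itself need not be measurable: off [reg_event] the
   limits below are junk values. *)
Definition reg_zero (f : Omega -> R) w : R := \1_reg_event w * f w.

Lemma reg_zero_cvg (u : nat -> Omega -> R) (f : Omega -> R) :
  (forall k, measurable_fun setT (reg_zero (u k))) ->
  (forall w, reg_event w -> u k w @[k --> \oo] --> f w) ->
  measurable_fun setT (reg_zero f).
Proof.
move=> mu uf; apply: (@measurable_fun_cvg _ _ _ _ (fun k => reg_zero (u k))) => // w _.
rewrite /reg_zero indicE; case: (boolP (w \in reg_event)) => [/set_mem gw|_] /=.
  by apply: cvgMr; exact: uf.
by under eq_fun do rewrite mul0r; rewrite mul0r; exact: cvg_cst.
Qed.

Lemma measurable_reg_zeta z : 0 < z <= 1 -> measurable_fun setT (reg_zero (fun w => zt w z)).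
Proof.
move=> z01; have [mG _] := reg_event_full; have z01' : 0 <= z <= 1.
  by case/andP: z01 => /ltW -> ->.
apply: (@reg_zero_cvg (fun k w => compose_le z0 (slist (N w) 0 k%:R) z)).
  move=> k; apply: measurable_funM; first exact: measurable_indic.
  exact: (measurable_compose_slist NP Nsep).
move=> w gw; under eq_fun => k do rewrite -zeta_tE//.
have := zeta_cvg_reg gw z01 => H.
by apply: (cvg_comp _ _ (@cvgr_idn R) H).
Qed.

Lemma reg_zeroB f g : reg_zero (fun w => f w - g w) = (fun w => reg_zero f w - reg_zero g w).
Proof. by apply/funext => w; rewrite /reg_zero mulrBr. Qed.
Lemma reg_zeroM c f : reg_zero (fun w => c * f w) = (fun w => c * reg_zero f w).
Proof. by apply/funext => w; rewrite /reg_zero mulrCA. Qed.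
Lemma reg_zero_sum k (f : nat -> Omega -> R) :
  reg_zero (fun w => \sum_(i < k) f i w) = (fun w => \sum_(i < k) reg_zero (f i) w).
Proof. by apply/funext => w; rewrite /reg_zero mulr_sumr. Qed.

Lemma measurable_block_int m : measurable_fun setT (reg_zero (fun w => block_int h (zt w) m)).
Proof.
have dlt := dy_lt (R := R) m; have d0 := dy_gt0 (R := R) m.+1.
apply: (@reg_zero_cvg (fun k w => unif_sum h (zt w) (dy m.+1) (dy m) k)); last first.
  by move=> w gw; apply: (is_RS_integral_cvg dlt); apply: rs_reg => //; exact: dy_le1.
move=> k; rewrite /unif_sum /rs_sum.
have xI := is_partition_itv (unif_partP k dlt).
rewrite (@reg_zero_sum _ (fun i w => h (unif_part (dy m.+1) (dy m) k.+1 i) *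
  (zt w (unif_part (dy m.+1) (dy m) k.+1 i.+1) - zt w (unif_part (dy m.+1) (dy m) k.+1 i)))).
have in01 i : (i <= k.+1)%N -> 0 < @unif_part R (dy m.+1) (dy m) k.+1 i <= 1.
  move=> ik; have /andP[i1 i2] := xI i ik; apply/andP; split.
    exact: lt_le_trans d0 i1.
  exact: le_trans i2 (dy_le1 _).
apply: measurable_sum => i; rewrite reg_zeroM; apply: measurable_funM => //.
rewrite reg_zeroB; apply: measurable_funB; apply: measurable_reg_zeta; apply: in01 => //.
exact: ltnW.
Qed.

(** The boundary term at [a] tends to 0 in L^p, and [block_lim] is the sum of the integrals over all
    dyadic blocks. *)
Definition limit_variable (w : Omega) : R :=
  reg_zero (fun w => zt w 1 * h 1 - block_lim h (zt w)) w.

Lemma measurable_limit_variable : measurable_fun setT limit_variable.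
Proof.
rewrite /limit_variable reg_zeroB; apply: measurable_funB.
  rewrite (_ : (fun w => zt w 1 * h 1) = (fun w => h 1 * zt w 1)).
    by rewrite reg_zeroM; apply: measurable_funM => //; apply: measurable_reg_zeta; rewrite ltr01 lexx.
  by apply/funext => w; rewrite mulrC.
apply: (@reg_zero_cvg (fun k w => block_sum h (zt w) k)); last first.
  by move=> w; exact: block_sum_cvg_reg.
move=> k; rewrite /block_sum (@reg_zero_sum _ (fun m w => block_int h (zt w) m)).
by apply: measurable_sum => m; exact: measurable_block_int.
Qed.

(** The degenerate interval [x = y = a] meets the step condition for every [a], which bounds the
    p-th moment of [zeta a] uniformly in [a]. *)
Let Wpt a := Wsup N z0 p a a.
Let WptI a : 0 < a <= 1 -> measurable_fun setT (Wpt a) /\ (\int[P]_w Wpt a w <= K%:E)%E.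
Proof.
move=> /andP[a0 a1].
apply: (Wsup_integral NP Nsep PhiE betaE Phi1 a0 (lexx a) a1).
by rewrite subrr mulr_ge0 ?(ltW a0)// divr_ge0// subr_ge0 ltW.
Qed.
Let Wpt0 a w : (0 <= Wpt a w)%E. Proof. exact: Wsup_ge0. Qed.

Let zeta_pt a w : 0 < a <= 1 -> ((`|zt w a| `^ p)%:E <= (`|z0| `^ p)%:E + Wpt a w)%E.
Proof.
move=> /andP[a0 a1].
have := zeta_bound Nsep z0 p01 a0 (lexx a) a1 w (z := a).
rewrite lexx => /(_ isT) H; apply: (@le_trans _ _ ((`|z0| `^ p)%:E + (`|zt w a - z0| `^ p)%:E)%E).
  by rewrite -EFinD lee_fin (le_trans _ (normpowD p01 _ _))// addrC subrK.
exact: leeD.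
Qed.

Let dom (c a : R) M w : \bar R := (c%:E * ((`|z0| `^ p)%:E + Wpt a w) + (Te M w + Te M w))%E.

Let dom_integral c a M : 0 <= c -> 0 < a <= 1 -> measurable_fun setT (dom c a M) /\
  (\int[P]_w dom c a M w <= (c * (`|z0| `^ p + K))%:E + (tailK M + tailK M))%E.
Proof.
move=> c0 a01; have [mW IW] := WptI a01.
have m1 : measurable_fun setT (fun w => (`|z0| `^ p)%:E + Wpt a w)%E.
  by apply: emeasurable_funD.
have m2 : measurable_fun setT (fun w => c%:E * ((`|z0| `^ p)%:E + Wpt a w))%E.
  by apply: emeasurable_funM.
have m3 : measurable_fun setT (fun w => Te M w + Te M w)%E.
  by apply: emeasurable_funD.
have z0p : (0 <= (`|z0| `^ p)%:E)%E by rewrite lee_fin powR_ge0.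
have p1 w : (0 <= (`|z0| `^ p)%:E + Wpt a w)%E by rewrite adde_ge0.
split; first exact: emeasurable_funD.
rewrite /dom ge0_integralD//; last 2 first.
- by move=> w _; rewrite mule_ge0.
- by move=> w _; rewrite adde_ge0.
apply: leeD.
  rewrite ge0_integralZl_EFin// EFinM; apply: lee_wpmul2l; first by rewrite lee_fin.
  rewrite ge0_integralD// EFinD; apply: leeD => //.
  apply: (@le_trans _ _ ((`|z0| `^ p)%:E * P setT)%E).
    by rewrite le_eqVlt; apply/orP; left; apply/eqP; exact: (integral_cst P measurableT).
  by rewrite probability_setT mule1.
by rewrite ge0_integralD//; apply: leeD; exact: TeI.
Qed.

Let limit_variableE w : reg_event w -> limit_variable w = zt w 1 * h 1 - block_lim h (zt w).
Proof. by move=> gw; rewrite /limit_variable /reg_zero indicE mem_set// mul1r. Qed.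

Let one01 : 0 < (1 : R) <= 1. Proof. by rewrite ltr01 lexx. Qed.

Lemma limit_variable_Lp : (\int[P]_w (`|limit_variable w| `^ p)%:E < +oo)%E.
Proof.
have [mG nG] := reg_event_full.
have [md Id] := dom_integral 0 (powR_ge0 `|h 1| p) one01.
apply: (@le_lt_trans _ _ (\int[P]_w dom (`|h 1| `^ p) 1 0 w)%E); last first.
  by apply: (le_lt_trans Id); rewrite lte_add_pinfty ?ltry// lte_add_pinfty.
apply: (le_integral_off_null mG nG md).
- by move=> w; rewrite lee_fin powR_ge0.
- move=> w; rewrite adde_ge0 ?mule_ge0 ?adde_ge0// ?lee_fin ?powR_ge0//.
move=> w gw; rewrite limit_variableE//.
apply: (@le_trans _ _ ((`|h 1| `^ p)%:E * (`|zt w 1| `^ p)%:E +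
    (`|block_lim h (zt w)| `^ p)%:E)%E).
  rewrite -EFinM -EFinD lee_fin -powRM// -normrM (mulrC (h 1)).
  by rewrite -[in leRHS](normrN (block_lim _ _)); exact: normpowD.
apply: leeD.
  by apply: lee_wpmul2l; [rewrite lee_fin powR_ge0|exact: zeta_pt].
apply: (le_trans (block_lim_bound_reg gw)); by rewrite leeDl.
Qed.

(** [N0] stands for the given process and [N] for its separated modification, equal to it on the
    full event [G0]. *)
Variables (N0 : Omega -> set point) (G0 : set Omega).
Hypothesis mG0 : measurable G0.
Hypothesis nG0 : P (~` G0) = 0%E.
Hypothesis N0E : forall w, G0 w -> N0 w = N w.

(** The terms at 1 cancel; what remains is [h a * zeta a] and the distance of the integral over
    [(a, 1]] from [block_lim]. *)
Lemma zeta_dh_dist (M : nat) a : dy M.+1 <= a < dy M ->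
  (\int[P]_w (`|zeta_dh z0 h (N0 w) a - limit_variable w| `^ p)%:E <=
   (`|h a| `^ p * (`|z0| `^ p + K))%:E + (tailK M + tailK M))%E.
Proof.
move=> Ma; have [mG nG] := reg_event_full; have /andP[Ma1 Ma2] := Ma.
have mGG : measurable (reg_event `&` G0) by exact: measurableI.
have nGG : P (~` (reg_event `&` G0)) = 0%E.
  by rewrite setCI; apply: null_set_setU => //; exact: measurableC.
have a01 : 0 < a <= 1.
  rewrite (lt_le_trans (dy_gt0 _) Ma1)/= ltW// (lt_le_trans Ma2)// dy_le1//.
have [md Id] := dom_integral M (powR_ge0 `|h a| p) a01.
apply: le_trans Id; apply: (le_integral_off_null mGG nGG md).
- by move=> w; rewrite lee_fin powR_ge0.
- move=> w; rewrite adde_ge0 ?mule_ge0 ?adde_ge0// ?lee_fin ?powR_ge0//.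
move=> w [gw g0w]; rewrite limit_variableE// N0E// /zeta_dh.
set I := RS_integral _ _ _ _; set L := block_lim _ _.
have -> : zt w 1 * h 1 - zt w a * h a - I - (zt w 1 * h 1 - L) = - (h a * zt w a + (I - L)).
  by ring.
rewrite normrN.
apply: (@le_trans _ _ ((`|h a| `^ p)%:E * (`|zt w a| `^ p)%:E + (`|I - L| `^ p)%:E)%E).
  by rewrite -EFinM -EFinD lee_fin -powRM// -normrM; exact: normpowD.
apply: leeD; last exact: RS_lim_dist_reg.
by apply: lee_wpmul2l; [rewrite lee_fin powR_ge0|exact: zeta_pt].
Qed.

Lemma zeta_dh_cvg :
  (\int[P]_w (`|zeta_dh z0 h (N0 w) a - limit_variable w| `^ p)%:E)%E @[a --> 0^'+] --> 0%E.
Proof.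
have bnd (e : R) : 0 < e -> \forall a \near (0 : R)^'+,
    (\int[P]_w (`|zeta_dh z0 h (N0 w) a - limit_variable w| `^ p)%:E < e%:E)%E.
  (* The added 1 keeps the divisor positive. Half of [e] goes to the boundary term and a quarter to
     each of the two tails. *)
  move=> e0; have C0 : 0 < `|z0| `^ p + K + 1 by rewrite ltr_wpDl// addr_ge0 ?powR_ge0.
  have e1 : 0 < e / 2 / (`|z0| `^ p + K + 1) by rewrite !divr_gt0.
  have [dl dl0 Hdl] := h_vanish p01 hc kint e1.
  have e4 : 0 < e / 4 by rewrite divr_gt0.
  have := tailK_cvg0 => /fine_cvgP[[M1 _ HM1] /cvgrPdist_lt/(_ _ e4)[M2 _ HM2]].
  pose M0 := maxn M1 M2.
  have tfin : tailK M0 \is a fin_num := HM1 M0 (leq_maxl _ _).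
  have := HM2 M0 (leq_maxr _ _); rewrite /= sub0r normrN => tsmall.
  have tle : (tailK M0 < (e / 4)%:E)%E.
    by rewrite -(fineK tfin) lte_fin (le_lt_trans (ler_norm _) tsmall).
  have m0 : 0 < Num.min dl (dy M0) by rewrite lt_min dl0 dy_gt0.
  near=> a.
  have a0 : 0 < a by near: a; exact: nbhs_right_gt.
  have : a < Num.min dl (dy M0) by near: a; exact: nbhs_right_lt.
  rewrite lt_min => /andP[adl aM0].
  have a1 : a < 1 := lt_le_trans aM0 (dy_le1 _).
  have [|M /andP[Ma1 Ma2]] := @dy_locate _ a; first by rewrite a0.
  have MM : (M0 <= M)%N.
    rewrite leqNgt; apply/negP => MM0; have := dy_anti (R := R) MM0.
    by rewrite leNgt (le_lt_trans Ma1 aM0).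
  apply: (le_lt_trans (zeta_dh_dist (M := M) _)); first by rewrite Ma1.
  have hs : `|h a| `^ p * (`|z0| `^ p + K) <= e / 2.
    have := Hdl a; rewrite a0 adl (ltW a1) => /(_ isT isT); rewrite ltr_pdivlMr// => hh.
    apply: le_trans (ltW hh); rewrite ler_wpM2l ?powR_ge0// lerDl//.
  have tl : (tailK M < (e / 4)%:E)%E := le_lt_trans (tailK_anti MM) tle.
  rewrite [X in (_ < X%:E)%E](_ : e = e / 2 + (e / 4 + e / 4)); last by field.
  by rewrite [ltRHS]EFinD EFinD lee_ltD// ?lee_fin// lteD.
apply/fine_cvgP; split.
  have := bnd 1 ltr01; apply: filterS => a lt1.
  rewrite ge0_fin_numE; first by rewrite (lt_trans lt1)// ltry.
  by apply: integral_ge0 => w _; rewrite lee_fin powR_ge0.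
apply/cvgrPdist_lt => e e0; have := bnd e e0; apply: filterS => a lte /=.
have I0 : (0 <= \int[P]_w (`|zeta_dh z0 h (N0 w) a - limit_variable w| `^ p)%:E)%E.
  by apply: integral_ge0 => w _; rewrite lee_fin powR_ge0.
rewrite sub0r normrN ger0_norm ?fine_ge0//.
by rewrite -lte_fin fineK// ge0_fin_numE// (lt_trans lte)// ltry.
Unshelve. all: by end_near. Qed.

End integral_near_zero.

Theorem theorem5p7 (R : realType) (nu : probability (LipG R) R) (z0 : R)
  (d : measure_display) (Omega : measurableType d) (P : probability Omega R)
  (N : Omega -> set ((R * R) * LipG R)%type)
  (h : R -> R) (p : R) :
  (\int[nu]_f (Lf f)%:E < +oo)%E ->
  (\int[nu]_f elog (Lf f) < 0)%E ->
  (\int[nu]_f (`|lfun f z0 - z0|)%:E < +oo)%E ->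
  poisson_process P (pp_intensity nu) N ->
  (forall w, N w `<=` @pts_space R) ->
  {within `[0, 1], continuous h} ->
  0 < p <= 1 ->
  (\int[nu]_f ((Lf f) `^ p)%:E < 1)%E ->
  (\int[lebesgue_measure]_(t in `]0%R, 1%R]) ((`|h t| `^ p) / t)%:E < +oo)%E ->
  exists J : Omega -> R,
    measurable_fun setT J /\
    (\int[P]_w (`|J w| `^ p)%:E < +oo)%E /\
    ((\int[P]_w (`|zeta_dh z0 h (N w) a - J w| `^ p)%:E)%E @[a --> 0^'+]
       --> 0%E).
Proof.
move=> _ _ disp_lty NP Npts hc p01 Phi_lt1 kint.
have slope_fin : (\int[nu]_f (slope p f)%:E)%E \is a fin_num.
  rewrite ge0_fin_numE ?(lt_trans Phi_lt1) ?ltry//.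
  by apply: integral_ge0 => f _; rewrite lee_fin powR_ge0.
have disp_fin : (\int[nu]_f (displacement z0 p f)%:E)%E \is a fin_num.
  rewrite ge0_fin_numE; last by apply: integral_ge0 => f _; rewrite lee_fin powR_ge0.
  have mD : measurable_fun setT (fun f : LipG R => (`|lfun f z0 - z0|)%:E).
    apply/measurable_EFinP; apply: measurableT_comp => //.
    by apply: measurable_funB => //; exact: measurable_eval.
  apply: (@le_lt_trans _ _ (\int[nu]_f (1 + (`|lfun f z0 - z0|)%:E))%E).
    apply: ge0_le_integral_nonmeas => f; first by rewrite lee_fin powR_ge0.
    by rewrite -EFinD lee_fin; exact: powR_le1D.
  rewrite ge0_integralD//.
  apply: lte_add_pinfty => //.
  apply: (@le_lt_trans _ _ (1 * nu setT)%E); first by rewrite (integral_cst nu measurableT 1).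
  by rewrite mul1e; apply: le_lt_trans (probability_le1 nu measurableT) (ltry _).
have Phi1 : fine (\int[nu]_f (slope p f)%:E) < 1 by rewrite -lte_fin fineK.
set Phi := fine _ in Phi1.
have ratio0 : 0 < step_ratio Phi by rewrite divr_gt0// subr_gt0.
(* The partitions of all blocks are fixed with [eta = step_ratio Phi], so that every cell satisfies
   the step condition of the moment bounds. *)
have [n nP] := choice (fun m => block_choice p01 hc m ratio0).
have NP' := restrict_good_poisson NP.
have Nsep := restrict_good_separated Npts.
have PhiE := esym (fineK slope_fin); have betaE := esym (fineK disp_fin).
exists (limit_variable (restrict_good N) z0 p h n); split; [|split].
- exact: (measurable_limit_variable NP' Nsep p01 PhiE betaE Phi1 hc kint nP).
- exact: (limit_variable_Lp NP' Nsep p01 PhiE betaE Phi1 hc kint nP).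
- exact: (zeta_dh_cvg NP' Nsep p01 PhiE betaE Phi1 hc kint nP (measurable_good_event NP)
    (prob_good_event NP) (fun w gw => esym (restrict_goodE gw))).
Qed.
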